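(* Let $d\ge1$, $\rho\in(\tfrac12,1]$ and $n,m,p\ge0$ integers. The surface development map $$H: C^\rho([0,1]^2,\mathbb{R}^d)\times\mathcal{M}^{n,m,p}(\mathbb{R}^d)\to \mathrm{GL}_1^{n,m,p},\qquad (X,\omega)\mapsto H^\omega(X),$$ is well-defined, and is locally Lipschitz with respect to $C^\rho([0,1]^2,\mathbb{R}^d)$ and $\mathcal{M}^{n,m,p}(\mathbb{R}^d)$.
   Context: **Hölder surfaces.** For $X:[0,1]^2\to\mathbb{R}^d$ continuous and $R=[s_1,s_2]\times[t_1,t_2]$ put $\square_R[X]=X_{s_1,t_1}-X_{s_1,t_2}-X_{s_2,t_1}+X_{s_2,t_2}$, $|X|_{\rho,(1)}=\sup_{t,\,s_1<s_2}\frac{|X_{s_1,t}-X_{s_2,t}|}{|s_1-s_2|^\rho}$, $|X|_{\rho,(2)}=\sup_{s,\,t_1<t_2}\frac{|X_{s,t_1}-X_{s,t_2}|}{|t_1-t_2|^\rho}$, $|X|_{\rho,(1,2)}=\sup_{s_1<s_2,\,t_1<t_2}\frac{|\square_R[X]|}{|s_1-s_2|^\rho|t_1-t_2|^\rho}$, and $\|X\|_\rho=|X|_{\rho,(1)}+|X|_{\rho,(2)}+|X|_{\rho,(1,2)}+\|X\|_\infty$. $C^\rho([0,1]^2,\mathbb{R}^d)$ is the space of $X$ with $\|X\|_\rho<\infty$, normed by $\|\cdot\|_\rho$. **Matrix 2-connections.** Let $\phi=\begin{pmatrix}I_n&0\\0&0\end{pmatrix}\in\mathrm{Mat}_{n+p,n+m}$.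 $\mathcal{M}^{n,m,p}(\mathbb{R}^d)$ is the set of triples $\omega=(\alpha,\beta,\gamma)$ with $\alpha=\sum_i\alpha^i dx_i$, $\beta=\sum_i\beta^i dx_i$, $\gamma=\sum_{i<j}\gamma^{i,j}dx_i\wedge dx_j$, where $$\alpha^i=\begin{pmatrix}A^i&0\\ B^i&C^i\end{pmatrix},\quad \beta^i=\begin{pmatrix}A^i&D^i\\0&E^i\end{pmatrix},\quad \gamma^{i,j}=\begin{pmatrix}R^{i,j}&S^{i,j}\\ T^{i,j}&U^{i,j}\end{pmatrix},$$ with real blocks $A^i\in\mathrm{Mat}_{n,n}$, $B^i\in\mathrm{Mat}_{m,n}$, $C^i\in\mathrm{Mat}_{m,m}$, $D^i\in\mathrm{Mat}_{n,p}$, $E^i\in\mathrm{Mat}_{p,p}$, $U^{i,j}\in\mathrm{Mat}_{m,p}$ such that for all $i<j$: $[C^i,C^j]=[E^i,E^j]=0$, $R^{i,j}=[A^i,A^j]$, $S^{i,j}=A^iD^j-A^jD^i+D^iE^j-D^jE^i$, $T^{i,j}=B^iA^j-B^jA^i+C^iB^j-C^jB^i$. It carries the metric $d_{\mathcal{M}}(\omega_1,\omega_2)=\|\omega_1-\omega_2\|_{\mathrm F}$, $\|\omega\|_{\mathrm F}^2=\sum_i\|\alpha^i\|_{\mathrm F}^2+\sum_i\|\beta^i\|_{\mathrm F}^2+\sum_{i<j}\|\gamma^{i,j}\|_{\mathrm F}^2$ (Frobenius norms). $\mathrm{GL}_1^{n,m,p}$ is the set of $(n+m)\times(n+p)$ real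 matrices $\begin{pmatrix}A-I&D\\ B&U\end{pmatrix}$ with $A\in\mathrm{GL}^n$, $B\in\mathrm{Mat}_{m,n}$, $D\in\mathrm{Mat}_{n,p}$, $U\in\mathrm{Mat}_{m,p}$, with the Frobenius norm distance. **Surface development.** For a $\rho$-Hölder path $x:[0,1]\to\mathbb{R}^d$ and a matrix-valued 1-form $\alpha$, $F^\alpha(x)=F_1$ where $dF_t=F_t\,\alpha(dx_t)$, $F_0=I$ (Young sense). For $X\in C^\rho([0,1]^2,\mathbb{R}^d)$ the tail path $x^{s,t}$ is $u\mapsto X_{0,2ut}$ for $u\in[0,\frac12]$ and $u\mapsto X_{(2u-1)s,t}$ for $u\in(\frac12,1]$. The area process $A(X):[0,1]^2\to\Lambda^2\mathbb{R}^d$ has components $A^{i,j}_{s,t}(X)=\int_{0<u_1<u_2<1}dy^i_{u_1}dy^j_{u_2}$, where $y$ is the counterclockwise boundary loop (bottom, right, upper reversed, left reversed) of $X|_{[0,s]\times[0,t]}$; for smooth $X$ it equals $\int_0^t\int_0^s(\partial_sX^i\partial_tX^j-\partial_tX^i\partial_sX^j)ds'dt'$. Put $Z^\omega_{s,t}(X)=\sum_{i<j}\int_0^t\int_0^sF^\alpha(x^{s',t'})\,\gamma^{i,j}\,F^\beta(x^{s',t'})^{-1}\,dA^{i,j}_{s',t'}(X)$ (2D Young integral). The surface development is $H^\omega(X)=h_1$ where $h:[0,1]\to\mathrm{Mat}_{n+m,n+p}$ solves the Young differential equation $dh_t=(I+h_t\phi)\,dZ^\omega_{1,t}(X)$, $h_0=0$.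 Well-definedness means that these Young integrals and equations make sense and have unique solutions, and that $H^\omega(X)$ takes values in $\mathrm{GL}_1^{n,m,p}$. *)

(* Defs.v *)
From HB Require Import structures.
From mathcomp Require Import all_boot all_order all_algebra.
From mathcomp Require Import all_classical all_reals all_analysis.

Set Implicit Arguments.
Unset Strict Implicit.
Unset Printing Implicit Defensive.

Import Order.TTheory GRing.Theory Num.Theory.
Import numFieldNormedType.Exports.

Local Open Scope classical_set_scope.
Local Open Scope ring_scope.

(* Paths on [0,1] and surfaces on [0,1]^2 are represented by total functions
   on R and R * R; no definition below looks at values outside [0,1] or
   [0,1]^2. *)

Section Definitions.
Variable R : realType.

(* On row vectors this is the Euclidean norm. *)
Definition frobenius (m n : nat) (M : 'M[R]_(m, n)) : R :=
  Num.sqrt (\sum_i \sum_j M i j ^+ 2).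

Definition unit_square : set (R * R) := [set` `[0, 1]] `*` [set` `[0, 1]].

Section HolderSurfaces.
Variables (V : normedModType R) (nrm : V -> R) (rho : R).

Definition rect_incr (X : R * R -> V) (s1 s2 t1 t2 : R) : V :=
  X (s1, t1) - X (s1, t2) - X (s2, t1) + X (s2, t2).

Definition holder1 (X : R * R -> V) : \bar R := ereal_sup
  [set q | exists s1 s2 t, [/\ 0 <= s1, s1 < s2, s2 <= 1, 0 <= t <= 1 &
    q = (nrm (X (s1, t) - X (s2, t)) / `|s1 - s2| `^ rho)%:E]].

Definition holder2 (X : R * R -> V) : \bar R := ereal_sup
  [set q | exists s t1 t2, [/\ 0 <= t1, t1 < t2, t2 <= 1, 0 <= s <= 1 &
    q = (nrm (X (s, t1) - X (s, t2)) / `|t1 - t2| `^ rho)%:E]].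

Definition holder12 (X : R * R -> V) : \bar R := ereal_sup
  [set q | exists s1 s2 t1 t2, [/\ 0 <= s1 /\ 0 <= t1, s1 < s2, t1 < t2,
    s2 <= 1 /\ t2 <= 1 &
    q = (nrm (rect_incr X s1 s2 t1 t2)
         / (`|s1 - s2| `^ rho * `|t1 - t2| `^ rho))%:E]].

Definition supnorm (X : R * R -> V) : \bar R := ereal_sup
  [set q | exists s t, [/\ 0 <= s <= 1, 0 <= t <= 1 & q = (nrm (X (s, t)))%:E]].

Definition holder_norm (X : R * R -> V) : \bar R :=
  (holder1 X + holder2 X + holder12 X + supnorm X)%E.

Definition holder_space : set (R * R -> V) :=
  [set X | {within unit_square, continuous X}
           /\ (holder_norm X < +oo)%E].

End HolderSurfaces.

(* Partitions a = u_0 < ... < u_N = b are encoded by s = [:: u_1; ...; u_N],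
   as in [itv_partition]; the filter expresses "as the mesh tends to 0". *)
Definition mesh_to0 (a b : R) : set_system (seq R) :=
  [set P | exists2 e : R, 0 < e & forall s, itv_partition a b s ->
    (forall k, (k < size s)%N ->
      nth b (a :: s) k.+1 - nth b (a :: s) k < e) -> P s].

(* Young integrals are limits of left-point sums; for the bilinear map mul,
   [young mul a b f g] is the integral of mul (f u) (dg u) over [a,b]. *)
Section YoungIntegral.
Variables (U V W : normedModType R) (mul : U -> V -> W).

Definition riemann_sum (a b : R) (f : R -> U) (g : R -> V) (s : seq R) : W :=
  let u := nth b (a :: s) in
  \sum_(0 <= k < size s) mul (f (u k)) (g (u k.+1) - g (u k)).

Definition young (a b : R) (f : R -> U) (g : R -> V) : W :=
  lim (riemann_sum a b f g @ mesh_to0 a b).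

End YoungIntegral.

Definition holder_path (V : normedModType R) (rho a b : R) (f : R -> V) :=
  exists C : R, forall u v, a <= u <= b -> a <= v <= b ->
    `|f u - f v| <= C * `|u - v| `^ rho.

Definition young_integrable (U V W : normedModType R) (mul : U -> V -> W)
    (rho a b : R) (f : R -> U) (g : R -> V) : Prop :=
  [/\ holder_path rho a b f, holder_path rho a b g &
      cvg (riemann_sum mul a b f g @ mesh_to0 a b)].

(* Integral over [0,s] x [0,t]; the two meshes tend to 0 independently. *)
Definition riemann_sum2 (W : normedModType R) (s t : R)
    (f : R * R -> W) (g : R * R -> R) (pi : seq R * seq R) : W :=
  let u := nth s (0 :: pi.1) in
  let v := nth t (0 :: pi.2) in
  \sum_(0 <= k < size pi.1) \sum_(0 <= l < size pi.2)
    rect_incr g (u k) (u k.+1) (v l) (v l.+1) *: f (u k, v l).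

Definition young2 (W : normedModType R) (s t : R)
    (f : R * R -> W) (g : R * R -> R) : W :=
  lim (riemann_sum2 s t f g @ filter_prod (mesh_to0 0 s) (mesh_to0 0 t)).

Definition young2_integrable (q r : nat) (rho s t : R)
    (f : R * R -> 'M[R]_(q, r)) (g : R * R -> R) : Prop :=
  [/\ holder_space (@frobenius q r) rho f, holder_space Num.norm rho g &
      cvg (riemann_sum2 s t f g @ filter_prod (mesh_to0 0 s) (mesh_to0 0 t))].

(* rho-Hoelder solutions on [0,1] of dF_t = L(F_t) dV_t, F_0 = F0. *)
Definition young_sol (q k r : nat) (rho : R) (L : 'M[R]_(q, r) -> 'M[R]_(q, k))
    (V : R -> 'M[R]_(k, r)) (F0 : 'M[R]_(q, r)) : set (R -> 'M[R]_(q, r)) :=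
  [set F | [/\ holder_path rho 0 1 F, F 0 = F0 &
    forall t, 0 <= t <= 1 ->
      young_integrable mulmx rho 0 t (L \o F) V /\
      F t = F0 + young mulmx 0 t (L \o F) V]].

Definition young_wellposed (q k r : nat) (rho : R)
    (L : 'M[R]_(q, r) -> 'M[R]_(q, k)) (V : R -> 'M[R]_(k, r))
    (F0 : 'M[R]_(q, r)) : Prop :=
  exists2 F, young_sol rho L V F0 F &
    forall G, young_sol rho L V F0 G -> forall t, 0 <= t <= 1 -> G t = F t.

Definition young_endpoint (q k r : nat) (rho : R)
    (L : 'M[R]_(q, r) -> 'M[R]_(q, k)) (V : R -> 'M[R]_(k, r))
    (F0 : 'M[R]_(q, r)) : 'M[R]_(q, r) :=
  xget (fun=> 0) (young_sol rho L V F0) 1.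

(* Only the components with i < j of the 2-form are meaningful; [matrix_conn]
   sets the others to 0 so that a 2-form has a unique representation. *)
Record forms (n m p d : nat) := Forms {
  alpha : 'I_d -> 'M[R]_(n + m);
  beta : 'I_d -> 'M[R]_(n + p);
  gamma : 'I_d -> 'I_d -> 'M[R]_(n + m, n + p) }.

Definition matrix_conn (n m p d : nat) : set (forms n m p d) :=
  [set w | exists (A : 'I_d -> 'M[R]_n) (B : 'I_d -> 'M[R]_(m, n))
      (C : 'I_d -> 'M[R]_m) (D : 'I_d -> 'M[R]_(n, p))
      (E : 'I_d -> 'M[R]_p) (U : 'I_d -> 'I_d -> 'M[R]_(m, p)),
    [/\ forall i, alpha w i = block_mx (A i) 0 (B i) (C i),
        forall i, beta w i = block_mx (A i) (D i) 0 (E i),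
        forall i j : 'I_d, (i < j)%N ->
          C i *m C j - C j *m C i = 0 /\ E i *m E j - E j *m E i = 0,
        forall i j : 'I_d, (i < j)%N -> gamma w i j =
          block_mx
            (A i *m A j - A j *m A i)
            (A i *m D j - A j *m D i + D i *m E j - D j *m E i)
            (B i *m A j - B j *m A i + C i *m B j - C j *m B i)
            (U i j) &
        forall i j : 'I_d, ~~ (i < j)%N -> gamma w i j = 0]].

Definition dist_conn (n m p d : nat) (w1 w2 : forms n m p d) : R :=
  Num.sqrt (\sum_i frobenius (alpha w1 i - alpha w2 i) ^+ 2
    + \sum_i frobenius (beta w1 i - beta w2 i) ^+ 2
    + \sum_(i < d) \sum_(j < d | (i < j)%N)
        frobenius (gamma w1 i j - gamma w2 i j) ^+ 2).

Definition GL1 (n m p : nat) : set 'M[R]_(n + m, n + p) :=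
  [set h | exists (A : 'M[R]_n) (B : 'M[R]_(m, n)) (D : 'M[R]_(n, p))
      (U : 'M[R]_(m, p)),
    A \in unitmx /\ h = block_mx (A - 1%:M) D B U].

Definition phi (n m p : nat) : 'M[R]_(n + p, n + m) := block_mx 1%:M 0 0 0.

Section Development.
Variables (d : nat) (rho : R).

Definition form_path (q : nat) (a : 'I_d -> 'M[R]_q) (x : R -> 'rV[R]_d)
    (t : R) : 'M[R]_q :=
  \sum_i x t 0 i *: a i.

Definition path_dev (q : nat) (a : 'I_d -> 'M[R]_q) (x : R -> 'rV[R]_d) :
    'M[R]_q :=
  young_endpoint rho id (form_path a x) 1%:M.

Definition tail_path (X : R * R -> 'rV[R]_d) (s t u : R) : 'rV[R]_d :=
  if u <= 1 / 2 then X (0, 2 * u * t) else X ((2 * u - 1) * s, t).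

Definition boundary_loop (X : R * R -> 'rV[R]_d) (s t u : R) : 'rV[R]_d :=
  if u <= 1 / 4 then X (4 * u * s, 0)
  else if u <= 1 / 2 then X (s, (4 * u - 1) * t)
  else if u <= 3 / 4 then X ((3 - 4 * u) * s, t)
  else X (0, (4 - 4 * u) * t).

Definition loop_coord (X : R * R -> 'rV[R]_d) (i : 'I_d) (s t u : R) : R :=
  boundary_loop X s t u 0 i.

Definition area_inner (X : R * R -> 'rV[R]_d) (i : 'I_d) (s t u : R) : R :=
  young (fun a b : R => a * b) 0 u (fun=> 1) (loop_coord X i s t).

Definition area (X : R * R -> 'rV[R]_d) (i j : 'I_d) (z : R * R) : R :=
  young (fun a b : R => a * b) 0 1
    (area_inner X i z.1 z.2) (loop_coord X j z.1 z.2).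

Variables (n m p : nat).

Definition dev_integrand (X : R * R -> 'rV[R]_d) (w : forms n m p d)
    (i j : 'I_d) (z : R * R) : 'M[R]_(n + m, n + p) :=
  path_dev (alpha w) (tail_path X z.1 z.2) *m gamma w i j
    *m invmx (path_dev (beta w) (tail_path X z.1 z.2)).

Definition dev_Z (X : R * R -> 'rV[R]_d) (w : forms n m p d) (s t : R) :
    'M[R]_(n + m, n + p) :=
  \sum_(i < d) \sum_(j < d | (i < j)%N) young2 s t (dev_integrand X w i j) (area X i j).

Definition dev_field (h : 'M[R]_(n + m, n + p)) : 'M[R]_(n + m) :=
  1%:M + h *m phi n m p.

Definition surface_dev (X : R * R -> 'rV[R]_d) (w : forms n m p d) :
    'M[R]_(n + m, n + p) :=
  young_endpoint rho dev_field (dev_Z X w 1) 0.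

(* The integrals and solutions above are total functions (through [lim] and
   [xget]); this says that each of them exists and is unique. *)
Definition well_defined (X : R * R -> 'rV[R]_d) (w : forms n m p d) : Prop :=
  [/\ forall s t, 0 <= s <= 1 -> 0 <= t <= 1 ->
        [/\ young_wellposed rho id (form_path (alpha w) (tail_path X s t)) 1%:M,
            young_wellposed rho id (form_path (beta w) (tail_path X s t)) 1%:M
          & path_dev (beta w) (tail_path X s t) \in unitmx],
      forall (i j : 'I_d) s t, (i < j)%N -> 0 <= s <= 1 -> 0 <= t <= 1 ->
        (forall u, 0 <= u <= 1 ->
          young_integrable (fun a b : R => a * b) rho 0 u
            (fun=> 1) (loop_coord X i s t)) /\
        young_integrable (fun a b : R => a * b) rho 0 1
          (area_inner X i s t) (loop_coord X j s t),
      forall (i j : 'I_d) s t, (i < j)%N -> 0 <= s <= 1 -> 0 <= t <= 1 ->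
        young2_integrable rho s t (dev_integrand X w i j) (area X i j),
      young_wellposed rho dev_field (dev_Z X w 1) 0
    & GL1 (surface_dev X w)].

(* Product metric on C^rho x M, with values in [0, +oo]. *)
Definition dist_dom (a b : (R * R -> 'rV[R]_d) * forms n m p d) : \bar R :=
  (holder_norm (@frobenius 1 d) rho (fun z => a.1 z - b.1 z)%R
   + (dist_conn a.2 b.2)%:E)%E.

End Development.

Definition locally_lipschitz (S T : Type) (A : set S) (dS : S -> S -> \bar R)
    (dT : T -> T -> R) (f : S -> T) : Prop :=
  forall a, A a -> exists e L : R, 0 < e /\
    forall x y, A x -> A y -> (dS a x < e%:E)%E -> (dS a y < e%:E)%E ->
      ((dT (f x) (f y))%:E <= L%:E * dS x y)%E.

End Definitions.

(* Main.v *)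
(* All objects come from one sewing lemma for functionals of partitions: if
   deleting a point changes the functional by a power [theta > 1] of the gap it
   leaves, then the functional converges as the mesh tends to 0, with explicit
   errors. Applied to Riemann sums it gives Young integrals, and applied to
   products of [1 + dV] it gives the solution [Dev V] of [dF = F dV].

   Only boundedness of developments is estimated directly. The development of
   the block path [[V, c (V - W)], [0, W]] is the block matrix
   [[Dev V, c (Dev V - Dev W)], [0, Dev W]], so with [c] the inverse of the
   distance of [V] and [W] boundedness turns into a Lipschitz estimate; used
   once it gives the two-parameter Hoelder regularity of developments along
   tail paths, used on top of that it gives their Lipschitz dependence on the
   surface and on the connection.

   The area process is a combination of integrals of [X^i dX^j] along the sides
   of the rectangle, so its rectangular increments are Young integrals of
   increments. The 2D Young integral is a sewing in the first variable of Young
   integrals in the second one. Finally [g = 1 + h phi] solves the linear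
   equation [dg = g d(Z phi)], whence [h] is the integral of [g] against [Z],
   and the upper left block of [h] is [A - 1] with [A] invertible as [g] is. *)

Require Import Defs.
From HB Require Import structures.
From mathcomp Require Import all_boot all_order all_algebra.
From mathcomp Require Import all_classical all_reals all_analysis.
From mathcomp Require Import ring lra.

Set Implicit Arguments.
Unset Strict Implicit.
Unset Printing Implicit Defensive.

Import Order.TTheory GRing.Theory Num.Theory.
Import numFieldNormedType.Exports.

Local Open Scope classical_set_scope.
Local Open Scope ring_scope.

(** The recurrent obstacle is second differences: the integrand must have rectangular increments of
    product size, and the Lipschitz estimate needs the same for differences of integrands. With the
    block drivers both are instances of one a priori bound, valid in every dimension and depending
    on the driver only through its Hoelder constant [K]. This is why so many estimates have the
    form: for each [K] there is a [C] that serves all drivers. Dividing by the distance requires it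
    to be positive, so Lipschitz statements take some [e > 0] bounding the distance, and the final
    proof lets [e] decrease to the actual distance.

    Inverses need no analysis of their own: the inverse of a development of [V] is the transpose of
    the development of [- V^T].

    The a priori bound is circular at first sight, since sewing of products presupposes that
    products are bounded. Induction on the number of factors over short intervals breaks the circle;
    the predicate [Q] of the sewing lemma restricts the functional to the partitions already under
    control. *)

Section ZmodExpr.

(** Reflection for abelian groups: an expression equals the integer combination of its atoms with
    coefficients [zcoef], so an identity reduces to comparing integers, which is done by
    computation. *)
Inductive zexpr := ZVar of nat | ZZero | ZAdd of zexpr & zexpr | ZOpp of zexpr.

Fixpoint zeval (V : zmodType) (env : seq V) (e : zexpr) : V :=
  match e with
  | ZVar k => nth 0 env k
  | ZZero => 0
  | ZAdd e1 e2 => zeval env e1 + zeval env e2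
  | ZOpp e1 => - zeval env e1
  end.

Fixpoint zcoef (i : nat) (e : zexpr) : int :=
  match e with
  | ZVar k => Posz (k == i)
  | ZZero => 0
  | ZAdd e1 e2 => zcoef i e1 + zcoef i e2
  | ZOpp e1 => - zcoef i e1
  end.

Lemma zeval_coef (V : zmodType) (env : seq V) e :
  zeval env e = \sum_(i < size env) env`_i *~ zcoef i e.
Proof.
elim: e => [k||e1 IH1 e2 IH2|e1 IH1] /=.
- have [kn|nk] := ltnP k (size env); last first.
    rewrite nth_default // big1 // => i _.
    by rewrite gtn_eqF // (leq_trans (ltn_ord i)).
  rewrite (bigD1 (Ordinal kn)) //= eqxx mulr1z big1 ?addr0 // => i.
  by rewrite -val_eqE /= eq_sym => /negPf ->.
- by rewrite big1.
- by rewrite IH1 IH2 -big_split; apply: eq_bigr => i _; rewrite mulrzDr.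
- by rewrite IH1 -sumrN; apply: eq_bigr => i _; rewrite mulrNz.
Qed.

Lemma zeval_eq (V : zmodType) (env : seq V) e1 e2 :
  all (fun i => zcoef i e1 == zcoef i e2) (iota 0 (size env)) ->
  zeval env e1 = zeval env e2.
Proof.
move=> /allP h; rewrite !zeval_coef; apply: eq_bigr => i _.
by rewrite (eqP (h i _)) // mem_iota /= add0n.
Qed.

End ZmodExpr.

(* Atoms are compared up to conversion of their canonical structures. *)
Ltac zmod_mem x env :=
  lazymatch env with
  | nil => constr:(false)
  | cons ?y ?env' =>
    match constr:(tt) with
    | _ => let _ := constr:(erefl : x = y) in constr:(true)
    | _ => zmod_mem x env'
    end
  end.

Ltac zmod_atoms t env :=
  lazymatch t with
  | (?x + ?y)%R => let env1 := zmod_atoms x env in zmod_atoms y env1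
  | (- ?x)%R => zmod_atoms x env
  | 0%R => env
  | _ => lazymatch zmod_mem t env with
         | true => env
         | false => constr:(cons t env)
         end
  end.

Ltac zmod_index x env :=
  lazymatch env with
  | cons ?y ?env' =>
    match constr:(tt) with
    | _ => let _ := constr:(erefl : x = y) in constr:(0%N)
    | _ => let k := zmod_index x env' in constr:(S k)
    end
  end.

Ltac zmod_reify t env :=
  lazymatch t with
  | (?x + ?y)%R => let e1 := zmod_reify x env in
                   let e2 := zmod_reify y env in constr:(ZAdd e1 e2)
  | (- ?x)%R => let e := zmod_reify x env in constr:(ZOpp e)
  | 0%R => constr:(ZZero)
  | _ => let k := zmod_index t env in constr:(ZVar k)
  end.

(* Decides equalities that hold in every abelian group. *)
Ltac zmod :=
  lazymatch goal with
  | |- @eq ?V ?x ?y =>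
    let env0 := zmod_atoms x (@nil V) in
    let env := zmod_atoms y env0 in
    let e1 := zmod_reify x env in
    let e2 := zmod_reify y env in
    exact: (@zeval_eq _ env e1 e2 isT)
  end.

(** Sewing takes limits of sums and products of matrices, hence completeness. *)
HB.instance Definition _ (R : realType) (m n : nat) :=
  Uniform_isComplete.Build 'M[R]_(m, n) (@mx_complete R m n).

(** * The entrywise maximum norm of matrices *)

Section MatrixNorm.
Variable R : realType.

Lemma normE_mx m n (A : 'M[R]_(m, n)) : `|A| = \big[Num.max/0]_ij `|A ij.1 ij.2|.
Proof. exact: mx_normrE. Qed.

Lemma normr_entry m n (A : 'M[R]_(m, n)) i j : `|A i j| <= `|A|.
Proof. by rewrite normE_mx; exact: (le_bigmax _ _ (i, j)). Qed.

Lemma normr_mx_le m n (A : 'M[R]_(m, n)) c : 0 <= c ->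
  (forall i j, `|A i j| <= c) -> `|A| <= c.
Proof. by move=> c0 h; rewrite normE_mx; apply: bigmax_le. Qed.

(** An entry of the product is a sum of [k] terms, so the maximum norm is submultiplicative only up
    to this factor. The [q%:R] in later constants come from here. *)
Lemma normr_mulmx m k n (A : 'M[R]_(m, k)) (B : 'M[R]_(k, n)) :
  `|A *m B| <= k%:R * `|A| * `|B|.
Proof.
apply: normr_mx_le => [|i j]; first by rewrite !mulr_ge0.
rewrite mxE; apply: le_trans (ler_norm_sum _ _ _) _.
apply: le_trans (ler_sum _ (_ : forall l, true -> _ <= `|A| * `|B|)) _.
  by move=> l _; rewrite normrM ler_pM // normr_entry.
by rewrite sumr_const card_ord -mulrA mulr_natl.
Qed.

Lemma normr_trmx m n (A : 'M[R]_(m, n)) : `|A^T| = `|A|.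
Proof.
suff le p q (B : 'M[R]_(p, q)) : `|B^T| <= `|B|.
  by apply/le_anti; rewrite le -{1}(trmxK A) le.
by apply: normr_mx_le => // i j; rewrite mxE normr_entry.
Qed.

Lemma normr_mx1 n : `|1%:M : 'M[R]_n| <= 1.
Proof.
apply: normr_mx_le => // i j; rewrite mxE.
by case: (i == j); rewrite ?normr1 ?normr0.
Qed.

Lemma normr_block_mx m1 m2 n1 n2 (A : 'M[R]_(m1, n1)) (B : 'M[R]_(m1, n2))
    (C : 'M[R]_(m2, n1)) (D : 'M[R]_(m2, n2)) c : 0 <= c ->
  `|A| <= c -> `|B| <= c -> `|C| <= c -> `|D| <= c -> `|block_mx A B C D| <= c.
Proof.
move=> c0 hA hB hC hD; apply: normr_mx_le => // i j.
case: (split_ordP i) => i' ->; case: (split_ordP j) => j' ->;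
  rewrite ?(block_mxEul, block_mxEur, block_mxEdl, block_mxEdr);
  by apply: le_trans (normr_entry _ _ _) _.
Qed.

Lemma normr_ursubmx m1 m2 n1 n2 (A : 'M[R]_(m1 + m2, n1 + n2)) :
  `|ursubmx A| <= `|A|.
Proof. by apply: normr_mx_le => // i j; rewrite !mxE normr_entry. Qed.

End MatrixNorm.

(** Passes between the two ways of writing a rectangular increment as a difference of one-parameter
    increments. *)
Lemma subrACB (V : zmodType) (x y z w : V) : x - y - (z - w) = x - z - (y - w).
Proof. by zmod. Qed.

(** * Sewing *)

Section PowerBounds.
Variable R : realType.
Implicit Types x y p q : R.

Lemma ler_powR2r p x y : 0 <= p -> 0 <= x -> x <= y -> x `^ p <= y `^ p.
Proof.
by move=> p0 x0 xy; apply: ge0_ler_powR; rewrite ?nnegrE // (le_trans x0).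
Qed.

Lemma powR_lt1 p x : 0 < p -> 0 <= x < 1 -> x `^ p < 1.
Proof.
move=> p0 /andP[x0 x1]; have <- : 1 `^ p = 1 :> R by rewrite powR1.
by apply: gt0_ltr_powR; rewrite ?nnegrE.
Qed.

Lemma powR_le1 p x : 0 <= p -> 0 <= x <= 1 -> x `^ p <= 1.
Proof.
move=> p0 /andP[x0 x1]; have <- : 1 `^ p = 1 :> R by rewrite powR1.
exact: ler_powR2r.
Qed.

(** With one power split off, errors of order [p] over a partition of mesh [d] add up to at most [d]
    to the power [p - 1] times the total length. *)
Lemma powR_split_le p x d : 1 < p -> 0 <= x <= d ->
  x `^ p <= d `^ (p - 1) * x.
Proof.
move=> p1 /andP[x0 xd].
rewrite -(@mulr_powRB1 _ x p) //; last by lra.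
by rewrite mulrC ler_wpM2r // ler_powR2r // subr_ge0 ltW.
Qed.

Lemma powR_small p (M e : R) : 0 < p -> 0 <= M -> 0 < e ->
  exists2 d, 0 < d & M * d `^ p <= e.
Proof.
(* [M + 1] instead of [M] covers [M = 0]. *)
move=> p0 M0 e0; exists ((e / (M + 1)) `^ p^-1).
  by apply: powR_gt0; apply: divr_gt0 => //; lra.
rewrite -powRrM mulVf ?gt_eqF // powRr1; last by apply: divr_ge0; lra.
by rewrite mulrCA ger_pMr // ler_pdivrMr; lra.
Qed.

Variables (theta : R) (theta_gt1 : 1 < theta).

(* The fixed point of [k = 2 * k * (1/2) `^ theta + 2]: cutting an interval at
   its midpoint leaves two halves and at most two points to be removed. *)
Definition sewing_cst : R := 2 / (1 - 2 * 2^-1 `^ theta).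

(** Here [theta > 1] enters: halving the length gains more than doubling the number of intervals
    loses. *)
Let den_gt0 : 0 < 1 - 2 * 2^-1 `^ theta.
Proof.
have h2 : 0 <= (2^-1 : R) < 1 by apply/andP; split; lra.
have ? : 0 < theta by exact: lt_trans ltr01 theta_gt1.
have ? : 0 <= 2^-1 :> R by rewrite invr_ge0.
rewrite -(@mulr_powRB1 _ 2^-1 theta) //.
rewrite mulrA mulfV // mul1r subr_gt0; apply: powR_lt1 => //.
by rewrite subr_gt0.
Qed.

Lemma sewing_cst_gt0 : 0 < sewing_cst.
Proof. exact: divr_gt0. Qed.

Lemma sewing_cst_fix (c h x y : R) : 0 <= c -> 0 <= h ->
    0 <= x <= h / 2 -> 0 <= y <= h / 2 ->
  sewing_cst * c * x `^ theta + sewing_cst * c * y `^ theta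
    + c * h `^ theta + c * h `^ theta <= sewing_cst * c * h `^ theta.
Proof.
move=> c0 h0 /andP[x0 xh] /andP[y0 yh].
have k0 := sewing_cst_gt0.
have half z : 0 <= z -> z <= h / 2 -> z `^ theta <= h `^ theta * 2^-1 `^ theta.
  move=> z0 zh; rewrite -powRM ?invr_ge0 //.
  by apply: ler_powR2r; rewrite // ltW // (lt_trans ltr01 theta_gt1).
have kE : sewing_cst = sewing_cst * (2 * 2^-1 `^ theta) + 2.
  by rewrite /sewing_cst; field; rewrite gt_eqF.
have hx := half _ x0 xh; have hy := half _ y0 yh.
have kc : 0 <= sewing_cst * c by rewrite mulr_ge0 // ltW.
have -> : sewing_cst * c * h `^ theta = 
  sewing_cst * c * (h `^ theta * 2^-1 `^ theta)
  + sewing_cst * c * (h `^ theta * 2^-1 `^ theta)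
    + c * h `^ theta + c * h `^ theta.
  by rewrite {1}kE; ring.
by rewrite !lerD2r lerD // ler_wpM2l.
Qed.

End PowerBounds.

(** * Partitions, their mesh and refinements *)

Section Partitions.
Variable R : realType.
Implicit Types (a b d : R) (s : seq R).

(** As a [path] it splits along concatenations; [fineP] recovers the form used in [mesh_to0]. *)
Definition fine d a s := path (fun x y : R => y - x < d) a s.

Lemma fine_cat d a s1 s2 :
  fine d a (s1 ++ s2) = fine d a s1 && fine d (last a s1) s2.
Proof. exact: cat_path. Qed.

Lemma fineP a b d s : reflect
  (forall k, (k < size s)%N -> nth b (a :: s) k.+1 - nth b (a :: s) k < d)
  (fine d a s).
Proof. exact: pathP. Qed.

Lemma fine_le d d' a s : d <= d' -> fine d a s -> fine d' a s.
Proof.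
by move=> dd'; apply: sub_path => x y /= h; apply: lt_le_trans dd'.
Qed.

Lemma path_last_ge a s : path <%R a s -> a <= last a s.
Proof.
elim: s a => //= x s IH a /andP[ax /IH]; apply: le_trans; exact: ltW.
Qed.

Lemma path_last_eq a s : path <%R a s -> last a s = a -> s = [::].
Proof.
case: s => //= x s /andP[ax /path_last_ge xs] e.
by move: ax; rewrite ltNge -e xs.
Qed.

Lemma path_all_le a s : path <%R a s -> all (<= last a s) s.
Proof.
elim: s a => //= x s IH a /andP[_ h]; rewrite path_last_ge //=.
exact: IH h.
Qed.

Lemma exists_fine_partition a b d : a <= b -> 0 < d ->
  exists2 s, itv_partition a b s & fine d a s.
Proof.
(* Induction on the number of steps [d / 2] that cover what remains of the interval; the last step
   may be longer, but stays below [d]. *)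
move=> ab d0; suff H n c : a <= c <= b -> b - c <= n%:R * (d / 2) ->
    exists2 s, itv_partition c b s & fine d c s.
  apply: (H (Num.bound ((b - a) / (d / 2)))); first by rewrite lexx.
  rewrite -ler_pdivrMr; last by rewrite divr_gt0.
  by apply/ltW/archi_boundP; rewrite divr_ge0 ?subr_ge0 // divr_ge0 // ltW.
elim: n c => [|n IH] c /andP[ac cb].
  rewrite mul0r => h; exists [::] => //; split=> //=.
  by rewrite eq_le cb; lra.
have [bc _|cdb h] := ltP (b - c) d; last first.
  have [||s [s1 s2] s3] := IH (c + d / 2).
  - by apply/andP; split; lra.
  - by move: h; rewrite -natr1; lra.
  - exists (c + d / 2 :: s); last by rewrite /fine /= -/(fine _ _ _) s3 andbT; lra.
    by split=> //=; rewrite s1 andbT; lra.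
have [->|nbc] := eqVneq c b; first by exists [::].
exists [:: b]; first by split; rewrite //= lt_neqAle nbc cb.
by rewrite /fine /= bc.
Qed.

#[global] Instance mesh_to0_filter a b : Filter (mesh_to0 a b).
Proof.
split; first by exists 1.
  move=> P Q [e1 e10 h1] [e2 e20 h2]; exists (Num.min e1 e2).
    by rewrite lt_min e10.
  move=> s hs hm; split; [apply: h1 => // k /hm | apply: h2 => // k /hm];
  by rewrite lt_min => /andP[].
by move=> P Q PQ [e e0 h]; exists e => // s hs hm; apply: PQ; apply: h.
Qed.

Lemma mesh_to0_proper a b : a <= b -> ProperFilter (mesh_to0 a b).
Proof.
move=> ab; apply: Build_ProperFilter_ex => P [e e0 h].
have [s sp /(fineP a b) sf] := exists_fine_partition ab e0.
by exists s; apply: h.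
Qed.

Lemma mesh_to0I a b d (P : set (seq R)) : 0 < d ->
  (forall s, itv_partition a b s -> fine d a s -> P s) -> mesh_to0 a b P.
Proof.
by move=> d0 h; exists d => // s hs hm; apply: h => //; apply/(fineP a b).
Qed.

Lemma common_refinement a b s1 s2 :
  itv_partition a b s1 -> itv_partition a b s2 ->
  exists s, [/\ itv_partition a b s, subseq s1 s & subseq s2 s].
Proof.
move=> [p1 /eqP l1] [p2 /eqP l2].
pose s := sort <=%R (undup (s1 ++ s2)).
have ms x : (x \in s) = (x \in s1) || (x \in s2).
  by rewrite mem_sort mem_undup mem_cat.
have sl : sorted <%R s by rewrite sort_lt_sorted undup_uniq.
have sub s' : path <%R a s' -> {subset s' <= s} -> subseq s' s.
  move=> p' h; rewrite (_ : s' = [seq x <- s | x \in s']) ?filter_subseq //.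
  apply: (@lt_sorted_eq _ _); first exact: path_sorted p'.
    by rewrite lt_sorted_filter.
  move=> x; rewrite mem_filter; case: (boolP (x \in s')) => //= xs'.
  by rewrite h.
have gta x : x \in s -> a < x.
  rewrite ms => /orP[] xs; [move: p1|move: p2].
    by move/(order_path_min lt_trans)/allP/(_ _ xs).
  by move/(order_path_min lt_trans)/allP/(_ _ xs).
have leb x : x \in s -> x <= b.
  rewrite ms => /orP[] xs; [move: (path_all_le p1)|move: (path_all_le p2)].
    by rewrite l1 => /allP/(_ _ xs).
  by rewrite l2 => /allP/(_ _ xs).
have ps : path <%R a s.
  case: (s) sl gta => //= x s' -> gta; rewrite gta // mem_head //.
exists s; split.
- split=> //; apply/eqP/le_anti/andP; split.
    by have := mem_last a s; rewrite inE => /orP[/eqP ->|/leb //];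
       rewrite -l1 path_last_ge.
  (* If [b] differs from [a], then [s1] is nonempty and contains [b], so [b] is one of the merged
     points. *)
  have [e|bs] := eqVneq b a; first by rewrite e path_last_ge.
  apply: (allP (path_all_le ps)); rewrite ms.
  have := mem_last a s1; rewrite l1 inE => /orP[/eqP e|->] //.
  by rewrite e eqxx in bs.
- by apply: sub => // x xs; rewrite ms xs.
- by apply: sub => // x xs; rewrite ms xs orbT.
Qed.

Lemma subseq_cons_split x s1 s2 : subseq (x :: s1) s2 ->
  exists l r, s2 = l ++ x :: r /\ subseq s1 r.
Proof.
elim: s2 => //= y s2 IH; case: eqP => [->|_] h; first by exists [::], s2.
by have [l [r [-> hr]]] := IH h; exists (y :: l), r.
Qed.

Lemma split_gt m s : exists l r, [/\ s = l ++ r, all (<= m) l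
  & r = [::] \/ exists y r', r = y :: r' /\ m < y].
Proof.
elim: s => [|y s [l [r [-> ml mr]]]]; first by exists [::], [::]; split; auto.
have [my|ym] := ltP m y.
  by exists [::], (y :: l ++ r); split=> //; right; exists y, (l ++ r).
by exists (y :: l), r; split=> //=; rewrite ym.
Qed.

End Partitions.

(** * Sewing of functionals of partitions *)

Section SewingFunctional.
Variables (R : realType) (E : completeNormedModType R).
Variables (a theta C : R) (Phi : seq R -> E) (Q : seq R -> Prop).

Local Notation kappa := (sewing_cst theta).

(* [Q] singles out the partitions for which deleting a point is known to be
   cheap. *)
Definition removal_bound := forall l u t r, path <%R a (l ++ u :: t :: r) ->
  Q (l ++ u :: t :: r) ->
  `|Phi (l ++ u :: t :: r) - Phi (l ++ t :: r)| <= C * (t - last a l) `^ theta.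

Hypotheses (theta_gt1 : 1 < theta) (C_ge0 : 0 <= C).
Hypothesis Q_sub : forall s1 s2, subseq s1 s2 -> Q s2 -> Q s1.
Hypothesis Phi_rem : removal_bound.

Let kappa_gt0 : 0 < kappa. Proof. exact: sewing_cst_gt0. Qed.

Lemma sewing_block s l t r : path <%R a (l ++ s ++ t :: r) ->
  Q (l ++ s ++ t :: r) ->
  `|Phi (l ++ s ++ t :: r) - Phi (l ++ t :: r)|
    <= kappa * C * (t - last a l) `^ theta.
Proof.
have kC : 0 <= kappa * C by rewrite mulr_ge0 // ltW.
have [n] := ubnP (size s); elim: n s l t r => // n IH s l t r ns ps Qs.
have sub s1 s2 : subseq s1 s2 -> path <%R a s2 -> path <%R a s1.
  exact: subseq_lt_path.
pose x := last a l; pose m := (x + t) / 2.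
have lt_last s' y r' : path <%R a (l ++ s' ++ y :: r') -> last x s' < y.
  by rewrite cat_path => /andP[_]; rewrite cat_path -/x /= => /and3P[].
have xt : x < t.
  apply: (lt_last [::] t r); apply: sub ps; rewrite /= cat_subseq //.
  exact: suffix_subseq.
have [s1 [s2 [sE s1m s2m]]] := split_gt m s.
have xm : x <= m by rewrite /m; lra.
have s1lm : last x s1 <= m.
  have := mem_last x s1; rewrite inE => /orP[/eqP -> //|h].
  exact: (allP s1m _ h).
(* Deleting the points of the left half; the next point is [y]. *)
have left y r' : path <%R a (l ++ s1 ++ y :: r') -> Q (l ++ s1 ++ y :: r') ->
    y <= t -> `|Phi (l ++ s1 ++ y :: r') - Phi (l ++ y :: r')|
      <= kappa * C * (last x s1 - x) `^ theta + C * (t - x) `^ theta.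
  case/lastP: s1 sE s1m s1lm => [_ _ _ _ _ _|s1 p sE s1m].
    rewrite subrr normr0 addr_ge0 // mulr_ge0 ?powR_ge0 //.
  rewrite last_rcons -!cats1 -!catA /= => pm p' Q' yt.
  apply: le_trans (ler_distD (Phi (l ++ p :: y :: r')) _ _) _.
  have sb : subseq (l ++ p :: y :: r') (l ++ s1 ++ p :: y :: r').
    by rewrite cat_subseq // suffix_subseq.
  apply: lerD.
    apply: IH => //; apply: leq_trans _ (ns : (size s <= n)%N).
    by rewrite sE size_cat size_rcons addSn ltnS leq_addr.
  apply: le_trans (Phi_rem _ _) _; [exact: sub p'|exact: Q_sub Q'|].
  rewrite ler_wpM2l // ler_powR2r //; first by rewrite ltW // (lt_trans ltr01).
    have := sub _ _ sb p'; rewrite cat_path /= -/x => /and4P[_ xp py _].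
    by rewrite subr_ge0 ltW // (lt_trans xp).
  by rewrite lerD2r.
have xs1 : x <= last x s1.
  move: ps; rewrite sE -catA cat_path => /andP[_].
  by rewrite cat_path => /andP[/path_last_ge].
have fix_cst y : 0 <= y <= (t - x) / 2 ->
  kappa * C * (last x s1 - x) `^ theta + kappa * C * y `^ theta
  + C * (t - x) `^ theta + C * (t - x) `^ theta
  <= kappa * C * (t - x) `^ theta.
  move=> hy; apply: sewing_cst_fix => //; first by lra.
  by apply/andP; split; move: s1lm; rewrite /m; lra.
case: s2m => [s20|[q [s2' [s2E mq]]]].
  have sE1 : s = s1 by rewrite sE s20 cats0.
  move: ps Qs; rewrite sE1 => ps Qs.
  apply: le_trans (left _ _ ps Qs (lexx _)) _.
  have h0 : 0 <= (0 : R) <= (t - x) / 2 by apply/andP; split; lra.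
  apply: le_trans (fix_cst _ h0); rewrite -!addrA lerD2l.
  have u0 : 0 <= kappa * C * 0 `^ theta by rewrite mulr_ge0 // powR_ge0.
  have v0 : 0 <= C * (t - x) `^ theta by rewrite mulr_ge0 // powR_ge0.
  by rewrite addrA lerDr addr_ge0.
move: ps Qs ns; rewrite sE s2E -!catA /= => ps Qs ns.
have sb1 : subseq (l ++ s1 ++ q :: t :: r) (l ++ s1 ++ q :: s2' ++ t :: r).
  by do 2 apply: cat_subseq => //=; rewrite eqxx suffix_subseq.
have sb2 : subseq (l ++ q :: t :: r) (l ++ s1 ++ q :: t :: r).
  by rewrite cat_subseq // suffix_subseq.
have p1 := sub _ _ sb1 ps; have Q1 := Q_sub sb1 Qs.
have p2 := sub _ _ sb2 p1; have Q2 := Q_sub sb2 Q1.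
have qt : q < t.
  by move: p2; rewrite cat_path /= => /and4P[].
apply: le_trans (ler_distD (Phi (l ++ s1 ++ q :: t :: r)) _ _) _.
have step1 : `|Phi (l ++ s1 ++ q :: s2' ++ t :: r)
    - Phi (l ++ s1 ++ q :: t :: r)| <= kappa * C * (t - q) `^ theta.
  have := IH s2' (l ++ s1 ++ [:: q]) t r.
  rewrite !last_cat /= -!catA /=; apply=> //.
  apply: leq_trans _ (ns : (_ <= n)%N).
  by rewrite size_cat /= addnS ltnS leq_addl.
have step2 := left q (t :: r) p1 Q1 (ltW qt).
have step3 := Phi_rem p2 Q2.
have hq : 0 <= t - q <= (t - x) / 2.
  by apply/andP; split; move: mq; rewrite /m; lra.
apply: le_trans _ (fix_cst _ hq).
have -> : forall A B D F : R, A + B + D + F = B + (A + D + F).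
  by move=> *; ring.
apply: lerD => //.
apply: le_trans (ler_distD (Phi (l ++ q :: t :: r)) _ _) _.
exact: lerD.
Qed.

(** The fine partition is coarsened one block at a time from the left; [l] holds the part already
    treated. Each block spans a gap of [s1] shorter than [d], so the costs telescope by
    [powR_split_le]. *)
Lemma sewing_refine d l s1 s2 : 0 <= d -> path <%R a (l ++ s2) -> Q (l ++ s2) ->
  subseq s1 s2 -> last (last a l) s1 = last (last a l) s2 ->
  fine d (last a l) s1 ->
  `|Phi (l ++ s2) - Phi (l ++ s1)| <=
    kappa * C * d `^ (theta - 1) * (last (last a l) s1 - last a l).
Proof.
move=> d0; elim: s1 l s2 => [|p s1 IH] l s2 ps Qs ss e fs.
  have -> : s2 = [::].
    apply: (@path_last_eq _ (last a l)); last by rewrite -e.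
    by move: ps; rewrite cat_path => /andP[].
  by rewrite cats0 subrr normr0 /= subrr mulr0.
have [l2 [r2 [s2E ss']]] := subseq_cons_split ss.
move: e fs ps Qs; rewrite s2E /= last_cat /= => e /andP[fp fs] ps Qs.
have sb : subseq (l ++ p :: r2) (l ++ l2 ++ p :: r2).
  by rewrite cat_subseq // suffix_subseq.
have pr := subseq_lt_path sb ps.
have xp : last a l < p by move: pr; rewrite cat_path /= => /and3P[].
have h1 := sewing_block ps Qs.
have := IH (rcons l p) r2; rewrite last_rcons !cat_rcons => h2.
have {h2} := h2 pr (Q_sub sb Qs) ss' e fs.
move=> h2; apply: le_trans (ler_distD (Phi (l ++ p :: r2)) _ _) _.
have -> : last p s1 - last a l = (p - last a l) + (last p s1 - p) by ring.
rewrite mulrDr; apply: lerD => //; apply: le_trans h1 _.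
rewrite -[leRHS]mulrA; apply: ler_wpM2l; first by rewrite mulr_ge0 // ltW.
by apply: powR_split_le => //; rewrite subr_ge0 (ltW xp) ltW.
Qed.

Lemma sewing_cauchy b d s1 s2 : 0 <= d ->
    (forall s, itv_partition a b s -> Q s) ->
    itv_partition a b s1 -> itv_partition a b s2 ->
    fine d a s1 -> fine d a s2 ->
  `|Phi s1 - Phi s2| <= 2 * (kappa * C * d `^ (theta - 1) * (b - a)).
Proof.
move=> d0 Qp p1 p2 f1 f2.
have [s [ps ss1 ss2]] := common_refinement p1 p2.
have Qs := Qp _ ps.
case: ps p1 p2 => ps /eqP ls [p1 /eqP l1] [p2 /eqP l2].
have h1 := @sewing_refine d [::] s1 s d0 ps Qs ss1.
have h2 := @sewing_refine d [::] s2 s d0 ps Qs ss2.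
move: h1 h2; rewrite /= l1 l2 ls => /(_ erefl f1) h1 /(_ erefl f2) h2.
apply: le_trans (ler_distD (Phi s) _ _) _.
by rewrite mulr_natl mulr2n; apply: lerD => //; rewrite distrC.
Qed.

Lemma sewing_lim b : a <= b -> (forall s, itv_partition a b s -> Q s) ->
  exists y : E, forall d s, 0 < d -> itv_partition a b s -> fine d a s ->
    `|Phi s - y| <= 2 * (kappa * C * d `^ (theta - 1) * (b - a)).
Proof.
move=> ab Qp; have mP := mesh_to0_proper ab.
have M0 : 0 <= 2 * (kappa * C * (b - a)).
  by do 2 rewrite mulr_ge0 ?subr_ge0 //; apply: mulr_ge0; first exact: ltW.
have th0 : 0 < theta - 1 by rewrite subr_gt0.
have cv : cvg (Phi @ mesh_to0 a b).
  apply: cauchy_cvg; apply/cauchy_ballP => e e0.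
  have e20 : 0 < e / 2 by rewrite divr_gt0.
  have [d d0 hd] := powR_small th0 M0 e20.
  pose P := [set y | exists s, [/\ itv_partition a b s, fine d a s & y = Phi s]].
  exists (P, P).
    by split; apply: (mesh_to0I d0) => s ps fs; exists s.
  move=> [_ _] /= [[s [ps fs ->]] [s' [ps' fs' ->]]].
  rewrite -ball_normE /=.
  apply: le_lt_trans (sewing_cauchy (ltW d0) Qp ps ps' fs fs') _.
  apply: le_lt_trans (_ : e / 2 < e); last by lra.
  by apply: le_trans hd; rewrite le_eqVlt; apply/orP; left; apply/eqP; ring.
exists (lim (Phi @ mesh_to0 a b)) => d s d0 ps fs.
apply/ler_addgt0Pr => e e0.
have /cvgrPdist_lt/(_ e e0) := cv.
case=> e' e'0 he.
have md0 : 0 < Num.min e' d by rewrite lt_min e'0.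
(* A partition both [d]-fine and close to the limit lets the Cauchy estimate pass to the limit with
   its explicit constant. *)
have [s' ps' fs'] := exists_fine_partition ab md0.
have le1 : Num.min e' d <= e' by rewrite ge_min lexx.
have le2 : Num.min e' d <= d by rewrite ge_min lexx orbT.
have h1 : `|lim (Phi @ mesh_to0 a b) - Phi s'| < e.
  apply: he => //; apply/(fineP a b); exact: fine_le fs'.
apply: le_trans (ler_distD (Phi s') _ _) _.
apply: lerD.
  exact: (sewing_cauchy (ltW d0) Qp ps ps' fs (fine_le le2 fs')).
by rewrite distrC ltW.
Qed.

End SewingFunctional.

(** * Sewing of one-step schemes *)

Section EulerScheme.
Variables (R : realType) (E : completeNormedModType R).
Variable N : R -> R -> E -> E.

(** [N u t x] is one step from time [u] to [t] started at [x]: a translation by a germ for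
    integrals, a multiplication by [1 + V t - V u] for linear equations. *)
Fixpoint euler (u : R) (x : E) (s : seq R) : E :=
  if s is t :: s' then euler t (N u t x) s' else x.

Lemma euler_cat u x s1 s2 :
  euler u x (s1 ++ s2) = euler (last u s1) (euler u x s1) s2.
Proof. by elim: s1 u x => //= t s1 IH u x; rewrite IH. Qed.

(** For the local estimate, partitions of [[a, s]] and [[s, t]] are concatenated. Deleting the
    interior points of the second one costs the stated error and leaves the single step [N s t]; as
    this step is Lipschitz, the meshes can tend to 0. *)
Lemma euler_sewing (a b theta C : R) (x0 : E) : 1 < theta -> 0 <= C -> a <= b ->
  (forall s t, exists2 L, 0 <= L & forall x y,
     `|N s t x - N s t y| <= L * `|x - y|) ->
  removal_bound a theta C (euler a x0) (fun s => all (<= b) s) ->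
  exists y : R -> E, [/\ y a = x0,
    forall s t, a <= s -> s < t -> t <= b ->
      `|y t - N s t (y s)| <= sewing_cst theta * C * (t - s) `^ theta &
    forall t d s, a <= t <= b -> 0 < d -> itv_partition a t s -> fine d a s ->
      `|euler a x0 s - y t|
        <= 2 * (sewing_cst theta * C * d `^ (theta - 1) * (t - a))].
Proof.
move=> th1 C0 ab NL rb.
pose Q := (fun s : seq R => all (<= b) s : Prop).
have Qs s1 s2 : subseq s1 s2 -> Q s2 -> Q s1.
  by move=> /mem_subseq ss /allP h; apply/allP => x /ss /h.
have Qp t s : t <= b -> itv_partition a t s -> Q s.
  move=> tb [p /eqP l]; apply: sub_all (path_all_le p) => x /= h.
  by apply: le_trans h _; rewrite l.
have /choice [y hy] (t : R) : exists y : E, a <= t <= b -> forall d s, 0 < d ->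
    itv_partition a t s -> fine d a s -> `|euler a x0 s - y|
      <= 2 * (sewing_cst theta * C * d `^ (theta - 1) * (t - a)).
  have [/andP[at_ tb]|_] := boolP (a <= t <= b); last by exists 0.
  have [y hy] := sewing_lim th1 C0 Qs rb at_ (fun s => Qp t s tb).
  by exists y.
have kC : 0 <= sewing_cst theta * C.
  by rewrite mulr_ge0 // ltW // sewing_cst_gt0.
have th0 : 0 < theta - 1 by rewrite subr_gt0.
have bnd t d s : a <= t <= b -> 0 < d -> itv_partition a t s -> fine d a s ->
    `|euler a x0 s - y t|
      <= 2 * (sewing_cst theta * C * (b - a)) * d `^ (theta - 1).
  move=> tab d0 ps fs; apply: le_trans (hy _ tab _ _ d0 ps fs) _.
  rewrite -!mulrA ler_wpM2l // !mulrA mulrAC ler_wpM2r ?powR_ge0 //.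
  by rewrite ler_wpM2l // lerD2r; case/andP: tab.
exists y; split=> //; last by move=> t d s tab; exact: hy.
  have aa : a <= a <= b by rewrite lexx.
  apply/esym/subr0_eq/eqP; rewrite -normr_eq0 eq_le normr_ge0 andbT.
  have pa : itv_partition a a [::] by split.
  have := hy _ aa 1 [::] ltr01 pa isT.
  by rewrite subrr !mulr0.
move=> s t as_ st tb.
apply/ler_addgt0Pr => e e0.
have [L L0 hL] := NL s t.
have M0 : 0 <= (1 + L) * (2 * (sewing_cst theta * C * (b - a))).
  rewrite mulr_ge0 ?addr_ge0 // mulr_ge0 // mulr_ge0 // subr_ge0.
  by rewrite (le_trans as_) // (le_trans (ltW st)).
have [d d0 hd] := powR_small th0 M0 e0.
have [s1 ps1 fs1] := exists_fine_partition as_ d0.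
have [s2 ps2 fs2] := exists_fine_partition (ltW st) d0.
have sab : a <= s <= b by rewrite as_ (le_trans (ltW st)).
have tab : a <= t <= b by rewrite (le_trans as_ (ltW st)).
have l1 : last a s1 = s by case: ps1 => _ /eqP.
have p12 := itv_partition_cat ps1 ps2.
have f12 : fine d a (s1 ++ s2) by rewrite fine_cat fs1 l1.
have b1 := bnd _ _ _ sab d0 ps1 fs1.
have b2 := bnd _ _ _ tab d0 p12 f12.
have b3 : `|euler a x0 (s1 ++ s2) - N s t (euler a x0 s1)|
    <= sewing_cst theta * C * (t - s) `^ theta.
  (* As [s < t], the second partition is nonempty; its last point [t] is kept and the others are
     deleted. *)
  case/lastP: s2 ps2 fs2 p12 f12 b2 => [[_ /eqP/= e']|s2 z].
    by move: st; rewrite e' ltxx.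
  move=> [_ /eqP]; rewrite last_rcons => -> _.
  rewrite -cats1 => p12 _ _; have Q12 := Qp _ _ tb p12.
  case: p12 => p12 _.
  have := sewing_block th1 C0 Qs rb p12 Q12.
  by rewrite (euler_cat _ _ s1 [:: _]) /= l1.
have b4 : `|N s t (euler a x0 s1) - N s t (y s)|
    <= L * (2 * (sewing_cst theta * C * (b - a)) * d `^ (theta - 1)).
  by apply: le_trans (hL _ _) _; rewrite ler_wpM2l.
apply: le_trans (ler_distD (N s t (euler a x0 s1)) _ _) _.
apply: le_trans (lerD (ler_distD (euler a x0 (s1 ++ s2)) _ _) b4) _.
rewrite distrC in b2.
apply: le_trans (lerD (lerD b2 b3) (lexx _)) _.
rewrite -addrA addrCA lerD2l; apply: le_trans hd.
by rewrite le_eqVlt; apply/orP; left; apply/eqP; ring.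
Qed.

End EulerScheme.

(** * Additive sewing of germs *)

Section AdditiveSewing.
Variables (R : realType) (E : completeNormedModType R).
Implicit Types (Xi : R -> R -> E) (I J : R -> E) (a b C theta : R).

Fixpoint rsum Xi (u : R) (s : seq R) : E :=
  if s is t :: s' then Xi u t + rsum Xi t s' else 0.

Definition coherent a b theta C Xi := forall s u t,
  a <= s -> s <= u -> u <= t -> t <= b ->
  `|Xi s t - Xi s u - Xi u t| <= C * (t - s) `^ theta.

(** [I] is an indefinite integral of the germ [Xi], with its initial value left free. The condition
    restricts to subintervals and adds up, unlike a statement on limits of sums. *)
Definition sews a b theta C Xi I := forall s t, a <= s -> s <= t -> t <= b ->
  `|I t - I s - Xi s t| <= C * (t - s) `^ theta.

Lemma sews_sub a b a' b' theta C Xi I : a <= a' -> b' <= b ->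
  sews a b theta C Xi I -> sews a' b' theta C Xi I.
Proof.
move=> aa bb h s t as_ st tb; apply: h => //.
  exact: le_trans as_.
exact: le_trans bb.
Qed.

Lemma coherent_sub a b a' b' theta C Xi : a <= a' -> b' <= b ->
  coherent a b theta C Xi -> coherent a' b' theta C Xi.
Proof.
move=> aa bb h s u t as_ su ut tb; apply: h => //.
  exact: le_trans as_.
exact: le_trans bb.
Qed.

Lemma coherent_diag a b theta C Xi s : 0 < theta -> coherent a b theta C Xi ->
  a <= s <= b -> Xi s s = 0.
Proof.
move=> th0 h /andP[as_ sb]; have := h s s s as_ (lexx _) (lexx _) sb.
rewrite (subrr s) powR0 ?gt_eqF // mulr0 subrr sub0r normrN.
by rewrite normr_le0 => /eqP.
Qed.

Lemma sewsD a b theta C D Xi Xj I J : sews a b theta C Xi I ->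
  sews a b theta D Xj J ->
  sews a b theta (C + D) (fun s t => Xi s t + Xj s t) (fun t => I t + J t).
Proof.
move=> hI hJ s t as_ st tb; rewrite mulrDl.
have -> : I t + J t - (I s + J s) - (Xi s t + Xj s t)
  = (I t - I s - Xi s t) + (J t - J s - Xj s t) by zmod.
by apply: le_trans (ler_normD _ _) _; rewrite lerD ?hI ?hJ.
Qed.

Lemma sewsB a b theta C D Xi Xj I J : sews a b theta C Xi I ->
  sews a b theta D Xj J ->
  sews a b theta (C + D) (fun s t => Xi s t - Xj s t) (fun t => I t - J t).
Proof.
move=> hI hJ s t as_ st tb; rewrite mulrDl.
have -> : I t - J t - (I s - J s) - (Xi s t - Xj s t)
  = (I t - I s - Xi s t) - (J t - J s - Xj s t) by zmod.
by apply: le_trans (ler_normB _ _) _; rewrite lerD ?hI ?hJ.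
Qed.

Lemma eq_sews a b theta C Xi Xj I :
  (forall s t, a <= s -> s <= t -> t <= b -> Xi s t = Xj s t) ->
  sews a b theta C Xi I -> sews a b theta C Xj I.
Proof. by move=> e h s t as_ st tb; rewrite -e //; exact: h. Qed.

Lemma sews_rsum a b theta C Xi I d s : 1 < theta -> 0 <= C ->
  sews a b theta C Xi I -> 0 <= d -> itv_partition a b s -> fine d a s ->
  `|rsum Xi a s - (I b - I a)| <= C * d `^ (theta - 1) * (b - a).
Proof.
move=> th1 C0 + d0; elim: s a => [|u s IH] a h.
  by move=> /itv_partition_nil <- _ /=; rewrite subrr sub0r oppr0 normr0 subrr mulr0.
move=> ps /= /andP[fu fs]; have ps' := itv_partition_cons ps.
have au : a < u by case: ps => /= /andP[].
have ub := itv_partition_le ps'.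
have {}IH := IH u (sews_sub (ltW au) (lexx b) h) ps' fs.
have -> : Xi a u + rsum Xi u s - (I b - I a)
  = - (I u - I a - Xi a u) + (rsum Xi u s - (I b - I u)) by zmod.
apply: le_trans (ler_normD _ _) _; rewrite normrN.
have -> : b - a = (u - a) + (b - u) by ring.
rewrite mulrDr; apply: lerD => //.
apply: le_trans (h _ _ (lexx _) (ltW au) ub) _.
rewrite -mulrA; apply: ler_wpM2l => //.
by apply: powR_split_le => //; rewrite subr_ge0 (ltW au) ltW.
Qed.

Lemma sews_cvg a b theta C Xi I : 1 < theta -> 0 <= C -> a <= b ->
  sews a b theta C Xi I -> rsum Xi a @ mesh_to0 a b --> I b - I a.
Proof.
move=> th1 C0 ab h; apply/cvgrPdist_lt => e e0.
have e20 : 0 < e / 2 by rewrite divr_gt0.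
have th0 : 0 < theta - 1 by rewrite subr_gt0.
have M0 : 0 <= C * (b - a) by rewrite mulr_ge0 // subr_ge0.
have [d d0 hd] := powR_small th0 M0 e20.
apply: (mesh_to0I d0) => s ps fs; rewrite distrC.
apply: le_lt_trans (sews_rsum th1 C0 h (ltW d0) ps fs) _.
by rewrite mulrAC; apply: le_lt_trans hd _; lra.
Qed.

(** Both sides are limits of the same Riemann sums. Identities between integrals are proved through
    this by comparing their germs. *)
Lemma sews_uniq a b theta C D Xi I J : 1 < theta -> 0 <= C -> 0 <= D ->
  a <= b -> sews a b theta C Xi I -> sews a b theta D Xi J ->
  I b - I a = J b - J a.
Proof.
move=> th1 C0 D0 ab hI hJ.
have mP := mesh_to0_proper ab.
exact: (cvg_unique _ (sews_cvg th1 C0 ab hI) (sews_cvg th1 D0 ab hJ)).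
Qed.

Lemma additive_sewing a b theta C Xi : 1 < theta -> 0 <= C -> a <= b ->
  coherent a b theta C Xi ->
  exists2 I, I a = 0 & sews a b theta (sewing_cst theta * C) Xi I.
Proof.
move=> th1 C0 ab h.
(* A scheme of translations: two runs along the same points keep their initial difference, so
   deleting a point changes the result by exactly the coherence defect of [Xi]. *)
pose N s t x := x + Xi s t.
have eN u x y s : euler N u x s - euler N u y s = x - y.
  by elim: s u x y => //= t s IH u x y; rewrite IH /N; zmod.
have th0 : 0 < theta by exact: lt_trans th1.
have [||y [ya hy _]] := @euler_sewing _ _ N a b theta C 0 th1 C0 ab.
- move=> s t; exists 1 => // x y; rewrite mul1r /N.
  by rewrite (_ : x + _ - _ = x - y) //; zmod.
- move=> l u t r p /allP q; rewrite !euler_cat /= eN /N.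
  have e (w x y z : E) : w + x + y - (w + z) = - (z - x - y) by zmod.
  rewrite e normrN; move: p; rewrite cat_path => /andP[/path_last_ge al].
  move=> /= /and3P[lu ut _]; apply: h => //; first exact: ltW.
    exact: ltW.
  by apply: q; rewrite mem_cat !inE eqxx !orbT.
exists y => // s t as_; rewrite le_eqVlt => /orP[/eqP <-|st] tb.
  rewrite subrr (coherent_diag th0 h) ?as_ // !subrr normr0.
  by rewrite powR0 ?gt_eqF // mulr0.
have := hy s t as_ st tb; rewrite /N opprD addrA; exact.
Qed.

(* A germ determines its integral, so any error constant can be replaced by
   the one that the coherence of the germ provides. *)
Lemma sews_improve a b theta C D Xi I : 1 < theta -> 0 <= C -> 0 <= D ->
  coherent a b theta C Xi -> sews a b theta D Xi I ->
  sews a b theta (sewing_cst theta * C) Xi I.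
Proof.
move=> th1 C0 D0 h hI s t as_ st tb.
have k0 : 0 <= sewing_cst theta * C by rewrite mulr_ge0 // ltW // sewing_cst_gt0.
have [J _ hJ] := additive_sewing th1 C0 st (coherent_sub as_ tb h).
rewrite (sews_uniq th1 D0 k0 st (sews_sub as_ tb hI) hJ).
exact: hJ.
Qed.

End AdditiveSewing.

(** * Young integrals *)

Section YoungIntegrals.
Variables (R : realType) (U V : normedModType R) (W : completeNormedModType R).

(** Covers products of scalars, products of matrices and scaling, so the Young estimates are proved
    once. *)
Record bounded_bilinear (mul : U -> V -> W) (M : R) : Prop := BoundedBilinear {
  bilin_ge0 : 0 <= M;
  bilinBl : forall x y z, mul (x - y) z = mul x z - mul y z;
  bilinBr : forall x y z, mul x (y - z) = mul x y - mul x z;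
  bilin_norm : forall x y, `|mul x y| <= M * `|x| * `|y| }.

Variables (mul : U -> V -> W) (M : R).
Hypothesis mulP : bounded_bilinear mul M.

Definition young_germ (f : R -> U) (g : R -> V) (s t : R) : W :=
  mul (f s) (g t - g s).

Lemma riemann_sumE a b f g s :
  riemann_sum mul a b f g s = rsum (young_germ f g) a s.
Proof.
rewrite /riemann_sum; elim: s a => [|t s IH] a /=; first by rewrite big_nil.
rewrite big_nat_recl //=; congr (_ + _); rewrite -IH.
by apply: eq_bigr => i _.
Qed.

Lemma young_sews a b theta C f g I : 1 < theta -> 0 <= C -> a <= b ->
  sews a b theta C (young_germ f g) I ->
  riemann_sum mul a b f g @ mesh_to0 a b --> I b - I a.
Proof.
move=> th1 C0 ab h.
have -> : riemann_sum mul a b f g = rsum (young_germ f g) a.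
  by apply/funext => s; exact: riemann_sumE.
exact: sews_cvg h.
Qed.

Lemma youngE a b theta C f g I : 1 < theta -> 0 <= C -> a <= b ->
  sews a b theta C (young_germ f g) I -> young mul a b f g = I b - I a.
Proof.
move=> th1 C0 ab h; have mP := mesh_to0_proper ab.
by apply: cvg_lim => //; exact: young_sews h.
Qed.

End YoungIntegrals.

Section BilinearMaps.
Variable R : realType.

Lemma mulr_bilinear : bounded_bilinear (fun a b : R => a * b) 1.
Proof.
split=> // [x y z|x y z|x y]; rewrite ?mulrBl ?mulrBr //.
by rewrite normrM mul1r.
Qed.

Lemma mulmx_bilinear m k n :
  bounded_bilinear (@mulmx R m k n) k%:R.
Proof.
split=> // [x y z|x y z|x y]; rewrite ?mulmxBl ?mulmxBr //.
exact: normr_mulmx.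
Qed.

Lemma scaler_bilinear (W : completeNormedModType R) :
  bounded_bilinear (fun (x : W) (c : R) => c *: x) 1.
Proof.
split=> // [x y z|x y z|x y]; rewrite ?scalerBl ?scalerBr //.
by rewrite normrZ mul1r mulrC.
Qed.

End BilinearMaps.

Section YoungEstimates.
Variables (R : realType) (rho : R).
Hypothesis rho_gt : 1 / 2 < rho.

Local Notation theta := (2 * rho).

Lemma theta_gt1 : 1 < theta. Proof. by move: rho_gt => ?; lra. Qed.

Lemma rho_gt0 : 0 < rho. Proof. by move: rho_gt => ?; lra. Qed.

Lemma powR_theta (x : R) : x `^ theta = x `^ rho * x `^ rho.
Proof.
rewrite mulr_natl mulr2n powRD //.
by apply/implyP; rewrite -mulr2n mulrn_eq0 /= gt_eqF // rho_gt0.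
Qed.

(** [holder_path] with its constant made explicit, because the bounds have to be uniform in it. *)
Definition hol (V : normedModType R) (a b K : R) (f : R -> V) :=
  forall u v, a <= u <= b -> a <= v <= b -> `|f u - f v| <= K * `|u - v| `^ rho.

Lemma hol_incr (V : normedModType R) a b K (f : R -> V) s t : hol a b K f ->
  a <= s -> s <= t -> t <= b -> `|f t - f s| <= K * (t - s) `^ rho.
Proof.
move=> h as_ st tb; have := h t s; rewrite ger0_norm ?subr_ge0 //; apply.
  by rewrite tb (le_trans as_).
by rewrite as_ (le_trans st).
Qed.

Lemma hol_of_incr (V : normedModType R) a b K (f : R -> V) :
  (forall s t, a <= s -> s <= t -> t <= b -> `|f t - f s| <= K * (t - s) `^ rho) ->
  hol a b K f.
Proof.
move=> h u v /andP[au ub] /andP[av vb].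
case: (leP u v) => [uv|/ltW vu].
  by rewrite distrC (distrC u) (ger0_norm (_ : 0 <= v - u)) ?subr_ge0 // h.
by rewrite (ger0_norm (_ : 0 <= u - v)) ?subr_ge0 // h.
Qed.

Lemma hol_sub (V : normedModType R) a b a' b' K (f : R -> V) :
  a <= a' -> b' <= b -> hol a b K f -> hol a' b' K f.
Proof.
move=> aa bb h u v /andP[a1 b1] /andP[a2 b2]; apply: h; apply/andP; split.
- exact: le_trans a1.
- exact: le_trans bb.
- exact: le_trans a2.
- exact: le_trans bb.
Qed.

Lemma hol_le (V : normedModType R) a b K L (f : R -> V) :
  K <= L -> hol a b K f -> hol a b L f.
Proof.
move=> KL h u v hu hv; apply: le_trans (h u v hu hv) _.
by rewrite ler_wpM2r // powR_ge0.
Qed.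

Lemma eq_hol (V : normedModType R) a b K (f g : R -> V) :
  (forall t, a <= t <= b -> f t = g t) -> hol a b K f -> hol a b K g.
Proof. by move=> e h u v hu hv; rewrite -!e //; exact: h. Qed.

Lemma holD (V : normedModType R) a b K L (f g : R -> V) :
  hol a b K f -> hol a b L g -> hol a b (K + L) (fun t => f t + g t).
Proof.
move=> hf hg u v hu hv; rewrite mulrDl.
have -> : f u + g u - (f v + g v) = (f u - f v) + (g u - g v) by zmod.
by apply: le_trans (ler_normD _ _) _; rewrite lerD ?hf ?hg.
Qed.

Lemma holB (V : normedModType R) a b K L (f g : R -> V) :
  hol a b K f -> hol a b L g -> hol a b (K + L) (fun t => f t - g t).
Proof.
move=> hf hg u v hu hv; rewrite mulrDl.
have -> : f u - g u - (f v - g v) = (f u - f v) - (g u - g v) by zmod.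
by apply: le_trans (ler_normB _ _) _; rewrite lerD ?hf ?hg.
Qed.

Lemma hol_cst (V : normedModType R) a b K (x : V) :
  0 <= K -> hol a b K (fun=> x).
Proof. by move=> K0 u v _ _; rewrite subrr normr0 mulr_ge0 // powR_ge0. Qed.

Lemma holder_path_hol (V : normedModType R) a b (f : R -> V) :
  holder_path rho a b f -> exists2 K, 0 <= K & hol a b K f.
Proof.
move=> [K h]; exists `|K| => // u v hu hv; apply: le_trans (h u v hu hv) _.
by rewrite ler_wpM2r ?powR_ge0 // ler_norm.
Qed.

Lemma hol_sup (V : normedModType R) a b K (f : R -> V) t : 0 <= K ->
  b - a <= 1 -> hol a b K f -> a <= t <= b -> `|f t| <= `|f a| + K.
Proof.
move=> K0 ba h /andP[at_ tb]; rewrite -[f t](subrK (f a)) addrC.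
apply: le_trans (ler_normD _ _) _; rewrite lerD2l.
apply: le_trans (hol_incr h (lexx _) at_ tb) _.
rewrite ler_piMr // powR_le1 ?(ltW rho_gt0) // subr_ge0 at_ /=; lra.
Qed.

Section Estimates.
Variables (U V : normedModType R) (W : completeNormedModType R).
Variables (mul : U -> V -> W) (M : R).
Hypothesis mulP : bounded_bilinear mul M.
Variables (a b Kf Kg : R) (f : R -> U) (g : R -> V).
Hypotheses (Kf0 : 0 <= Kf) (Kg0 : 0 <= Kg).
Hypotheses (hf : hol a b Kf f) (hg : hol a b Kg g).

Let C0 : 0 <= M * Kf * Kg.
Proof. by rewrite !mulr_ge0 // (bilin_ge0 mulP). Qed.

Lemma young_coherent : coherent a b theta (M * Kf * Kg) (young_germ mul f g).
Proof.
move=> s u t as_ su ut tb; rewrite /young_germ.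
(* The defect of the left-point germ is a product of two increments of order [rho]. *)
have -> : mul (f s) (g t - g s) - mul (f s) (g u - g s) - mul (f u) (g t - g u)
    = - mul (f u - f s) (g t - g u).
  by rewrite !(bilinBl mulP, bilinBr mulP); zmod.
rewrite normrN; apply: le_trans (bilin_norm mulP _ _) _.
rewrite powR_theta -mulrA.
have -> : M * Kf * Kg * ((t - s) `^ rho * (t - s) `^ rho)
  = M * ((Kf * (t - s) `^ rho) * (Kg * (t - s) `^ rho)) by ring.
rewrite ler_wpM2l ?(bilin_ge0 mulP) //.
have h1 := hol_incr hf as_ su (le_trans ut tb).
have h2 := hol_incr hg (le_trans as_ su) ut tb.
rewrite ler_pM //.
  apply: le_trans h1 _; rewrite ler_wpM2l // ler_powR2r ?(ltW rho_gt0) //.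
    by rewrite subr_ge0.
  by rewrite lerD2r.
apply: le_trans h2 _; rewrite ler_wpM2l // ler_powR2r ?(ltW rho_gt0) //.
  by rewrite subr_ge0.
by rewrite lerD2l lerN2.
Qed.

Lemma young_exists : a <= b -> exists2 I, I a = 0 &
  sews a b theta (sewing_cst theta * (M * Kf * Kg)) (young_germ mul f g) I.
Proof.
move=> ab; apply: additive_sewing => //; [exact: theta_gt1|].
exact: young_coherent.
Qed.

Lemma young_integrable_hol : a <= b -> young_integrable mul rho a b f g.
Proof.
move=> ab; split; [by exists Kf|by exists Kg|].
have [I _ hI] := young_exists ab.
apply/cvg_ex; exists (I b - I a); apply: young_sews ab hI; first exact: theta_gt1.
by rewrite mulr_ge0 // ltW // sewing_cst_gt0 // theta_gt1.
Qed.

(** The germ gives the main term, and length at most 1 weakens the error from order [theta] to order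
    [rho]. [sews_improve] exchanges [D] for a constant bilinear in [Kf] and [Kg], which later makes
    estimates of differences proportional to the distance. *)
Lemma young_hol D I : b - a <= 1 -> 0 <= D ->
  (forall t, a <= t <= b -> `|f t| <= Kf) ->
  sews a b theta D (young_germ mul f g) I ->
  hol a b ((1 + sewing_cst theta) * (M * Kf * Kg)) I.
Proof.
move=> ba D0 fK /(sews_improve theta_gt1 C0 D0 young_coherent) hI.
apply: hol_of_incr => s t as_ st tb.
rewrite -[I t - I s](subrK (young_germ mul f g s t)) addrC.
apply: le_trans (ler_normD _ _) _; rewrite mulrDl mul1r mulrDl.
have ts1 : 0 <= t - s <= 1 by apply/andP; split; lra.
apply: lerD.
  apply: le_trans (bilin_norm mulP _ _) _.
  rewrite -[leRHS]mulrA ler_pM ?mulr_ge0 ?(bilin_ge0 mulP) //.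
    rewrite ler_wpM2l ?(bilin_ge0 mulP) // fK // as_ /=; lra.
  exact: hol_incr hg as_ st tb.
apply: le_trans (hI s t as_ st tb) _.
have k0 := mulr_ge0 (ltW (sewing_cst_gt0 theta_gt1)) C0.
rewrite powR_theta mulrA; apply: ler_piMr.
  by apply: mulr_ge0 => //; exact: powR_ge0.
by rewrite powR_le1 // ltW // rho_gt0.
Qed.

End Estimates.

End YoungEstimates.

(** * Linear Young equations *)

Section LinearEquations.
Variables (R : realType) (rho : R).
Hypothesis rho_gt : 1 / 2 < rho.

Local Notation theta := (2 * rho).
Local Notation kappa := (sewing_cst (2 * rho)).

Let th1 : 1 < theta. Proof. exact: theta_gt1. Qed.
Let rho0 : 0 < rho. Proof. exact: rho_gt0. Qed.

Section Products.
Variable q : nat.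
Implicit Type V : R -> 'M[R]_q.

Definition lstep V (s t : R) (x : 'M[R]_q) := x *m (1%:M + (V t - V s)).

Lemma euler_lstep V u x s :
  euler (lstep V) u x s = x *m euler (lstep V) u 1%:M s.
Proof.
elim: s u x => [|t s IH] u x /=; first by rewrite mulmx1.
by rewrite IH [in RHS]IH /lstep mul1mx mulmxA.
Qed.

(** Bounds [X *m (D1 *m D2) *m Y] with outer factors at most [B] and inner ones at most [K]; every
    product costs a factor [q]. *)
Definition removal_cst (K B : R) : R := q%:R * (q%:R * B * (q%:R * K * K)) * B.

Lemma removal_cst_ge0 K B : 0 <= K -> 0 <= B -> 0 <= removal_cst K B.
Proof. by move=> K0 B0; rewrite !mulr_ge0. Qed.

(** Deleting [u] between [x] and [t] replaces two factors by one and changes their product by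
    [(V u - V x) *m (V t - V u)], of order [2 * rho]. The products on both sides of it have to be
    bounded beforehand, whence the hypothesis with [B]. *)
Lemma lstep_removal V K B a (Q : seq R -> Prop) : 0 <= K -> 0 <= B ->
  hol rho 0 1 K V -> 0 <= a -> (forall s, Q s -> all (<= 1) s) ->
  (forall l u t r, path <%R a (l ++ u :: t :: r) -> Q (l ++ u :: t :: r) ->
     `|euler (lstep V) a 1%:M l| <= B /\ `|euler (lstep V) t 1%:M r| <= B) ->
  removal_bound a theta (removal_cst K B) (euler (lstep V) a 1%:M) Q.
Proof.
move=> K0 B0 hV a0 Q1 QB l u t r p Qs.
have [Bl Br] := QB _ _ _ _ p Qs.
have t1 : t <= 1.
  by apply: (allP (Q1 _ Qs)); rewrite mem_cat !inE eqxx !orbT.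
move: p; rewrite cat_path => /andP[/path_last_ge al] /= /and3P[lu ut _].
rewrite !euler_cat /= euler_lstep [X in _ - X]euler_lstep /lstep.
set x := last a l in al lu *; set X := euler _ _ _ l; set Y := euler _ _ _ r.
have -> : X *m (1%:M + (V u - V x)) *m (1%:M + (V t - V u)) *m Y
  - X *m (1%:M + (V t - V x)) *m Y
  = X *m ((V u - V x) *m (V t - V u)) *m Y.
  rewrite -mulmxBl -mulmxA -mulmxBr; congr (_ *m _ *m _).
  by rewrite !mulmxDl !mulmxDr !mul1mx !mulmx1; zmod.
have h1 := hol_incr hV (le_trans a0 al) (ltW lu) (le_trans (ltW ut) t1).
have h2 := hol_incr hV (le_trans a0 (le_trans al (ltW lu))) (ltW ut) t1.
have le1 : (u - x) `^ rho <= (t - x) `^ rho.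
  by rewrite ler_powR2r ?(ltW rho0) ?subr_ge0 ?ltW // ltrD2r.
have le2 : (t - u) `^ rho <= (t - x) `^ rho.
  by rewrite ler_powR2r ?(ltW rho0) ?subr_ge0 ?ltW // ltrD2l ltrN2.
have hD : `|(V u - V x) *m (V t - V u)| <= q%:R * K * K * (t - x) `^ theta.
  apply: le_trans (normr_mulmx _ _) _; rewrite powR_theta //.
  have -> : q%:R * K * K * ((t - x) `^ rho * (t - x) `^ rho)
    = q%:R * (K * (t - x) `^ rho) * (K * (t - x) `^ rho) by ring.
  have h3 := le_trans h1 (ler_wpM2l K0 le1).
  have h4 := le_trans h2 (ler_wpM2l K0 le2).
  by rewrite ler_pM ?mulr_ge0 // ler_wpM2l.
have -> : removal_cst K B * (t - x) `^ theta
  = q%:R * (q%:R * B * (q%:R * K * K * (t - x) `^ theta)) * B.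
  by rewrite /removal_cst; ring.
apply: le_trans (normr_mulmx _ _) _; rewrite ler_pM ?mulr_ge0 //.
rewrite ler_wpM2l //; apply: le_trans (normr_mulmx _ _) _.
by rewrite ler_pM ?mulr_ge0 // ler_wpM2l.
Qed.

Lemma lstep_norm V K s t : 0 <= K -> hol rho 0 1 K V -> 0 <= s -> s <= t ->
  t <= 1 -> `|1%:M + (V t - V s)| <= 1 + K * (t - s) `^ rho.
Proof.
move=> K0 hV s0 st t1; apply: le_trans (ler_normD _ _) _.
by rewrite lerD ?normr_mx1 //; exact: hol_incr hV s0 st t1.
Qed.

(* On a short interval the bound 2 on the shorter products propagates to the
   longer ones, because sewing makes the error quadratic in the increment. *)
Lemma short_products K : 0 <= K -> exists2 d, 0 < d & forall V a s,
  hol rho 0 1 K V -> 0 <= a -> path <%R a s -> last a s <= 1 ->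
  last a s - a <= d -> `|euler (lstep V) a 1%:M s| <= 2.
Proof.
move=> K0; have k0 : 0 < kappa by exact: sewing_cst_gt0.
have C0 : 0 <= removal_cst K 2 by exact: removal_cst_ge0.
have M0 : 0 <= K + kappa * removal_cst K 2.
  by rewrite addr_ge0 // mulr_ge0 // ltW.
have e0 : 0 < 2^-1 :> R by rewrite invr_gt0.
(* For this [d] the new product is at most [1 + 1 / 2], which closes the induction; taking the
   minimum with 1 makes order [theta] smaller than order [rho]. *)
have [d d0 hd] := powR_small rho0 M0 e0.
exists (Num.min d 1); first by rewrite lt_min d0 ltr01.
move=> V a s hV; have [n] := ubnP (size s); elim: n a s => // n IH a s.
rewrite ltnS; case/lastP: s => [|s z] ns a0 ps l1 lz /=.
  by apply: le_trans (normr_mx1 _ _) _; rewrite ler1n.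
rewrite last_rcons in l1 lz.
have az : a < z by move: ps; rewrite rcons_path => /andP[/path_last_ge] /le_lt_trans; apply.
(* At most [n] points: once a point and its successor are taken out, the pieces on both sides are
   short enough for the induction hypothesis. *)
pose Q := (fun l : seq R => (size l <= n)%N /\ all (<= z) l).
have QS s1 s2 : subseq s1 s2 -> Q s2 -> Q s1.
  move=> ss [h1 /allP h2]; split; first exact: leq_trans (size_subseq ss) h1.
  by apply/allP => x /(mem_subseq ss)/h2.
have all_last x l : x <= z -> all (<= z) l -> last x l <= z.
  move=> xz /allP h; have := mem_last x l; rewrite inE => /orP[/eqP -> //|].
  exact: h.
have rb : removal_bound a theta (removal_cst K 2) (euler (lstep V) a 1%:M) Q.
  apply: lstep_removal => //.
    by move=> l [_ /allP h]; apply/allP => x /h /le_trans; apply.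
  move=> l u t r p [sz]; rewrite all_cat /= => /and4P[hl hu ht hr].
  have szl : (size l < n)%N.
    by apply: leq_trans sz; rewrite size_cat /= !addnS ltnS leqW // leq_addr.
  have szr : (size r < n)%N.
    by apply: leq_trans sz; rewrite size_cat /= !addnS ltnS leqW // leq_addl.
  have ll := all_last a l (ltW az) hl; have lr := all_last t r ht hr.
  move: p; rewrite cat_path => /andP[pl /= /and3P[lu ut pr]].
  have at_ : a <= t := le_trans (path_last_ge pl) (ltW (lt_trans lu ut)).
  split; apply: IH => //.
  - exact: le_trans ll l1.
  - by apply: le_trans lz; rewrite lerD2r.
  - exact: le_trans at_.
  - exact: le_trans lr l1.
  - by apply: le_trans lz; apply: lerB.
(* All interior points are deleted at once, which compares the product with the single step from [a]
   to [z]. *)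
have := sewing_block th1 C0 QS rb (s := s) (l := [::]) (t := z) (r := [::]).
rewrite !cats1 /= => /(_ ps) h.
have {}h := h _; have Qs : Q (rcons s z).
  split=> //; have := path_all_le ps; by rewrite last_rcons.
have {}h := h Qs; rewrite /lstep mul1mx in h.
rewrite -[euler _ _ _ _](subrK (1%:M + (V z - V a))).
apply: le_trans (ler_normD _ _) _.
have hm := lstep_norm K0 hV a0 (ltW az) l1.
apply: le_trans (lerD h hm) _.
move: lz; rewrite le_min => /andP[zd z1].
have za0 : 0 <= z - a by rewrite subr_ge0 ltW.
have zr : (z - a) `^ rho <= d `^ rho by rewrite ler_powR2r // ltW.
have zr1 : (z - a) `^ rho <= 1 by rewrite powR_le1 ?(ltW rho0) // za0.
have zr0 : 0 <= (z - a) `^ rho by exact: powR_ge0.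
have kC : 0 <= kappa * removal_cst K 2 by rewrite mulr_ge0 // ltW.
have : kappa * removal_cst K 2 * (z - a) `^ theta
    <= kappa * removal_cst K 2 * d `^ rho.
  rewrite ler_wpM2l // powR_theta //; apply: le_trans zr.
  by rewrite ler_piMr.
have : K * (z - a) `^ rho <= K * d `^ rho by rewrite ler_wpM2l.
move: hd; rewrite mulrDl.
set A := kappa * _ * _ ; set B := kappa * _ * _; set D := K * _; set F := K * _.
by move=> *; lra.
Qed.

(** The interval is covered by boundedly many pieces of length [d], each of which costs one factor
    [B]. *)
Lemma bounded_products K : 0 <= K -> exists2 B, 0 <= B & forall V a s,
  hol rho 0 1 K V -> 0 <= a -> path <%R a s -> last a s <= 1 ->
  `|euler (lstep V) a 1%:M s| <= B.
Proof.
move=> K0; have [d d0 hd] := short_products K0.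
(* A short product of norm at most 2 is followed by the step that crosses [a + d], of norm at most
   [1 + K]. The summand 2 ensures [2 <= B] for a last piece without crossing. *)
pose B := q%:R * (q%:R * 2 * (1 + K)) + 2.
have B0 : 0 <= q%:R * (q%:R * 2 * (1 + K)) by rewrite !mulr_ge0 // addr_ge0.
have B2 : 2 <= B by rewrite lerDr.
have B1 : 1 <= B by apply: le_trans B2; rewrite ler1n.
exists (B ^+ Num.bound (1 / d)); first by rewrite exprn_ge0 // (le_trans ler01).
move=> V a s hV a0 ps l1.
have : last a s - a <= (Num.bound (1 / d))%:R * d.
  apply: (@le_trans _ _ 1); first by lra.
  by rewrite -ler_pdivrMr //; apply/ltW/archi_boundP; rewrite divr_ge0 // ltW.
elim: (Num.bound _) a s a0 ps l1 => [|n IH] a s a0 ps l1.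
  rewrite mul0r => h; have -> : s = [::].
    apply: (path_last_eq ps); apply/le_anti/andP; split.
      by rewrite -subr_le0.
    exact: path_last_ge ps.
  by rewrite expr0 normr_mx1.
rewrite -natr1 mulrDl mul1r => h.
have [l [r [sE /allP lm rm]]] := split_gt (a + d) s.
have ll : last a l <= a + d.
  have := mem_last a l; rewrite inE => /orP[/eqP -> |/lm //]; lra.
case: rm => [r0|[y [r' [rE my]]]].
  move: ps l1; rewrite sE r0 cats0 => ps l1.
  apply: le_trans (hd V a l hV a0 ps l1 _) _; first by lra.
  by rewrite exprS (le_trans B2) // ler_peMr ?exprn_ege1 // (le_trans ler01).
move: ps l1 h; rewrite sE rE cat_path last_cat /= => /and3P[pl ly pr] l1 h.
rewrite euler_cat /= euler_lstep /lstep exprS.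
have ar := path_last_ge pr; have al := path_last_ge pl.
have hr : `|euler (lstep V) y 1%:M r'| <= B ^+ n.
  by apply: IH => //; [exact: le_trans (le_trans al (ltW ly))|lra].
have hl : `|euler (lstep V) a 1%:M l| <= 2.
  apply: hd => //; last by lra.
  by rewrite (le_trans _ l1) // (le_trans (ltW ly)).
apply: le_trans (normr_mulmx _ _) _; rewrite ler_pM ?mulr_ge0 //.
apply: (@le_trans _ _ (q%:R * (q%:R * 2 * (1 + K)))); last by rewrite lerDl.
rewrite ler_wpM2l //; apply: le_trans (normr_mulmx _ _) _.
rewrite ler_pM ?mulr_ge0 // ?ler_wpM2l //.
have y1 : y <= 1 := le_trans ar l1.
apply: le_trans (lstep_norm K0 hV (le_trans a0 al) (ltW ly) y1) _.
rewrite lerD2l ler_piMr // powR_le1 ?(ltW rho0) // subr_ge0 (ltW ly) /=; lra.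
Qed.

Lemma linear_exists K : 0 <= K -> exists2 C, 0 <= C & forall V,
  hol rho 0 1 K V -> exists F : R -> 'M[R]_q,
    [/\ F 0 = 1%:M, forall t, 0 <= t <= 1 -> `|F t| <= C,
        hol rho 0 1 C F & sews 0 1 theta C (young_germ mulmx F V) F].
Proof.
move=> K0; have [B B0 hB] := bounded_products K0.
have k0 : 0 < kappa by exact: sewing_cst_gt0.
set D := removal_cst K B; have D0 : 0 <= D by exact: removal_cst_ge0.
have kD : 0 <= kappa * D by rewrite mulr_ge0 // ltW.
pose C := B + 1 + q%:R * (B + 1) * K + kappa * D.
have P0 : 0 <= q%:R * (B + 1) * K by rewrite !mulr_ge0 // addr_ge0.
have C0 : 0 <= C by rewrite !addr_ge0.
exists C => // V hV.
have rb : removal_bound 0 theta D (euler (lstep V) 0 1%:M) (fun s => all (<= 1) s).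
  apply: lstep_removal => // l u t r p /allP q1.
  have last1 x s : x <= 1 -> {subset s <= l ++ u :: t :: r} -> last x s <= 1.
    move=> x1 ss; have := mem_last x s; rewrite inE => /orP[/eqP -> //|/ss].
    exact: q1.
  have tin : t \in l ++ u :: t :: r by rewrite mem_cat !inE eqxx !orbT.
  move: p; rewrite cat_path => /andP[pl /= /and3P[lu ut pr]].
  split; apply: hB => //.
  - by apply: last1 => // x xl; rewrite mem_cat xl.
  - by apply: le_trans (path_last_ge pl) (ltW (lt_trans lu ut)).
  - apply: last1; first exact: q1.
    by move=> x xr; rewrite mem_cat !inE xr !orbT.
have [|y [y0 hy hlim]] := @euler_sewing _ _ (lstep V) 0 1 theta D 1%:M th1 D0 ler01 _ rb.
  move=> s t; exists (q%:R * `|1%:M + (V t - V s)|); first by rewrite mulr_ge0.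
  move=> x z; rewrite /lstep -mulmxBl; apply: le_trans (normr_mulmx _ _) _.
  by rewrite mulrAC.
(* The limit is compared with a product over a partition so fine that the sewing error is at most
   1. *)
have yB t : 0 <= t <= 1 -> `|y t| <= B + 1.
  move=> /andP[t0 t1].
  have M0 : 0 <= 2 * (kappa * D) by rewrite mulr_ge0.
  have thm : 0 < theta - 1 by rewrite subr_gt0.
  have [d d0 hd] := powR_small thm M0 ltr01.
  have [s ps fs] := exists_fine_partition t0 d0.
  have t01 : 0 <= t <= 1 by rewrite t0.
  have h := hlim t d s t01 d0 ps fs.
  have [p /eqP lst] := ps.
  have lst1 : last 0 s <= 1 by rewrite lst.
  have hb := hB V 0 s hV (lexx _) p lst1.
  rewrite -[y t](subrK (euler (lstep V) 0 1%:M s)) addrC.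
  apply: le_trans (ler_normD _ _) (lerD hb _); rewrite distrC.
  apply: le_trans h _; apply: le_trans hd; rewrite subr0 -[leRHS]mulrA ler_wpM2l //.
  by apply: ler_piMr => //; apply: mulr_ge0 => //; exact: powR_ge0.
have sy : sews 0 1 theta (kappa * D) (young_germ mulmx y V) y.
  move=> s t s0; rewrite le_eqVlt => /orP[/eqP <- _|st t1].
    rewrite /young_germ !subrr mulmx0 subr0 normr0 mulr_ge0 ?powR_ge0 //.
  have := hy s t s0 st t1; rewrite /lstep mulmxDr mulmx1 /young_germ.
  by rewrite opprD addrA.
exists y; split=> //.
- move=> t /yB h; apply: le_trans h _; rewrite /C -addrA lerDl.
  by rewrite addr_ge0.
- apply: hol_of_incr => s t s0 st t1.
  rewrite -[y t - y s](subrK (young_germ mulmx y V s t)).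
  apply: le_trans (ler_normD _ _) _.
  have ts : 0 <= t - s <= 1 by apply/andP; split; lra.
  have h1 : `|young_germ mulmx y V s t|
      <= q%:R * (B + 1) * K * (t - s) `^ rho.
    apply: le_trans (normr_mulmx _ _) _; rewrite -[leRHS]mulrA.
    rewrite ler_pM ?mulr_ge0 ?ler_wpM2l ?yB ?s0 ?(le_trans st) //.
    exact: hol_incr hV s0 st t1.
  have h2 := sy s t s0 st t1.
  have h3 : kappa * D * (t - s) `^ theta <= kappa * D * (t - s) `^ rho.
    rewrite ler_wpM2l // powR_theta // ler_piMr ?powR_ge0 //.
    by rewrite powR_le1 // ltW.
  apply: le_trans (lerD (le_trans h2 h3) h1) _.
  rewrite -mulrDl ler_wpM2r ?powR_ge0 // /C addrC -[leRHS]addrA lerDr.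
  by rewrite addr_ge0.
- move=> s t s0 st t1; apply: le_trans (sy s t s0 st t1) _.
  by rewrite ler_wpM2r ?powR_ge0 // /C lerDr addr_ge0 // addr_ge0.
Qed.

End Products.

End LinearEquations.

Section Transpose.
Variable R : realType.

Lemma trmxB m n (A B : 'M[R]_(m, n)) : (A - B)^T = A^T - B^T.
Proof. by apply/matrixP => i j; rewrite !mxE. Qed.

Lemma trmxN m n (A : 'M[R]_(m, n)) : (- A)^T = - A^T.
Proof. by apply/matrixP => i j; rewrite !mxE. Qed.

End Transpose.

(** * Inverses, flow property, uniqueness and Lipschitz bounds *)

Section LinearFlow.
Variables (R : realType) (rho : R).
Hypothesis rho_gt : 1 / 2 < rho.

Local Notation theta := (2 * rho).
Local Notation kappa := (sewing_cst (2 * rho)).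

Let th1 : 1 < theta. Proof. exact: theta_gt1. Qed.

Lemma sews_zero_cst (E : completeNormedModType R) a b C (f : R -> E) :
  0 <= C -> a <= b -> sews a b theta C (fun _ _ => 0) f -> f b = f a.
Proof.
move=> C0 ab h.
have h0 : sews a b theta 0 (fun _ _ => 0 : E) (fun=> 0).
  by move=> s t _ _ _; rewrite !subrr normr0 mul0r.
by apply/subr0_eq; rewrite (sews_uniq th1 C0 (lexx _) ab h h0) subrr.
Qed.

(** The equation [dF = F dV] in local form with free initial value, suited to restriction,
    reparametrization and gluing. *)
Definition lode q a b (V F : R -> 'M[R]_q) := exists2 C, 0 <= C &
  hol rho a b C F /\ sews a b theta C (young_germ mulmx F V) F.

Lemma lode_sub q a b a' b' (V F : R -> 'M[R]_q) : a <= a' -> b' <= b ->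
  lode a b V F -> lode a' b' V F.
Proof.
move=> aa bb [C C0 [h s]]; exists C => //; split.
  exact: hol_sub h.
exact: sews_sub s.
Qed.

(* [F G^T] has increments of order [2 rho > 1], so it is constant. *)
Lemma lode_inv_cst q a b K (V F G : R -> 'M[R]_q) : 0 <= K -> a <= b ->
  b - a <= 1 -> hol rho a b K V -> lode a b V F ->
  lode a b (fun t => - (V t)^T) G -> F b *m (G b)^T = F a *m (G a)^T.
Proof.
move=> K0 ab ba hV [C C0 [hF sF]] [D D0 [hG sG]].
pose BF := `|F a| + C; pose BG := `|G a| + D.
have BF0 : 0 <= BF by rewrite addr_ge0.
have BG0 : 0 <= BG by rewrite addr_ge0.
have FB t : a <= t <= b -> `|F t| <= BF by exact: hol_sup hF.
have GB t : a <= t <= b -> `|G t| <= BG by exact: hol_sup hG.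
pose L := q%:R * C * BG + (q%:R * BF * D + q%:R * (q%:R * BF * K) * D).
have L0 : 0 <= L by rewrite !addr_ge0 // !mulr_ge0.
apply: (@sews_zero_cst _ a b L (fun t => F t *m (G t)^T)) => //.
move=> s t as_ st tb; rewrite subr0.
have sab : a <= s <= b by rewrite as_ (le_trans st).
have tab : a <= t <= b by rewrite tb (le_trans as_).
have hr1 := sF s t as_ st tb; have hr2 := sG s t as_ st tb.
have hv := hol_incr hV as_ st tb; have hg := hol_incr hG as_ st tb.
rewrite /young_germ in hr1 hr2.
set r1 := F t - F s - _ in hr1; set r2 := G t - G s - _ in hr2.
(* The first-order terms [F s *m (V t - V s) *m (G s)^T] cancel; what is left are two remainders and
   a product of two increments. *)
have -> : F t *m (G t)^T - F s *m (G s)^T =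
  r1 *m (G t)^T + (F s *m r2^T + (F s *m (V t - V s)) *m (G t - G s)^T).
  rewrite /r1 /r2 !(trmxB, trmxN, trmx_mul, trmxK).
  rewrite !(mulmxBl, mulmxBr, mulmxN, mulNmx, mulmxDl, mulmxDr) !mulmxA.
  by zmod.
apply: le_trans (ler_normD _ _) _; rewrite mulrDl; apply: lerD.
  apply: le_trans (normr_mulmx _ _) _; rewrite normr_trmx.
  rewrite -[leRHS]mulrA [BG * _]mulrC [leRHS]mulrA ler_pM ?mulr_ge0 ?GB //.
  by rewrite -mulrA ler_wpM2l.
apply: le_trans (ler_normD _ _) _; rewrite mulrDl; apply: lerD.
  apply: le_trans (normr_mulmx _ _) _; rewrite normr_trmx -[leRHS]mulrA.
  by rewrite ler_pM ?mulr_ge0 // ler_wpM2l // FB.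
apply: le_trans (normr_mulmx _ _) _; rewrite normr_trmx powR_theta //.
have -> : q%:R * (q%:R * BF * K) * D * ((t - s) `^ rho * (t - s) `^ rho)
  = q%:R * (q%:R * BF * (K * (t - s) `^ rho)) * (D * (t - s) `^ rho) by ring.
rewrite ler_pM ?mulr_ge0 // ler_wpM2l //; apply: le_trans (normr_mulmx _ _) _.
by rewrite ler_pM ?mulr_ge0 // ler_wpM2l // FB.
Qed.

Lemma hol_opp_tr q a b K (V : R -> 'M[R]_q) :
  hol rho a b K V -> hol rho a b K (fun t => - (V t)^T).
Proof.
move=> h u v hu hv; have -> : - (V u)^T - - (V v)^T = (V v - V u)^T by rewrite trmxB; zmod.
by rewrite normr_trmx distrC; exact: h.
Qed.

Lemma lode_exists q K (V : R -> 'M[R]_q) : 0 <= K -> hol rho 0 1 K V ->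
  exists2 F, F 0 = 1%:M & lode 0 1 V F.
Proof.
move=> K0 hV; have [C C0 /(_ V hV) [F [F0 _ hF sF]]] := linear_exists rho_gt q K0.
by exists F => //; exists C.
Qed.

(** With [H] driven by [- V^T], both [F H^T] and [G H^T] are constant on [[a, b]]. Comparing them at
    [a] and [b] gives the claim multiplied by [(H b)^T], which is cancelled because the solution
    [G'] inverts it. *)
Lemma lode_flow q a b K (V F G : R -> 'M[R]_q) : 0 <= K -> 0 <= a -> a <= b ->
  b <= 1 -> hol rho 0 1 K V -> lode a b V F -> lode a b V G -> G a = 1%:M ->
  F b = F a *m G b.
Proof.
move=> K0 a0 ab b1 hV lF lG Ga.
have [H H0 lH] := lode_exists K0 (hol_opp_tr hV).
have [G' G'0 lG'] := lode_exists K0 hV.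
have ba : b - a <= 1 by lra.
have hVab := hol_sub a0 b1 hV.
have e1 := lode_inv_cst K0 ab ba hVab lF (lode_sub a0 b1 lH).
have e2 := lode_inv_cst K0 ab ba hVab lG (lode_sub a0 b1 lH).
have b0 := le_trans a0 ab.
have b1' : b - 0 <= 1 by rewrite subr0.
have e3 := lode_inv_cst K0 b0 b1' (hol_sub (lexx _) b1 hV)
  (lode_sub (lexx _) b1 lG') (lode_sub (lexx _) b1 lH).
rewrite G'0 H0 trmx1 mulmx1 in e3; have e4 := mulmx1C e3.
have e5 : F b *m (H b)^T = F a *m G b *m (H b)^T.
  by rewrite -mulmxA e2 Ga mul1mx e1.
by rewrite -[LHS]mulmx1 -[RHS]mulmx1 -e4 !mulmxA e5.
Qed.

Lemma lode_uniq q K (V F G : R -> 'M[R]_q) t : 0 <= K -> hol rho 0 1 K V ->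
  lode 0 1 V F -> lode 0 1 V G -> F 0 = G 0 -> 0 <= t <= 1 -> F t = G t.
Proof.
move=> K0 hV lF lG FG /andP[t0 t1].
have [H H0 lH] := lode_exists K0 hV.
rewrite (lode_flow K0 (lexx _) t0 t1 hV (lode_sub (lexx _) t1 lF)
  (lode_sub (lexx _) t1 lH) H0) FG.
by rewrite (lode_flow K0 (lexx _) t0 t1 hV (lode_sub (lexx _) t1 lG)
  (lode_sub (lexx _) t1 lH) H0).
Qed.

Section Solutions.
Variables (q k r : nat) (L : 'M[R]_(q, r) -> 'M[R]_(q, k)) (Lam : R).
Hypothesis Lam0 : 0 <= Lam.
Hypothesis L_lip : forall x y, `|L x - L y| <= Lam * `|x - y|.

Lemma hol_lip a b K (F : R -> 'M[R]_(q, r)) :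
  hol rho a b K F -> hol rho a b (Lam * K) (L \o F).
Proof.
move=> h u v hu hv; apply: le_trans (L_lip _ _) _.
by rewrite -mulrA ler_wpM2l // h.
Qed.

(** Trades the integral equation for a germ estimate: a solution differs by the constant [F0] from
    the integral sewn from its own germ. Stated for Lipschitz [L] so that [id] and [dev_field] are
    both covered. *)
Lemma young_solP K (V : R -> 'M[R]_(k, r)) F0 (F : R -> 'M[R]_(q, r)) :
  0 <= K -> hol rho 0 1 K V -> young_sol rho L V F0 F <->
  F 0 = F0 /\ exists2 C, 0 <= C &
    hol rho 0 1 C F /\ sews 0 1 theta C (young_germ mulmx (L \o F) V) F.
Proof.
move=> K0 hV; split=> [[hp F00 hF]|[F00 [C C0 [hF sF]]]].
  split=> //; have [C C0 hC] := holder_path_hol hp.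
  have hLF := hol_lip hC; have LC0 : 0 <= Lam * C by rewrite mulr_ge0.
  have [I I0 sI] := young_exists rho_gt (mulmx_bilinear R q k r) LC0 K0 hLF hV ler01.
  set D := kappa * _ in sI.
  have D0 : 0 <= D by apply: mulr_ge0; [exact: ltW (sewing_cst_gt0 th1)|rewrite !mulr_ge0].
  have FI t : 0 <= t <= 1 -> F t = F0 + I t.
    move=> /andP[t0 t1]; have [_ ->] : young_integrable mulmx rho 0 t (L \o F) V
      /\ F t = F0 + young mulmx 0 t (L \o F) V by apply: hF; rewrite t0.
    by rewrite (youngE th1 D0 t0 (sews_sub (lexx _) t1 sI)) I0 subr0.
  exists (C + D); first by rewrite addr_ge0.
  split; first by apply: hol_le hC; rewrite lerDl.
  move=> s t s0 st t1; rewrite (FI t) ?(le_trans s0) // (FI s) ?s0 ?(le_trans st) //.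
  rewrite opprD addrACA subrr add0r; apply: le_trans (sI s t s0 st t1) _.
  by rewrite ler_wpM2r ?powR_ge0 // lerDr.
split=> [||t /andP[t0 t1]] //; first by exists C.
have hLF := hol_sub (lexx _) t1 (hol_lip hF).
split.
  exact: (young_integrable_hol rho_gt (mulmx_bilinear R q k r)
    (mulr_ge0 Lam0 C0) K0 hLF (hol_sub (lexx _) t1 hV) t0).
rewrite (youngE th1 C0 t0 (sews_sub (lexx _) t1 sF)) F00.
by rewrite addrCA subrr addr0.
Qed.

End Solutions.

Lemma id_lip q r (x y : 'M[R]_(q, r)) : `|id x - id y| <= 1 * `|x - y|.
Proof. by rewrite mul1r. Qed.

(** The value at 1 is convertible to [young_endpoint rho id V 1%:M]. *)
Definition Dev q (V : R -> 'M[R]_q) : R -> 'M[R]_q :=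
  xget (fun=> 0) (young_sol rho id V 1%:M).

Lemma DevP q K (V : R -> 'M[R]_q) : 0 <= K -> hol rho 0 1 K V ->
  [/\ young_sol rho id V 1%:M (Dev V), Dev V 0 = 1%:M & lode 0 1 V (Dev V)].
Proof.
move=> K0 hV; have [F F0 lF] := lode_exists K0 hV.
have h : young_sol rho id V 1%:M (Dev V).
  apply: (@xgetPex _ (fun=> 0) (young_sol rho id V 1%:M)); exists F.
  by apply/(young_solP ler01 (@id_lip q q) _ _ K0 hV).
by have /(young_solP ler01 (@id_lip q q) _ _ K0 hV) [] := h.
Qed.

Lemma Dev_uniq q K (V F : R -> 'M[R]_q) t : 0 <= K -> hol rho 0 1 K V ->
  F 0 = 1%:M -> lode 0 1 V F -> 0 <= t <= 1 -> Dev V t = F t.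
Proof.
move=> K0 hV F0 lF t01; have [_ D0 lD] := DevP K0 hV.
by apply: lode_uniq hV lD lF _ t01; rewrite ?F0.
Qed.

Lemma Dev_wellposed q K (V : R -> 'M[R]_q) : 0 <= K -> hol rho 0 1 K V ->
  young_wellposed rho id V 1%:M.
Proof.
move=> K0 hV; have [sD D0 lD] := DevP K0 hV; exists (Dev V) => // G.
move=> /(young_solP ler01 (@id_lip q q) _ _ K0 hV) [G0 lG] t t01.
by rewrite (Dev_uniq K0 hV G0 lG t01).
Qed.

Lemma Dev_bound q K : 0 <= K -> exists2 C, 0 <= C & forall V : R -> 'M[R]_q,
  hol rho 0 1 K V -> [/\ forall t, 0 <= t <= 1 -> `|Dev V t| <= C,
        hol rho 0 1 C (Dev V) &
        sews 0 1 theta C (young_germ mulmx (Dev V) V) (Dev V)].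
Proof.
move=> K0; have [C C0 hC] := linear_exists rho_gt q K0; exists C => // V hV.
have [F [F0 bF hF sF]] := hC V hV.
have e t : 0 <= t <= 1 -> Dev V t = F t.
  by apply: Dev_uniq K0 hV F0 _; exists C.
split.
- by move=> t t01; rewrite e //; exact: bF.
- by apply: eq_hol hF => t t01; rewrite e.
- move=> s t s0 st t1; rewrite /young_germ !e ?s0 ?t1 ?(le_trans st) ?(le_trans s0) //.
  exact: sF.
Qed.

Lemma Dev_inv q K (V : R -> 'M[R]_q) t : 0 <= K -> hol rho 0 1 K V ->
  0 <= t <= 1 -> Dev V t *m (Dev (fun u => - (V u)^T) t)^T = 1%:M.
Proof.
move=> K0 hV /andP[t0 t1]; have hV' := hol_opp_tr hV.
have [_ D0 lD] := DevP K0 hV; have [_ D0' lD'] := DevP K0 hV'.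
have t01 : t - 0 <= 1 by rewrite subr0.
rewrite (lode_inv_cst K0 t0 t01 (hol_sub (lexx _) t1 hV)
  (lode_sub (lexx _) t1 lD) (lode_sub (lexx _) t1 lD')).
by rewrite D0 D0' trmx1 mulmx1.
Qed.

Section DifferenceBlock.
Variable q : nat.

(* Conjugating [block_mx A 0 0 B] by a unipotent matrix puts [c (A - B)] in the
   corner. Developments commute with this operation, so bounding developments
   of such blocks, with [c] the inverse of the distance between the drivers,
   bounds differences of developments. *)
Definition diff_block (c : R) (A B : 'M[R]_q) : 'M[R]_(q + q) :=
  block_mx A (c *: (A - B)) 0 B.

Lemma diff_blockB c A B A' B' :
  diff_block c A B - diff_block c A' B' = diff_block c (A - A') (B - B').
Proof.
rewrite /diff_block opp_block_mx add_block_mx subr0; congr block_mx.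
by rewrite -scalerBr; congr (_ *: _); zmod.
Qed.

Lemma diff_blockM c A B A' B' :
  diff_block c A B *m diff_block c A' B' = diff_block c (A *m A') (B *m B').
Proof.
rewrite /diff_block mulmx_block !mul0mx !mulmx0 !addr0 add0r.
rewrite -scalemxAr -scalemxAl -scalerDr !(mulmxBl, mulmxBr).
by congr (block_mx _ (_ *: _) _ _); zmod.
Qed.

Lemma diff_block1 c : diff_block c 1%:M 1%:M = 1%:M.
Proof. by rewrite /diff_block subrr scaler0 -scalar_mx_block. Qed.

Lemma normr_diff_block c A B C : 0 <= C -> `|A| <= C -> `|B| <= C ->
  `|c *: (A - B)| <= C -> `|diff_block c A B| <= C.
Proof. by move=> C0 hA hB hAB; apply: normr_block_mx => //; rewrite normr0. Qed.

Lemma diff_block_corner c A B : 0 < c ->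
  `|A - B| <= c^-1 * `|diff_block c A B|.
Proof.
move=> c0; rewrite ler_pdivlMl //; apply: le_trans (normr_ursubmx _).
by rewrite block_mxKur normrZ gtr0_norm.
Qed.

(** [diff_block c] respects differences and products, so the block of solutions solves the block
    equation, and uniqueness identifies it. The error constant found here grows with [c], which is
    harmless: uniqueness accepts any constant. *)
Lemma Dev_diff_block c K (V W : R -> 'M[R]_q) t : 0 <= K ->
  hol rho 0 1 K V -> hol rho 0 1 K W ->
  hol rho 0 1 K (fun u => diff_block c (V u) (W u)) -> 0 <= t <= 1 ->
  Dev (fun u => diff_block c (V u) (W u)) t = diff_block c (Dev V t) (Dev W t).
Proof.
move=> K0 hV hW hVW t01.
have [_ V0 [C C0 [hC sC]]] := DevP K0 hV; have [_ W0 [D D0 [hD sD]]] := DevP K0 hW.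
have nb A B X : 0 <= X -> `|A| <= C * X -> `|B| <= D * X ->
    `|diff_block c A B| <= (1 + `|c|) * (C + D) * X.
  move=> X0 hA hB; pose Y := C * X + D * X.
  have CX : 0 <= C * X by rewrite mulr_ge0.
  have DX : 0 <= D * X by rewrite mulr_ge0.
  have cY : 0 <= `|c| * Y by rewrite mulr_ge0 // addr_ge0.
  have -> : (1 + `|c|) * (C + D) * X = Y + `|c| * Y by rewrite /Y; ring.
  apply: normr_diff_block.
  - by rewrite addr_ge0 // addr_ge0.
  - by rewrite (le_trans hA) // /Y -addrA lerDl addr_ge0.
  - by rewrite (le_trans hB) // /Y addrAC lerDr addr_ge0.
  - rewrite normrZ; apply: (@le_trans _ _ (`|c| * Y)).
      rewrite ler_wpM2l //; apply: le_trans (ler_normB _ _) _; exact: lerD.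
    by rewrite lerDr addr_ge0.
apply: (@Dev_uniq _ K _ (fun u => diff_block c (Dev V u) (Dev W u))) => //.
  by rewrite V0 W0 diff_block1.
exists ((1 + `|c|) * (C + D)).
  by rewrite mulr_ge0 // addr_ge0.
split.
- move=> u v hu hv; rewrite diff_blockB; apply: nb; first exact: powR_ge0.
    exact: hC.
  exact: hD.
- move=> s u s0 su u1; rewrite /young_germ !diff_blockB diff_blockM diff_blockB.
  by apply: nb; [exact: powR_ge0|exact: sC|exact: sD].
Qed.

Lemma Dev_lip K : 0 <= K -> exists2 C, 0 <= C & forall e (V W : R -> 'M[R]_q),
  0 < e -> hol rho 0 1 K V -> hol rho 0 1 K W ->
  hol rho 0 1 (K * e) (fun t => V t - W t) ->
  hol rho 0 1 (C * e) (fun t => Dev V t - Dev W t) /\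
  forall t, 0 <= t <= 1 -> `|Dev V t - Dev W t| <= C * e.
Proof.
move=> K0; have [C C0 hC] := Dev_bound (q + q) K0.
exists C => // e V W e0 hV hW hVW.
have c0 : 0 < e^-1 by rewrite invr_gt0.
(* The corner of the block path has Hoelder constant [K * e / e], so the bound [C] is independent of
   [e]. *)
have hb : hol rho 0 1 K (fun u => diff_block e^-1 (V u) (W u)).
  move=> u v hu hv; rewrite diff_blockB; apply: normr_diff_block.
  - by rewrite mulr_ge0 ?powR_ge0.
  - exact: hV.
  - exact: hW.
  - rewrite normrZ gtr0_norm // ler_pdivrMl // mulrA [e * K]mulrC.
    have -> : V u - V v - (W u - W v) = V u - W u - (V v - W v) by zmod.
    exact: hVW.
have [bD hD _] := hC _ hb.
have corner (A B : 'M[R]_q) X : `|diff_block e^-1 A B| <= C * X ->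
    `|A - B| <= C * e * X.
  move=> h; apply: le_trans (diff_block_corner _ _ c0) _; rewrite invrK.
  by rewrite [C * e]mulrC -mulrA; apply: ler_wpM2l => //; exact: ltW.
split.
  move=> u v hu hv.
  rewrite subrACB; apply: corner; rewrite -diff_blockB.
  by rewrite -(Dev_diff_block K0 hV hW hb hu) -(Dev_diff_block K0 hV hW hb hv) hD.
move=> t t01; rewrite -[C * e]mulr1; apply: corner; rewrite mulr1.
by rewrite -(Dev_diff_block K0 hV hW hb t01) bD.
Qed.

End DifferenceBlock.

End LinearFlow.

(** * Hoelder surfaces *)

Section HolderSurfaces.
Variables (R : realType) (rho : R).
Hypothesis rho_gt : 1 / 2 < rho.

Local Notation theta := (2 * rho).

Let rho0 : 0 < rho. Proof. exact: rho_gt0. Qed.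

(* Indexing the four kinds of differences in the Hoelder norm by one type lets
   linear operations on surfaces be treated uniformly. *)
Inductive increment :=
  | Inc0 of R & R
  | Inc1 of R & R & R
  | Inc2 of R & R & R
  | Inc12 of R & R & R & R.

Definition inc_val (V : zmodType) (f : R * R -> V) (i : increment) : V :=
  match i with
  | Inc0 s t => f (s, t)
  | Inc1 s1 s2 t => f (s1, t) - f (s2, t)
  | Inc2 s t1 t2 => f (s, t1) - f (s, t2)
  | Inc12 s1 s2 t1 t2 => f (s1, t1) - f (s1, t2) - (f (s2, t1) - f (s2, t2))
  end.

Definition inc_size (i : increment) : R :=
  match i with
  | Inc0 s t => 1
  | Inc1 s1 s2 t => `|s1 - s2| `^ rho
  | Inc2 s t1 t2 => `|t1 - t2| `^ rho
  | Inc12 s1 s2 t1 t2 => `|s1 - s2| `^ rho * `|t1 - t2| `^ rho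
  end.

Definition inc_in (i : increment) : bool :=
  match i with
  | Inc0 s t => (0 <= s <= 1) && (0 <= t <= 1)
  | Inc1 s1 s2 t => [&& 0 <= s1 <= 1, 0 <= s2 <= 1 & 0 <= t <= 1]
  | Inc2 s t1 t2 => [&& 0 <= s <= 1, 0 <= t1 <= 1 & 0 <= t2 <= 1]
  | Inc12 s1 s2 t1 t2 =>
    [&& 0 <= s1 <= 1, 0 <= s2 <= 1, 0 <= t1 <= 1 & 0 <= t2 <= 1]
  end.

Lemma inc_size_ge0 i : 0 <= inc_size i.
Proof. by case: i => *; rewrite /= ?mulr_ge0 ?powR_ge0. Qed.

(** Up to constants, [K] bounds the Hoelder norm ([holder_norm_bd], [bd_holder_space]), but this
    form is a family of inequalities between reals without suprema. *)
Definition bd (V : normedModType R) (K : R) (f : R * R -> V) :=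
  forall i, inc_in i -> `|inc_val f i| <= K * inc_size i.

Lemma eq_inc_val (V : zmodType) (f g : R * R -> V) i : inc_in i ->
  (forall s t, 0 <= s <= 1 -> 0 <= t <= 1 -> f (s, t) = g (s, t)) ->
  inc_val f i = inc_val g i.
Proof.
case: i => [s t /andP[]|s1 s2 t /and3P[]|s t1 t2 /and3P[]|s1 s2 t1 t2 /and4P[]];
  by move=> *; rewrite /=; do ?[congr (_ - _)]; auto.
Qed.

Lemma inc_val_comp (V W : zmodType) (phi : V -> W) f i :
  (forall x y, phi (x - y) = phi x - phi y) ->
  inc_val (fun z => phi (f z)) i = phi (inc_val f i).
Proof. by move=> h; case: i => *; rewrite /= ?h. Qed.

Lemma inc_val_comp2 (V V' W : zmodType) (phi : V -> V' -> W) f g i :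
  (forall x y x' y', phi (x - y) (x' - y') = phi x x' - phi y y') ->
  inc_val (fun z => phi (f z) (g z)) i = phi (inc_val f i) (inc_val g i).
Proof. by move=> h; case: i => *; rewrite /= ?h. Qed.

Section Basic.
Variable V : normedModType R.
Implicit Types f g : R * R -> V.

Lemma eq_bd K f g :
  (forall s t, 0 <= s <= 1 -> 0 <= t <= 1 -> f (s, t) = g (s, t)) ->
  bd K f -> bd K g.
Proof. by move=> e h i hi; rewrite -(eq_inc_val hi e) h. Qed.

Lemma bd_le K L f : K <= L -> bd K f -> bd L f.
Proof.
move=> KL h i hi; apply: le_trans (h i hi) _.
by rewrite ler_wpM2r // inc_size_ge0.
Qed.

Lemma bd_ge0 K f : bd K f -> 0 <= K.
Proof.
move=> /(_ (Inc0 0 0)) /=; rewrite lexx ler01 mulr1 => /(_ isT).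
exact: le_trans.
Qed.

Lemma bdD K L f g : bd K f -> bd L g -> bd (K + L) (fun z => f z + g z).
Proof.
move=> hf hg i hi; rewrite mulrDl (@inc_val_comp2 _ _ _ +%R).
  by apply: le_trans (ler_normD _ _) _; rewrite lerD ?hf ?hg.
by move=> *; zmod.
Qed.

Lemma bdB K L f g : bd K f -> bd L g -> bd (K + L) (fun z => f z - g z).
Proof.
move=> hf hg i hi; rewrite mulrDl (@inc_val_comp2 _ _ _ (fun x y => x - y)).
  by apply: le_trans (ler_normB _ _) _; rewrite lerD ?hf ?hg.
by move=> *; zmod.
Qed.

Lemma bd_cst (x : V) : bd `|x| (fun=> x).
Proof.
case=> *; rewrite /= ?mulr1 //; rewrite ?subrr ?subr0 normr0 !mulr_ge0 ?powR_ge0 //.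
Qed.

Lemma bd_hol1 K f t : 0 <= t <= 1 -> bd K f ->
  hol rho 0 1 K (fun s => f (s, t)).
Proof. by move=> t01 h u v hu hv; apply: (h (Inc1 u v t)); rewrite /= hu hv. Qed.

Lemma bd_hol2 K f s : 0 <= s <= 1 -> bd K f ->
  hol rho 0 1 K (fun t => f (s, t)).
Proof. by move=> t01 h u v hu hv; apply: (h (Inc2 s u v)); rewrite /= hu hv t01. Qed.

Lemma bd_hol12 K f t1 t2 : 0 <= t1 <= 1 -> 0 <= t2 <= 1 -> bd K f ->
  hol rho 0 1 (K * `|t1 - t2| `^ rho) (fun s => f (s, t1) - f (s, t2)).
Proof.
move=> h1 h2 h u v hu hv; rewrite mulrAC -mulrA.
by apply: (h (Inc12 u v t1 t2)); rewrite /= hu hv h1.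
Qed.

Lemma bd_sup K f s t : bd K f -> 0 <= s <= 1 -> 0 <= t <= 1 -> `|f (s, t)| <= K.
Proof.
by move=> h hs ht; have := h (Inc0 s t); rewrite /= mulr1 hs ht; apply.
Qed.

End Basic.

Lemma bd_lin (V W : normedModType R) (phi : V -> W) M K f :
  (forall x y, phi (x - y) = phi x - phi y) ->
  (forall x, `|phi x| <= M * `|x|) -> 0 <= M ->
  bd K f -> bd (M * K) (fun z => phi (f z)).
Proof.
move=> hB hM M0 h i hi; rewrite inc_val_comp //; apply: le_trans (hM _) _.
by rewrite -mulrA ler_wpM2l // h.
Qed.

(** Leibniz rule for each kind of increment. The rectangular one yields four terms, each pairing
    increments whose sizes multiply to that of the rectangle; this is the origin of the factor 4. *)
Lemma bd_mul (U V : normedModType R) (W : completeNormedModType R)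
    (mul : U -> V -> W) M K L f g : bounded_bilinear mul M ->
  bd K f -> bd L g -> bd (4 * (M * K * L)) (fun z => mul (f z) (g z)).
Proof.
move=> mulP hf hg.
have K0 := bd_ge0 hf; have L0 := bd_ge0 hg; have M0 := bilin_ge0 mulP.
have C0 : 0 <= M * K * L by rewrite !mulr_ge0.
have nb i j x : inc_in i -> inc_in j -> inc_size i * inc_size j = x ->
    `|mul (inc_val f i) (inc_val g j)| <= M * K * L * x.
  move=> hi hj <-; apply: le_trans (bilin_norm mulP _ _) _.
  have -> : M * K * L * (inc_size i * inc_size j) =
    M * (K * inc_size i) * (L * inc_size j) by ring.
  by rewrite ler_pM ?mulr_ge0 // ?ler_wpM2l ?hf ?hg.
have four x : 4 * (M * K * L) * x = M * K * L * x + M * K * L * x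
   + (M * K * L * x + M * K * L * x) by ring.
have Cx x : 0 <= x -> 0 <= M * K * L * x by exact: mulr_ge0.
case=> [s t|s1 s2 t|s t1 t2|s1 s2 t1 t2].
- move=> hi; rewrite four -addrA ler_wpDr ?addr_ge0 ?mulr_ge0 ?inc_size_ge0 //.
  by apply: (nb (Inc0 s t) (Inc0 s t)); rewrite //= mulr1.
- move=> /and3P[h1 h2 ht]; rewrite /=.
  have -> : mul (f (s1, t)) (g (s1, t)) - mul (f (s2, t)) (g (s2, t))
    = mul (f (s1, t)) (g (s1, t) - g (s2, t))
      + mul (f (s1, t) - f (s2, t)) (g (s2, t)).
    by rewrite !(bilinBl mulP, bilinBr mulP); zmod.
  rewrite four ler_wpDr ?addr_ge0 ?Cx ?powR_ge0 //.
  apply: le_trans (ler_normD _ _) _; apply: lerD.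
    by apply: (nb (Inc0 s1 t) (Inc1 s1 s2 t)); rewrite /= ?h1 ?h2 ?mul1r.
  by apply: (nb (Inc1 s1 s2 t) (Inc0 s2 t)); rewrite /= ?h1 ?h2 ?mulr1.
- move=> /and3P[hs h1 h2]; rewrite /=.
  have -> : mul (f (s, t1)) (g (s, t1)) - mul (f (s, t2)) (g (s, t2))
    = mul (f (s, t1)) (g (s, t1) - g (s, t2))
      + mul (f (s, t1) - f (s, t2)) (g (s, t2)).
    by rewrite !(bilinBl mulP, bilinBr mulP); zmod.
  rewrite four ler_wpDr ?addr_ge0 ?Cx ?powR_ge0 //.
  apply: le_trans (ler_normD _ _) _; apply: lerD.
    by apply: (nb (Inc0 s t1) (Inc2 s t1 t2)); rewrite /= ?hs ?h1 ?h2 ?mul1r.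
  by apply: (nb (Inc2 s t1 t2) (Inc0 s t2)); rewrite /= ?hs ?h1 ?h2 ?mulr1.
- move=> /and4P[hs1 hs2 ht1 ht2].
  rewrite [inc_val _ _](_ : _ =
    mul (inc_val f (Inc12 s1 s2 t1 t2)) (inc_val g (Inc0 s1 t1))
    + mul (inc_val f (Inc1 s1 s2 t2)) (inc_val g (Inc2 s1 t1 t2))
    + (mul (inc_val f (Inc2 s2 t1 t2)) (inc_val g (Inc1 s1 s2 t1))
    + mul (inc_val f (Inc0 s2 t2)) (inc_val g (Inc12 s1 s2 t1 t2)))); last first.
    by rewrite /= !(bilinBl mulP, bilinBr mulP); zmod.
  rewrite four; apply: le_trans (ler_normD _ _) _.
  by apply: lerD; apply: le_trans (ler_normD _ _) _; apply: lerD; apply: nb;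
    rewrite /= ?hs1 ?hs2 ?ht1 ?ht2 ?mulr1 ?mul1r // mulrC.
Qed.

Lemma bd_of_param1 (V : normedModType R) K (f : R -> V) : 0 <= K ->
  hol rho 0 1 K f -> (forall t, 0 <= t <= 1 -> `|f t| <= K) ->
  bd K (fun z => f z.2).
Proof.
move=> K0 h b; case=> [s t|s1 s2 t|s t1 t2|s1 s2 t1 t2] /=.
- by move=> /andP[_ ht]; rewrite mulr1 b.
- by move=> _; rewrite subrr normr0 mulr_ge0 ?powR_ge0.
- by move=> /and3P[_ h1 h2]; exact: h.
- by move=> _; rewrite subrr normr0 !mulr_ge0 ?powR_ge0.
Qed.

(** * Developments along tail paths as surfaces *)

Section SurfaceOfDevelopments.

(** The development along the tail path ([Dev_tail]), split at the corner of the path: first up the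
    left side, then along the horizontal segment at height [z.2]. *)
Definition tail_dev q (V : R * R -> 'M[R]_q) (z : R * R) : 'M[R]_q :=
  Dev rho (fun t => V (0, t)) z.2 *m Dev rho (fun s => V (s, z.2)) z.1.

Let i01 : 0 <= (0 : R) <= 1. Proof. by rewrite lexx ler01. Qed.

(** In the second factor [t] is a parameter of the driver. Drivers at heights [t1] and [t2] are at
    Hoelder distance [K] times the power [rho] of [t1 - t2], so [Dev_lip] bounds the increment in
    [t] by its supremum part and the rectangular one by its Hoelder part. *)
Lemma bd_tail_dev q K : 0 <= K -> exists2 C, 0 <= C &
  forall V : R * R -> 'M[R]_q, bd K V -> bd C (tail_dev V).
Proof.
move=> K0; have [C C0 hC] := Dev_bound rho_gt q K0.
have [D D0 hD] := Dev_lip rho_gt q K0.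
exists (4 * (q%:R * C * (C + D))); first by rewrite !mulr_ge0 // addr_ge0.
move=> V bV.
apply: (bd_mul (mulmx_bilinear R q q q)
  (f := fun z => Dev rho (fun t => V (0, t)) z.2)).
  have [b h _] := hC _ (bd_hol2 i01 bV); exact: bd_of_param1.
case=> [s t|s1 s2 t|s t1 t2|s1 s2 t1 t2] /=.
- move=> /andP[hs ht]; have [b _ _] := hC _ (bd_hol1 ht bV).
  by rewrite mulr1; apply: le_trans (b _ hs) _; rewrite lerDl.
- move=> /and3P[h1 h2 ht]; have [_ h _] := hC _ (bd_hol1 ht bV).
  by apply: le_trans (h _ _ h1 h2) _; rewrite ler_wpM2r ?powR_ge0 // lerDl.
(* [Dev_lip] requires a positive distance, so equal heights are treated apart. *)
- move=> /and3P[hs h1 h2]; have [->|ne] := eqVneq t1 t2.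
    by rewrite subrr normr0 mulr_ge0 ?powR_ge0 // addr_ge0.
  have e0 : 0 < `|t1 - t2| `^ rho by rewrite powR_gt0 // normr_gt0 subr_eq0.
  have [_ b] := hD _ _ _ e0 (bd_hol1 h1 bV) (bd_hol1 h2 bV) (bd_hol12 h1 h2 bV).
  by apply: le_trans (b _ hs) _; rewrite ler_wpM2r ?powR_ge0 // lerDr.
- move=> /and4P[hs1 hs2 h1 h2]; have [->|ne] := eqVneq t1 t2.
    by rewrite !subrr normr0 !mulr_ge0 ?powR_ge0 // addr_ge0.
  have e0 : 0 < `|t1 - t2| `^ rho by rewrite powR_gt0 // normr_gt0 subr_eq0.
  have [h _] := hD _ _ _ e0 (bd_hol1 h1 bV) (bd_hol1 h2 bV) (bd_hol12 h1 h2 bV).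
  apply: le_trans (h _ _ hs1 hs2) _.
  rewrite mulrAC -mulrA ler_wpM2r ?mulr_ge0 ?powR_ge0 // lerDr //.
Qed.

Lemma tail_dev_diff_block q c K (V W : R * R -> 'M[R]_q) (z : R * R) : 0 <= z.1 <= 1 -> 0 <= z.2 <= 1 ->
  bd K V -> bd K W -> bd K (fun z => diff_block c (V z) (W z)) ->
  tail_dev (fun z => diff_block c (V z) (W z)) z = diff_block c (tail_dev V z) (tail_dev W z).
Proof.
move=> h1 h2 bV bW bVW; have K0 := bd_ge0 bV; rewrite /tail_dev -diff_blockM.
rewrite (Dev_diff_block rho_gt K0 (bd_hol2 i01 bV) (bd_hol2 i01 bW)
  (bd_hol2 i01 bVW) h2).
by rewrite (Dev_diff_block rho_gt K0 (bd_hol1 h2 bV) (bd_hol1 h2 bW)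
  (bd_hol1 h2 bVW) h1).
Qed.

Lemma tail_dev_lip q K : 0 <= K -> exists2 C, 0 <= C &
  forall e (V W : R * R -> 'M[R]_q), 0 < e ->
  bd K V -> bd K W -> bd (K * e) (fun z => V z - W z) ->
  bd (C * e) (fun z => tail_dev V z - tail_dev W z).
Proof.
move=> K0; have [C C0 hC] := bd_tail_dev (q + q) K0; exists C => // e V W e0 bV bW bVW.
have c0 : 0 < e^-1 by rewrite invr_gt0.
have block (F G : R * R -> 'M[R]_q) i :
    inc_val (fun z => diff_block e^-1 (F z) (G z)) i =
    diff_block e^-1 (inc_val F i) (inc_val G i).
  by apply: inc_val_comp2 => *; rewrite diff_blockB.
have diff (F G : R * R -> 'M[R]_q) i :
    inc_val (fun z => F z - G z) i = inc_val F i - inc_val G i.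
  by apply: (inc_val_comp2 (phi := fun x y => x - y)) => *; zmod.
have bb : bd K (fun z => diff_block e^-1 (V z) (W z)).
  move=> i hi; rewrite block; apply: normr_diff_block.
  - by rewrite mulr_ge0 // inc_size_ge0.
  - exact: bV.
  - exact: bW.
  - rewrite normrZ gtr0_norm // ler_pdivrMl // mulrA [e * K]mulrC -diff.
    exact: bVW.
move=> i hi; rewrite diff; apply: le_trans (diff_block_corner _ _ c0) _.
rewrite invrK [C * e]mulrC -mulrA; apply: ler_wpM2l; first exact: ltW.
rewrite -block -(@eq_inc_val _ (tail_dev (fun z => diff_block e^-1 (V z) (W z)))) //.
  exact: hC.
by move=> s t hs ht; apply: tail_dev_diff_block bV bW bb.
Qed.

Lemma bd_opp_tr q K (V : R * R -> 'M[R]_q) :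
  bd K V -> bd K (fun z => - (V z)^T).
Proof.
rewrite -[K in bd K (fun _ => - _)]mul1r => bV.
apply: (bd_lin (phi := fun A : 'M[R]_q => - A^T)) => //.
- by move=> x y; rewrite trmxB; zmod.
- by move=> x; rewrite normrN normr_trmx mul1r.
Qed.

Lemma tail_dev_inv q K (V : R * R -> 'M[R]_q) (z : R * R) : bd K V ->
  0 <= z.1 <= 1 -> 0 <= z.2 <= 1 ->
  tail_dev V z *m (tail_dev (fun z => - (V z)^T) z)^T = 1%:M.
Proof.
move=> bV h1 h2; have K0 := bd_ge0 bV; rewrite /tail_dev trmx_mul mulmxA.
rewrite -[X in X *m _]mulmxA (Dev_inv rho_gt K0 (bd_hol1 h2 bV) h1) mulmx1.
exact: (Dev_inv rho_gt K0 (bd_hol2 i01 bV) h2).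
Qed.

End SurfaceOfDevelopments.

(** * Concatenation and reparametrization of paths *)

Section Concatenation.

Lemma hol_concat (V : normedModType R) a m b K (f : R -> V) : 0 <= K ->
  hol rho a m K f -> hol rho m b K f -> hol rho a b (2 * K) f.
Proof.
move=> K0 h1 h2; apply: hol_of_incr => s t as_ st tb.
have T0 : 0 <= K * (t - s) `^ rho by rewrite mulr_ge0 ?powR_ge0.
rewrite -mulrA mulr_natl mulr2n.
have [tm|/ltW mt] := leP t m.
  by apply: le_trans (hol_incr h1 as_ st tm) _; rewrite lerDl.
have [ms|/ltW sm] := leP m s.
  by apply: le_trans (hol_incr h2 ms st tb) _; rewrite lerDl.
rewrite -[f t - f s](subrK (f m - f s)).
apply: le_trans (ler_normD _ _) _; apply: lerD.
  rewrite (_ : f t - f s - (f m - f s) = f t - f m); last by zmod.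
  apply: le_trans (hol_incr h2 (lexx _) mt tb) _.
  by rewrite ler_wpM2l // ler_powR2r ?(ltW rho0) ?subr_ge0 // lerD2l lerN2.
apply: le_trans (hol_incr h1 as_ sm (lexx _)) _.
by rewrite ler_wpM2l // ler_powR2r ?(ltW rho0) ?subr_ge0 // lerD2r.
Qed.

Lemma hol_affine (V : normedModType R) a b c d K l k (f : R -> V) :
  (forall u, a <= u <= b -> c <= l * u + k <= d) ->
  hol rho c d K f -> hol rho a b (K * `|l| `^ rho) (fun u => f (l * u + k)).
Proof.
move=> h hf u v hu hv; apply: le_trans (hf _ _ (h _ hu) (h _ hv)) _.
rewrite (_ : l * u + k - (l * v + k) = l * (u - v)); last by ring.
by rewrite normrM powRM // mulrA.
Qed.

Lemma sews_affine (E : completeNormedModType R) a b c d C l k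
    (Xi : R -> R -> E) (I : R -> E) : 0 <= l ->
  (forall u, a <= u <= b -> c <= l * u + k <= d) ->
  sews c d theta C Xi I ->
  sews a b theta (C * l `^ theta) (fun s t => Xi (l * s + k) (l * t + k))
    (fun u => I (l * u + k)).
Proof.
move=> l0 h sI s t as_ st tb.
have /h/andP[h1 _] : a <= s <= b by rewrite as_ (le_trans st).
have /h/andP[_ h2] : a <= t <= b by rewrite tb (le_trans as_).
apply: le_trans (sI _ _ h1 _ h2) _; first by rewrite lerD2r ler_wpM2l.
rewrite (_ : l * t + k - (l * s + k) = l * (t - s)); last by ring.
by rewrite powRM ?subr_ge0 // mulrA.
Qed.

Lemma lode_affine q a b c d l k (V F : R -> 'M[R]_q) : 0 <= l ->
  (forall u, a <= u <= b -> c <= l * u + k <= d) ->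
  lode rho c d V F ->
  lode rho a b (fun u => V (l * u + k)) (fun u => F (l * u + k)).
Proof.
move=> l0 h [C C0 [hF sF]].
have h1 : 0 <= C * `|l| `^ rho by rewrite mulr_ge0 ?powR_ge0.
have h2 : 0 <= C * l `^ theta by rewrite mulr_ge0 ?powR_ge0.
exists (C * `|l| `^ rho + C * l `^ theta); first by rewrite addr_ge0.
split.
  by apply: hol_le (hol_affine h hF); rewrite lerDl.
move=> s t as_ st tb; apply: le_trans (sews_affine l0 h sF as_ st tb) _.
by rewrite ler_wpM2r ?powR_ge0 // lerDr.
Qed.

Lemma eq_lode q a b (V W F : R -> 'M[R]_q) :
  (forall t, a <= t <= b -> V t = W t) -> lode rho a b V F -> lode rho a b W F.
Proof.
move=> e [C C0 [hF sF]]; exists C => //; split=> //.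
apply: eq_sews sF => s t as_ st tb; rewrite /young_germ !e //.
  by rewrite as_ (le_trans st).
by rewrite tb (le_trans as_).
Qed.

(** [tail_path] with arbitrary codomain, so that it can also be applied to the matrix-valued
    driver. *)
Definition tail (V : Type) (f : R * R -> V) (s t u : R) : V :=
  if u <= 1 / 2 then f (0, 2 * u * t) else f ((2 * u - 1) * s, t).

Lemma tail_left (V : Type) (f : R * R -> V) s t u : 0 <= u <= 1 / 2 ->
  tail f s t u = f (0, 2 * t * u + 0).
Proof.
by move=> /andP[_ h]; rewrite /tail h addr0; congr (f (_, _)); ring.
Qed.

Lemma tail_right (V : Type) (f : R * R -> V) s t u : 1 / 2 <= u <= 1 ->
  tail f s t u = f (2 * s * u + - s, t).
Proof.
(* At [u = 1 / 2] the first branch is taken, but both branches give the corner value [f (0, t)]. *)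
rewrite /tail => /andP[h _]; case: ifPn => [h'|_].
  have -> : u = 1 / 2 by apply/le_anti/andP.
  by congr (f (_, _)); field.
by congr (f (_, _)); ring.
Qed.

Lemma tail_in1 (t u : R) : 0 <= t <= 1 -> 0 <= u <= 1 / 2 ->
  0 <= 2 * t * u + 0 <= 1.
Proof. by move=> /andP[t0 t1] /andP[u0 u1]; apply/andP; split; nra. Qed.

Lemma tail_in2 (s u : R) : 0 <= s <= 1 -> 1 / 2 <= u <= 1 ->
  0 <= 2 * s * u + - s <= 1.
Proof. by move=> /andP[t0 t1] /andP[u0 u1]; apply/andP; split; nra. Qed.

Lemma hol_tail (V : normedModType R) K (f : R * R -> V) s t : bd K f ->
  0 <= s <= 1 -> 0 <= t <= 1 ->
  hol rho 0 1 (2 * (K * 2 `^ rho)) (tail f s t).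
Proof.
move=> bf hs ht; have K0 := bd_ge0 bf.
have i01 : 0 <= (0 : R) <= 1 by rewrite lexx ler01.
have le2 x : 0 <= x <= 1 -> `|2 * x| `^ rho <= 2 `^ rho.
  move=> /andP[x0 x1]; have h : 0 <= 2 * x by rewrite mulr_ge0.
  by rewrite ger0_norm // ler_powR2r ?(ltW rho0) //; lra.
apply: (@hol_concat _ 0 (1 / 2) 1); first by rewrite mulr_ge0 ?powR_ge0.
  apply: (@eq_hol _ _ _ _ _ _ (fun u => f (0, 2 * t * u + 0))).
    by move=> u hu; rewrite tail_left.
  apply: hol_le (hol_affine (fun u => tail_in1 ht) (bd_hol2 i01 bf)).
  by rewrite ler_wpM2l // le2.
apply: (@eq_hol _ _ _ _ _ _ (fun u => f (2 * s * u + - s, t))).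
  by move=> u hu; rewrite tail_right.
apply: hol_le (hol_affine (fun u => tail_in2 hs)
  (bd_hol1 ht bf : hol rho 0 1 K (fun s => f (s, t)))).
by rewrite ler_wpM2l // le2.
Qed.

(** Nondecreasing affine reparametrization preserves solutions ([lode_affine]), and solutions
    multiply across the corner at time [1 / 2] ([lode_flow]). *)
Lemma Dev_tail q K (V : R * R -> 'M[R]_q) s t : bd K V ->
  0 <= s <= 1 -> 0 <= t <= 1 -> Dev rho (tail V s t) 1 = tail_dev V (s, t).
Proof.
move=> bV hs ht; have K0 := bd_ge0 bV.
have i01 : 0 <= (0 : R) <= 1 by rewrite lexx ler01.
have hW := hol_tail bV hs ht.
have K20 : 0 <= 2 * (K * 2 `^ rho) by rewrite !mulr_ge0 ?powR_ge0.
have [_ W0 lW] := DevP rho_gt K20 hW.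
have [_ E0 lE] := DevP rho_gt K0 (bd_hol2 i01 bV).
have [_ G0 lG] := DevP rho_gt K0 (bd_hol1 ht bV).
have h2 : 0 <= 1 / 2 :> R by lra.
have h2' : 1 / 2 <= 1 :> R by lra.
have t20 : 0 <= 2 * t by rewrite mulr_ge0 //; case/andP: ht.
have s20 : 0 <= 2 * s by rewrite mulr_ge0 //; case/andP: hs.
have l1 : lode rho 0 (1 / 2) (tail V s t)
    (fun u => Dev rho (fun t => V (0, t)) (2 * t * u + 0)).
  apply: eq_lode (lode_affine t20 (fun u => tail_in1 ht) lE) => u hu.
  by rewrite tail_left.
have l2 : lode rho (1 / 2) 1 (tail V s t)
    (fun u => Dev rho (fun s => V (s, t)) (2 * s * u + - s)).
  apply: eq_lode (lode_affine s20 (fun u => tail_in2 hs) lG) => u hu.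
  by rewrite tail_right.
have z1 : 2 * s * (1 / 2) + - s = 0 by field.
have z2 : 2 * s * 1 + - s = s by ring.
have z3 : 2 * t * (1 / 2) + 0 = t by field.
have z4 : 2 * t * 0 + 0 = 0 by ring.
have e2 : Dev rho (tail V s t) 1 = Dev rho (tail V s t) (1 / 2)
    *m Dev rho (fun s => V (s, t)) (2 * s * 1 + - s).
  apply: (lode_flow rho_gt K20 h2 h2' (lexx _) hW (lode_sub h2 (lexx _) lW) l2).
  by rewrite z1; exact: G0.
have e1 : Dev rho (tail V s t) (1 / 2) = Dev rho (tail V s t) 0
    *m Dev rho (fun t => V (0, t)) (2 * t * (1 / 2) + 0).
  apply: (lode_flow rho_gt K20 (lexx _) h2 h2' hW (lode_sub (lexx _) h2' lW) l1).
  by rewrite z4; exact: E0.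
by rewrite e2 e1 W0 mul1mx z2 z3.
Qed.

End Concatenation.

End HolderSurfaces.

(** * Hoelder norm and Frobenius norm *)

Section HolderNorm.
Variables (R : realType) (rho : R).
Hypothesis rho_gt : 1 / 2 < rho.

Let rho0 : 0 < rho. Proof. exact: rho_gt0. Qed.

Lemma rect_incrE (V : normedModType R) (X : R * R -> V) s1 s2 t1 t2 :
  rect_incr X s1 s2 t1 t2 = inc_val X (Inc12 s1 s2 t1 t2).
Proof. by rewrite /rect_incr /=; zmod. Qed.

Section Norm.
Variables (V : normedModType R) (nrm : V -> R).
Implicit Type X : R * R -> V.

(** The four suprema are nonnegative, so each is at most their sum. They range over ordered pairs
    only; the other orders follow by symmetry of the increments, and equal arguments give increment
    0. *)
Lemma holder_norm_bd X r : (forall x, `|x| <= nrm x) ->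
  (holder_norm nrm rho X <= r%:E)%E -> bd rho r X.
Proof.
move=> hn hX.
have n0 x : 0 <= nrm x by apply: le_trans (hn x).
have h01 : 0 <= (0 : R) <= 1 by rewrite lexx ler01.
have p1 : (0 <= holder1 nrm rho X)%E.
  apply: le_ereal_sup_tmp; eexists; first by exists 0, 1, 0; split.
  by rewrite lee_fin divr_ge0 ?powR_ge0.
have p2 : (0 <= holder2 nrm rho X)%E.
  apply: le_ereal_sup_tmp; eexists; first by exists 0, 0, 1; split.
  by rewrite lee_fin divr_ge0 ?powR_ge0.
have p12 : (0 <= holder12 nrm rho X)%E.
  apply: le_ereal_sup_tmp; eexists; first by exists 0, 1, 0, 1; split.
  by rewrite lee_fin divr_ge0 ?mulr_ge0 ?powR_ge0.
have p0 : (0 <= supnorm nrm X)%E.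
  apply: le_ereal_sup_tmp; eexists; first by exists 0, 0; split.
  by rewrite lee_fin.
have [q1 q2 q12 q0] : [/\ (holder1 nrm rho X <= r%:E)%E,
    (holder2 nrm rho X <= r%:E)%E, (holder12 nrm rho X <= r%:E)%E &
    (supnorm nrm X <= r%:E)%E].
  split; apply: le_trans hX; rewrite /holder_norm.
  - by rewrite -!addeA leeDl // !adde_ge0.
  - by rewrite -!addeA addeCA leeDl // !adde_ge0.
  - by rewrite addeAC leeDr // !adde_ge0.
  - by rewrite leeDr // !adde_ge0.
have up (v : V) (w : R) : 0 < w -> nrm v / w <= r -> `|v| <= r * w.
  by move=> w0; rewrite ler_pdivrMr //; exact: le_trans.
have pw (x y : R) : x < y -> 0 < `|x - y| `^ rho.
  by move=> xy; rewrite powR_gt0 // normr_gt0 subr_eq0 lt_eqF.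
have r0 : 0 <= r by rewrite -lee_fin; exact: le_trans q0.
have zero (v : V) w : v = 0 -> 0 <= w -> `|v| <= r * w.
  by move=> -> w0; rewrite normr0 mulr_ge0.
have b1 (s1 s2 t : R) : 0 <= s1 -> s1 < s2 -> s2 <= 1 -> 0 <= t <= 1 ->
    `|X (s1, t) - X (s2, t)| <= r * `|s1 - s2| `^ rho.
  move=> h1 h2 h3 h4; apply: up; first exact: pw.
  rewrite -lee_fin; apply: le_trans q1; apply: ereal_sup_ubound.
  by exists s1, s2, t; split.
have b2 (s t1 t2 : R) : 0 <= t1 -> t1 < t2 -> t2 <= 1 -> 0 <= s <= 1 ->
    `|X (s, t1) - X (s, t2)| <= r * `|t1 - t2| `^ rho.
  move=> h1 h2 h3 h4; apply: up; first exact: pw.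
  rewrite -lee_fin; apply: le_trans q2; apply: ereal_sup_ubound.
  by exists s, t1, t2; split.
have b12 (s1 s2 t1 t2 : R) : 0 <= s1 -> 0 <= t1 -> s1 < s2 -> t1 < t2 ->
    s2 <= 1 -> t2 <= 1 -> `|inc_val X (Inc12 s1 s2 t1 t2)|
       <= r * (`|s1 - s2| `^ rho * `|t1 - t2| `^ rho).
  move=> *; apply: up; first by rewrite mulr_gt0 // pw.
  rewrite -lee_fin; apply: le_trans q12; apply: ereal_sup_ubound.
  by exists s1, s2, t1, t2; split; rewrite // rect_incrE.
case=> [s t|s1 s2 t|s t1 t2|s1 s2 t1 t2].
- move=> /andP[hs ht] /=; rewrite mulr1; apply: le_trans (hn _) _.
  rewrite -lee_fin; apply: le_trans q0; apply: ereal_sup_ubound.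
  by exists s, t; split.
- move=> /and3P[/andP[a1 c1] /andP[a2 c2] ht] /=.
  case: (ltgtP s1 s2) => [lt|gt|->]; first exact: b1.
    by rewrite distrC (distrC s1); exact: b1.
  by apply: zero; rewrite ?subrr ?powR_ge0.
- move=> /and3P[hs /andP[a1 c1] /andP[a2 c2]] /=.
  case: (ltgtP t1 t2) => [lt|gt|->]; first exact: b2.
    by rewrite distrC (distrC t1); exact: b2.
  by apply: zero; rewrite ?subrr ?powR_ge0.
- move=> /and4P[/andP[a1 c1] /andP[a2 c2] /andP[a3 c3] /andP[a4 c4]].
  have b12' : s1 < s2 -> `|inc_val X (Inc12 s1 s2 t1 t2)|
       <= r * (`|s1 - s2| `^ rho * `|t1 - t2| `^ rho).
    move=> s12; case: (ltgtP t1 t2) => [lt|gt|->]; first exact: b12.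
      rewrite (distrC t1) (_ : inc_val _ _ = - inc_val X (Inc12 s1 s2 t2 t1)).
        by rewrite normrN; exact: b12.
      by rewrite /=; zmod.
    by apply: zero; rewrite ?mulr_ge0 ?powR_ge0 //= !subrr.
  case: (ltgtP s1 s2) => [lt|gt|->]; first exact: b12'.
    rewrite (_ : inc_val _ _ = - inc_val X (Inc12 s2 s1 t1 t2)) ?normrN /=.
      rewrite (distrC s1); case: (ltgtP t1 t2) => [lt'|gt'|->].
      - exact: (b12 s2 s1 t1 t2).
      - rewrite (distrC t1) subrACB -normrN.
        have -> : - (X (s2, t1) - X (s1, t1) - (X (s2, t2) - X (s1, t2))) =
          inc_val X (Inc12 s2 s1 t2 t1) by rewrite /=; zmod.
        exact: b12.
      - by apply: zero; rewrite ?mulr_ge0 ?powR_ge0 //= !subrr.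
    by rewrite /=; zmod.
  by apply: zero; rewrite ?mulr_ge0 ?powR_ge0 //= subrr.
Qed.

(** A negative value would give a negative constant in [bd], against [bd_ge0]. *)
Lemma holder_norm_ge0 X : (forall x, `|x| <= nrm x) ->
  (0 <= holder_norm nrm rho X)%E.
Proof.
move=> hn; rewrite leNgt; apply/negP => h.
have neg r : r < 0 -> (holder_norm nrm rho X <= r%:E)%E -> False.
  by move=> r0 /(holder_norm_bd hn)/bd_ge0; rewrite leNgt r0.
case e : (holder_norm nrm rho X) h => [r| |] //.
  by rewrite lte_fin => r0; apply: (neg r) => //; rewrite e.
by move=> _; apply: (neg (-1)); rewrite ?ltrN10 // e leNye.
Qed.

Lemma holder_space_bd X : (forall x, `|x| <= nrm x) ->
  holder_space nrm rho X -> exists2 K, 0 <= K & bd rho K X.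
Proof.
move=> hn [_ hX]; case e : (holder_norm nrm rho X) hX => [r| |] // _.
- have b : bd rho r X by apply: holder_norm_bd => //; rewrite e.
  by exists r => //; exact: bd_ge0 b.
- have b : bd rho 0 X by apply: holder_norm_bd => //; rewrite e leNye.
  by exists 0 => //; exact: bd_ge0 b.
Qed.

Lemma bd_holder_space X K c : 0 <= c -> (forall x, nrm x <= c * `|x|) ->
  bd rho K X -> holder_space nrm rho X.
Proof.
move=> c0 hn bX; have K0 := bd_ge0 bX.
have up (v : V) (w : R) : 0 < w -> `|v| <= K * w -> nrm v / w <= c * K.
  move=> w0 hv; rewrite ler_pdivrMr //; apply: le_trans (hn v) _.
  by rewrite -mulrA ler_wpM2l.
have pw (x y : R) : x < y -> 0 < `|x - y| `^ rho.
  by move=> xy; rewrite powR_gt0 // normr_gt0 subr_eq0 lt_eqF.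
split.
  apply/subspace_continuousP => -[s t] [/= hs ht]; rewrite !in_itv /= in hs ht.
  apply/cvgrPdist_lt => e e0; rewrite near_withinE.
  have M0 : 0 <= 2 * K by rewrite mulr_ge0.
  have e20 : 0 < e / 2 by rewrite divr_gt0.
  have [d d0 hd] := powR_small rho0 M0 e20.
  apply/nbhs_ballP; exists d => //= -[s' t'] /= [bs bt] [/= hs' ht'].
  rewrite !in_itv /= in hs' ht'; rewrite -!ball_normE /= in bs bt.
  have -> : X (s, t) - X (s', t') = (X (s, t) - X (s', t))
    + (X (s', t) - X (s', t')) by zmod.
  have h1 : `|X (s, t) - X (s', t)| <= K * `|s - s'| `^ rho.
    by apply: (bX (Inc1 s s' t)); rewrite /= hs hs'.
  have h2 : `|X (s', t) - X (s', t')| <= K * `|t - t'| `^ rho.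
    by apply: (bX (Inc2 s' t t')); rewrite /= ht ht' hs'.
  have le (x : R) : `|x| < d -> K * `|x| `^ rho <= K * d `^ rho.
    by move=> xd; rewrite ler_wpM2l // ler_powR2r // ltW.
  apply: le_lt_trans (ler_normD _ _) _.
  have := lerD (le_trans h1 (le (s - s') bs)) (le_trans h2 (le (t - t') bt)).
  rewrite -mulr2n -mulr_natl mulrA => h; apply: le_lt_trans h _.
  by apply: le_lt_trans hd _; lra.
apply: (@le_lt_trans _ _ (((c * K)%:E + (c * K)%:E + (c * K)%:E + (c * K)%:E)%E)).
  rewrite /holder_norm; apply: leeD;
    [apply: leeD; [apply: leeD|]|]; apply: ge_ereal_sup => q /=.
  - move=> [s1 [s2 [t [h1 h2 h3 h4 ->]]]]; rewrite lee_fin up ?pw //.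
    apply: (bX (Inc1 s1 s2 t)); rewrite /= h1 h4 h3.
    by rewrite (le_trans h1 (ltW h2)) (le_trans (ltW h2) h3).
  - move=> [s [t1 [t2 [h1 h2 h3 h4 ->]]]]; rewrite lee_fin up ?pw //.
    apply: (bX (Inc2 s t1 t2)); rewrite /= h1 h4 h3.
    by rewrite (le_trans h1 (ltW h2)) (le_trans (ltW h2) h3).
  - move=> [s1 [s2 [t1 [t2 [[h1 h1'] h2 h3 [h4 h4'] ->]]]]].
    rewrite lee_fin up ?mulr_gt0 ?pw // rect_incrE.
    apply: (bX (Inc12 s1 s2 t1 t2)); rewrite /= h1 h1' h4 h4'.
    by rewrite (le_trans h1 (ltW h2)) (le_trans (ltW h2) h4)
      (le_trans h1' (ltW h3)) (le_trans (ltW h3) h4').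
  - move=> [s [t [hs ht ->]]]; rewrite lee_fin; apply: le_trans (hn _) _.
    by rewrite ler_wpM2l // (bd_sup bX).
by rewrite -!EFinD ltry.
Qed.

End Norm.

Lemma normr_frobenius m n (A : 'M[R]_(m, n)) : `|A| <= frobenius A.
Proof.
have S0 : 0 <= \sum_i \sum_j A i j ^+ 2.
  by do 2 (apply: sumr_ge0 => ? _); rewrite sqr_ge0.
apply: normr_mx_le => [|i j]; first exact: sqrtr_ge0.
rewrite -sqrtr_sqr ler_sqrt // (bigD1 i) //= (bigD1 j) //= -addrA lerDl.
by rewrite addr_ge0 // ?sumr_ge0 // => *; rewrite ?sumr_ge0 // => *; rewrite sqr_ge0.
Qed.

Lemma frobenius_le m n (A : 'M[R]_(m, n)) :
  frobenius A <= Num.sqrt (m * n)%:R * `|A|.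
Proof.
rewrite -[`|A|]ger0_norm // -sqrtr_sqr -sqrtrM // ler_sqrt; last first.
  by rewrite mulr_ge0 // sqr_ge0.
apply: (@le_trans _ _ (\sum_(i < m) \sum_(j < n) `|A| ^+ 2)).
  apply: ler_sum => i _; apply: ler_sum => j _.
  by rewrite -[leLHS]real_normK ?num_real // ler_sqr ?nnegrE // normr_entry.
rewrite !sumr_const !card_ord -mulrnA mulnC mulr_natl; exact: lexx.
Qed.

End HolderNorm.

(** * Indefinite Young integrals on the unit interval *)

Section IndefiniteIntegral.
Variables (R : realType) (rho : R).
Hypothesis rho_gt : 1 / 2 < rho.

Local Notation theta := (2 * rho).
Local Notation kappa := (sewing_cst (2 * rho)).

Let th1 : 1 < theta. Proof. exact: theta_gt1. Qed.
Let k0 : 0 <= kappa. Proof. exact: ltW (sewing_cst_gt0 th1). Qed.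

Variables (U V : normedModType R) (W : completeNormedModType R).
Variables (mul : U -> V -> W) (M : R).
Hypothesis mulP : bounded_bilinear mul M.
Let M0 : 0 <= M. Proof. exact: bilin_ge0 mulP. Qed.

Lemma young_sews01 Kf Kg f g : 0 <= Kf -> 0 <= Kg ->
  hol rho 0 1 Kf f -> hol rho 0 1 Kg g ->
  sews 0 1 theta (kappa * (M * Kf * Kg)) (young_germ mul f g)
    (fun t => young mul 0 t f g) /\ young mul 0 0 f g = 0.
Proof.
move=> f0 g0 hf hg.
have C0 : 0 <= kappa * (M * Kf * Kg) by apply: mulr_ge0 => //; rewrite !mulr_ge0.
have [I I0 hI] := young_exists rho_gt mulP f0 g0 hf hg ler01.
have e t : 0 <= t <= 1 -> young mul 0 t f g = I t.
  move=> /andP[t0 t1].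
  by rewrite (youngE th1 C0 t0 (sews_sub (lexx _) t1 hI)) I0 subr0.
split; last by rewrite e ?I0 // lexx ler01.
move=> s t s0 st t1; rewrite !e ?s0 ?t1 ?(le_trans st) ?(le_trans s0) //.
exact: hI.
Qed.

Lemma young_eq01 C f g I t : 0 <= C -> 0 <= t <= 1 ->
  sews 0 1 theta C (young_germ mul f g) I -> young mul 0 t f g = I t - I 0.
Proof.
by move=> C0 /andP[t0 t1] h; exact: youngE th1 C0 t0 (sews_sub (lexx _) t1 h).
Qed.

Lemma young_hol01 Kf Kg f g : 0 <= Kf -> 0 <= Kg ->
  hol rho 0 1 Kf f -> hol rho 0 1 Kg g ->
  (forall t, 0 <= t <= 1 -> `|f t| <= Kf) ->
  hol rho 0 1 ((1 + kappa) * (M * Kf * Kg)) (fun t => young mul 0 t f g).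
Proof.
move=> f0 g0 hf hg fK; have [h _] := young_sews01 f0 g0 hf hg.
have C0 : 0 <= kappa * (M * Kf * Kg) by apply: mulr_ge0 => //; rewrite !mulr_ge0.
by apply: (young_hol rho_gt mulP f0 g0 hf hg _ C0 fK h); rewrite subr0.
Qed.

(** The germs of both sides agree by bilinearity. This splits a change of the integral into a change
    of integrand and a change of integrator. *)
Lemma young_diff01 K f g f' g' t : 0 <= K ->
  hol rho 0 1 K f -> hol rho 0 1 K g -> hol rho 0 1 K f' -> hol rho 0 1 K g' ->
  0 <= t <= 1 ->
  young mul 0 t f g - young mul 0 t f' g'
  = young mul 0 t (fun u => f u - f' u) g
    + young mul 0 t f' (fun u => g u - g' u).
Proof.
move=> K0 hf hg hf' hg' t01; have KK : 0 <= K + K by rewrite addr_ge0.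
have [s1 z1] := young_sews01 K0 K0 hf hg.
have [s2 z2] := young_sews01 K0 K0 hf' hg'.
have [s3 z3] := young_sews01 KK K0 (holB hf hf') hg.
have [s4 z4] := young_sews01 K0 KK hf' (holB hg hg').
have C0 a b : 0 <= a -> 0 <= b -> 0 <= kappa * (M * a * b).
  by move=> *; apply: mulr_ge0 => //; rewrite !mulr_ge0.
have e1 := sewsB s1 s2; have e2 := sewsD s3 s4.
have e3 : sews 0 1 theta _ (fun s t => young_germ mul f g s t
    - young_germ mul f' g' s t) _ := eq_sews _ e2.
case/andP: t01 => t0 t1.
have := sews_uniq th1 _ _ t0 (sews_sub (lexx _) t1 e1)
  (sews_sub (lexx _) t1 (e3 _)).
rewrite /= z1 z2 z3 z4 !(subr0, addr0); apply.
- by apply: addr_ge0; exact: C0.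
- by apply: addr_ge0; exact: C0.
- by move=> s u _ _ _; rewrite /young_germ !(bilinBl mulP, bilinBr mulP); zmod.
Qed.

End IndefiniteIntegral.

(** * The area process *)

Section LineIntegrals.
Variables (R : realType) (rho : R).
Hypothesis rho_gt : 1 / 2 < rho.

Local Notation theta := (2 * rho).
Local Notation kappa := (sewing_cst (2 * rho)).
Local Notation mul := (fun a b : R => a * b).

Let rho0 : 0 < rho. Proof. exact: rho_gt0. Qed.
Let th1 : 1 < theta. Proof. exact: theta_gt1. Qed.
Let k0 : 0 <= kappa. Proof. exact: ltW (sewing_cst_gt0 th1). Qed.

Implicit Types f g : R * R -> R.

Definition swap f (z : R * R) := f (z.2, z.1).

Lemma bd_swap K f : bd rho K f -> bd rho K (swap f).
Proof.
move=> h; case=> [s t|s1 s2 t|s t1 t2|s1 s2 t1 t2] /=.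
- by move=> /andP[hs ht]; apply: (h (Inc0 t s)); rewrite /= ht.
- by move=> /and3P[h1 h2 ht]; apply: (h (Inc2 t s1 s2)); rewrite /= ht h1.
- by move=> /and3P[hs h1 h2]; apply: (h (Inc1 t1 t2 s)); rewrite /= hs h1 h2.
- move=> /and4P[h1 h2 h3 h4]; rewrite /swap /= subrACB [X in _ <= _ * X]mulrC.
  by apply: (h (Inc12 t1 t2 s1 s2)); rewrite /= h1 h2 h3 h4.
Qed.

(** For a function vanishing on both axes every increment is, up to sign, a rectangular one with the
    missing corners on an axis, and side lengths are at most 1. *)
Lemma bd_of_rect (E : normedModType R) K (f : R * R -> E) : 0 <= K ->
  (forall t, 0 <= t <= 1 -> f (0, t) = 0) ->
  (forall s, 0 <= s <= 1 -> f (s, 0) = 0) ->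
  (forall s1 s2 t1 t2, inc_in (Inc12 s1 s2 t1 t2) ->
    `|inc_val f (Inc12 s1 s2 t1 t2)| <= K * inc_size rho (Inc12 s1 s2 t1 t2)) ->
  bd rho K f.
Proof.
move=> K0 f1 f2 h; have i0 : 0 <= (0 : R) <= 1 by rewrite lexx ler01.
have w1 x : 0 <= x <= 1 -> `|x - 0| `^ rho <= 1.
  move=> /andP[x0 x1]; rewrite subr0 ger0_norm // powR_le1 ?(ltW rho0) // x0 //.
case=> [s t|s1 s2 t|s t1 t2|//] /=.
- move=> /andP[hs ht]; have /= := h s 0 t 0; rewrite hs ht i0 => /(_ isT).
  rewrite !f1 // f2 // !subr0 => {}h; apply: le_trans h _.
  by rewrite ler_wpM2l // mulr_ile1 ?powR_ge0 ?w1 // -[X in `|X|]subr0 w1.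
- move=> /and3P[h1 h2 ht]; have /= := h s1 s2 t 0; rewrite h1 h2 ht i0.
  rewrite !f2 // !subr0 => /(_ isT) {}h; apply: le_trans h _.
  by rewrite ler_wpM2l // ler_piMr ?powR_ge0 // -[X in `|X|]subr0 w1.
- move=> /and3P[hs h1 h2]; have /= := h s 0 t1 t2; rewrite h1 h2 hs i0.
  rewrite !f1 // !subr0 => /(_ isT) {}h; apply: le_trans h _.
  by rewrite ler_wpM2l // ler_piMl ?powR_ge0 // -[X in `|X|]subr0 w1.
Qed.

(** The integral of [f dg] along the horizontal segment ending at [z]; vertical segments are reached
    through [swap]. *)
Definition line_int f g (z : R * R) : R :=
  young mul 0 z.1 (fun u => f (u, z.2)) (fun u => g (u, z.2)).

Lemma line_int0 K f g t : bd rho K f -> bd rho K g -> 0 <= t <= 1 ->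
  line_int f g (0, t) = 0.
Proof.
move=> bf bg ht; have K0 := bd_ge0 bf.
by have [] := young_sews01 rho_gt (mulr_bilinear R) K0 K0 (bd_hol1 ht bf) (bd_hol1 ht bg).
Qed.

(** The difference between heights [t1] and [t2] is a sum of two integrals in which integrand or
    integrator is an increment in [t]. Its Hoelder constant in [s] carries the factor in [t1 - t2],
    and the integral is Hoelder in [s]. *)
Lemma line_int_rect K L f g s1 s2 t1 t2 : bd rho K f -> bd rho L g ->
  inc_in (Inc12 s1 s2 t1 t2) ->
  `|inc_val (line_int f g) (Inc12 s1 s2 t1 t2)|
    <= 2 * (1 + kappa) * (K * L) * inc_size rho (Inc12 s1 s2 t1 t2).
Proof.
move=> bf bg /and4P[hs1 hs2 ht1 ht2] /=.
have K0 := bd_ge0 bf; have L0 := bd_ge0 bg.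
pose e := `|t1 - t2| `^ rho; have e0 : 0 <= e by exact: powR_ge0.
pose N := K + L; have N0 : 0 <= N by rewrite addr_ge0.
have KN : K <= N by rewrite lerDl.
have LN : L <= N by rewrite lerDr.
pose J1 s := young mul 0 s (fun u => f (u, t1) - f (u, t2)) (fun u => g (u, t1)).
pose J2 s := young mul 0 s (fun u => f (u, t2)) (fun u => g (u, t1) - g (u, t2)).
have eJ s : 0 <= s <= 1 -> line_int f g (s, t1) - line_int f g (s, t2)
    = J1 s + J2 s.
  move=> hs; apply: (young_diff01 rho_gt (mulr_bilinear R) N0 _ _ _ _ hs).
  - exact: hol_le KN (bd_hol1 ht1 bf).
  - exact: hol_le LN (bd_hol1 ht1 bg).
  - exact: hol_le KN (bd_hol1 ht2 bf).
  - exact: hol_le LN (bd_hol1 ht2 bg).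
rewrite !eJ // opprD addrACA.
have h1 := young_hol01 rho_gt (mulr_bilinear R) (mulr_ge0 K0 e0) L0
  (bd_hol12 ht1 ht2 bf) (bd_hol1 ht1 bg) _.
have h2 := young_hol01 rho_gt (mulr_bilinear R) K0 (mulr_ge0 L0 e0)
  (bd_hol1 ht2 bf) (bd_hol12 ht1 ht2 bg) _.
apply: le_trans (ler_normD _ _) _.
have -> : 2 * (1 + kappa) * (K * L) * (`|s1 - s2| `^ rho * e) =
  (1 + kappa) * (1 * (K * e) * L) * `|s1 - s2| `^ rho
  + (1 + kappa) * (1 * K * (L * e)) * `|s1 - s2| `^ rho by ring.
apply: lerD.
  apply: h1 => // u hu; apply: (bf (Inc2 u t1 t2)); by rewrite /= hu ht1.
by apply: h2 => // u hu; exact: bd_sup bf _ _.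
Qed.

Lemma line_int_diff K f g f' g' s t : bd rho K f -> bd rho K g ->
  bd rho K f' -> bd rho K g' -> 0 <= s <= 1 -> 0 <= t <= 1 ->
  line_int f g (s, t) - line_int f' g' (s, t) =
  line_int (fun z => f z - f' z) g (s, t)
  + line_int f' (fun z => g z - g' z) (s, t).
Proof.
move=> bf bg bf' bg' hs ht.
exact: (young_diff01 rho_gt (mulr_bilinear R) (bd_ge0 bf) (bd_hol1 ht bf)
  (bd_hol1 ht bg) (bd_hol1 ht bf') (bd_hol1 ht bg') hs).
Qed.

(* The integral of [f dg] along the boundary of [0, s] x [0, t]: bottom minus
   top, plus right minus left. *)
Definition area_form f g (z : R * R) : R :=
  line_int f g (z.1, 0) - line_int f g z
  + (line_int (swap f) (swap g) (z.2, z.1) - line_int (swap f) (swap g) (z.2, 0)).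

Let i0 : 0 <= (0 : R) <= 1. Proof. by rewrite lexx ler01. Qed.

(** The bottom and left sides depend on one variable only and drop out of rectangular increments;
    the top and right sides contribute 2 each to the factor 4. *)
Lemma bd_area_form K L f g : bd rho K f -> bd rho L g ->
  bd rho (4 * (1 + kappa) * (K * L)) (area_form f g).
Proof.
move=> bf bg; have K0 := bd_ge0 bf; have L0 := bd_ge0 bg.
have bf' := bd_swap bf; have bg' := bd_swap bg.
have bfN := bd_le (_ : K <= K + L) bf; have bgN := bd_le (_ : L <= K + L) bg.
have {}bfN : bd rho (K + L) f by apply: bfN; rewrite lerDl.
have {}bgN : bd rho (K + L) g by apply: bgN; rewrite lerDr.
have bfN' := bd_swap bfN; have bgN' := bd_swap bgN.
apply: bd_of_rect.
- by rewrite !mulr_ge0 // addr_ge0.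
- move=> t ht; rewrite /area_form /= !(line_int0 bfN bgN) //.
  by rewrite subrr add0r subrr.
- move=> s hs; rewrite /area_form /= !(line_int0 bfN' bgN') //.
  by rewrite subrr add0r subrr.
- move=> s1 s2 t1 t2 /[dup] h /and4P[h1 h2 h3 h4].
  have -> : inc_val (area_form f g) (Inc12 s1 s2 t1 t2)
    = inc_val (line_int (swap f) (swap g)) (Inc12 t1 t2 s1 s2)
      - inc_val (line_int f g) (Inc12 s1 s2 t1 t2).
    by rewrite /area_form /=; zmod.
  apply: le_trans (ler_normB _ _) _.
  have r1 := line_int_rect bf bg h.
  have r2 := @line_int_rect _ _ _ _ t1 t2 s1 s2 bf' bg' _.
  have {}r2 : `|inc_val (line_int (swap f) (swap g)) (Inc12 t1 t2 s1 s2)|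
      <= 2 * (1 + kappa) * (K * L) * inc_size rho (Inc12 s1 s2 t1 t2).
    by rewrite [inc_size _ _]mulrC; apply: r2; rewrite /= h1 h2 h3 h4.
  apply: le_trans (lerD r2 r1) _; rewrite -mulrDl le_eqVlt; apply/orP; left.
  by apply/eqP; ring.
Qed.

Lemma area_form_diff K f g f' g' s t : bd rho K f -> bd rho K g ->
  bd rho K f' -> bd rho K g' -> 0 <= s <= 1 -> 0 <= t <= 1 ->
  area_form f g (s, t) - area_form f' g' (s, t) =
  area_form (fun z => f z - f' z) g (s, t)
  + area_form f' (fun z => g z - g' z) (s, t).
Proof.
move=> bf bg bf' bg' hs ht; rewrite /area_form /=.
have d1 u (hu : 0 <= u <= 1) := line_int_diff bf bg bf' bg' hs hu.
have d2 u (hu : 0 <= u <= 1) :=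
  line_int_diff (bd_swap bf) (bd_swap bg) (bd_swap bf') (bd_swap bg') ht hu.
move: (d1 0 i0) (d1 t ht) (d2 s hs) (d2 0 i0); rewrite /swap /=.
by move=> *; lra.
Qed.

Lemma area_form_lip K : 0 <= K -> exists2 C, 0 <= C & forall e f g f' g', 0 <= e ->
  bd rho K f -> bd rho K g -> bd rho K f' -> bd rho K g' ->
  bd rho e (fun z => f z - f' z) -> bd rho e (fun z => g z - g' z) ->
  bd rho (C * e) (fun z => area_form f g z - area_form f' g' z).
Proof.
move=> K0; exists (2 * (4 * (1 + kappa) * K)).
  by rewrite !mulr_ge0 // addr_ge0.
move=> e f g f' g' e0 bf bg bf' bg' df dg.
have h := bdD (bd_area_form df bg) (bd_area_form bf' dg).
apply: (@eq_bd _ _ _ _ (fun z => area_form (fun z => f z - f' z) g z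
   + area_form f' (fun z => g z - g' z) z)).
  by move=> s t hs ht; rewrite (area_form_diff bf bg bf' bg' hs ht).
by apply: bd_le h; rewrite le_eqVlt; apply/orP; left; apply/eqP; ring.
Qed.

End LineIntegrals.

Section BoundaryLoop.
Variables (R : realType) (rho : R).
Hypothesis rho_gt : 1 / 2 < rho.

Local Notation theta := (2 * rho).
Local Notation mul := (fun a b : R => a * b).

Let th1 : 1 < theta. Proof. exact: theta_gt1. Qed.
Let i0 : 0 <= (0 : R) <= 1. Proof. by rewrite lexx ler01. Qed.

(* Reversing the orientation of a path costs one more quadratic term. *)
Lemma young_sews_affine a b C Kf Kg l k (x y Y : R -> R) :
  0 <= C -> 0 <= Kf -> 0 <= Kg ->
  hol rho 0 1 Kf x -> hol rho 0 1 Kg y ->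
  sews 0 1 theta C (young_germ mul x y) Y ->
  (forall u, a <= u <= b -> 0 <= l * u + k <= 1) ->
  sews a b theta ((C + Kf * Kg) * `|l| `^ theta)
    (young_germ mul (fun u => x (l * u + k)) (fun u => y (l * u + k)))
    (fun u => Y (l * u + k)).
Proof.
move=> C0 Kf0 Kg0 hx hy sY h.
have two u v : 0 <= u <= 1 -> 0 <= v <= 1 ->
    `|Y v - Y u - x u * (y v - y u)| <= (C + Kf * Kg) * `|v - u| `^ theta.
  move=> hu hv; case/andP: (hu) => u0 u1; case/andP: (hv) => v0 v1.
  have [uv|/ltW vu] := leP u v.
    rewrite (ger0_norm (_ : 0 <= v - u)) ?subr_ge0 //.
    apply: le_trans (sY _ _ u0 uv v1) _.
    by rewrite ler_wpM2r ?powR_ge0 // lerDl mulr_ge0.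
  have -> : Y v - Y u - x u * (y v - y u) =
    - (Y u - Y v - x v * (y u - y v)) + (x v - x u) * (y v - y u) by ring.
  apply: le_trans (ler_normD _ _) _; rewrite normrN [leRHS]mulrDl; apply: lerD.
    by rewrite (distrC v) (ger0_norm (_ : 0 <= u - v)) ?subr_ge0 //; exact: sY.
  rewrite normrM powR_theta // mulrACA ler_pM //.
    exact: hx.
  exact: hy.
move=> s t as_ st tb; have -> : (C + Kf * Kg) * `|l| `^ theta * (t - s) `^ theta
  = (C + Kf * Kg) * `|l * t + k - (l * s + k)| `^ theta.
  rewrite (_ : l * t + k - (l * s + k) = l * (t - s)); last by ring.
  by rewrite normrM powRM // (ger0_norm (_ : 0 <= t - s)) ?subr_ge0 // mulrA.
by apply: two; apply: h; rewrite ?as_ ?tb ?(le_trans st) ?(le_trans as_).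
Qed.

(** The contribution of one side of the loop. Here [c] stands for the starting value of the loop,
    which [area_inner] subtracts; since the loop is closed, the terms with [c] of the four sides
    cancel. *)
Lemma young_piece a b C D Kf Kg l k c (x y Y h g I : R -> R) :
  0 <= C -> 0 <= D -> 0 <= Kf -> 0 <= Kg ->
  hol rho 0 1 Kf x -> hol rho 0 1 Kg y ->
  sews 0 1 theta C (young_germ mul x y) Y ->
  (forall u, a <= u <= b -> 0 <= l * u + k <= 1) ->
  0 <= a -> a <= b -> b <= 1 ->
  (forall u, a <= u <= b -> h u = x (l * u + k)) ->
  (forall u, a <= u <= b -> g u = y (l * u + k)) ->
  sews 0 1 theta D (young_germ mul (fun u => h u - c) g) I ->
  I b - I a = Y (l * b + k) - Y (l * a + k)
    - c * (y (l * b + k) - y (l * a + k)).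
Proof.
move=> C0 D0 Kf0 Kg0 hx hy sY hl a0 ab b1 eh eg sI.
have s1 := young_sews_affine C0 Kf0 Kg0 hx hy sY hl.
have s2 : sews a b theta ((C + Kf * Kg) * `|l| `^ theta)
    (young_germ mul (fun u => h u - c) g)
    (fun u => Y (l * u + k) - c * y (l * u + k)).
  move=> s t as_ st tb; have := s1 s t as_ st tb; rewrite /young_germ.
  rewrite eh ?as_ ?(le_trans st) // !eg ?as_ ?tb ?(le_trans st) ?(le_trans as_) //.
  by congr (`|_| <= _); ring.
have C1 : 0 <= (C + Kf * Kg) * `|l| `^ theta.
  by rewrite mulr_ge0 ?powR_ge0 // addr_ge0 // mulr_ge0.
rewrite (sews_uniq th1 D0 C1 ab (sews_sub a0 b1 sI) s2); ring.
Qed.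

Definition loop (V : Type) (f : R * R -> V) (s t u : R) : V :=
  if u <= 1 / 4 then f (4 * u * s, 0)
  else if u <= 1 / 2 then f (s, (4 * u - 1) * t)
  else if u <= 3 / 4 then f ((3 - 4 * u) * s, t)
  else f (0, (4 - 4 * u) * t).

Lemma loop_coordE d (X : R * R -> 'rV[R]_d) i s t :
  loop_coord X i s t = loop (fun z => X z 0 i) s t.
Proof.
apply/funext => u; rewrite /loop_coord /boundary_loop /loop.
by case: ifP => // _; case: ifP => // _; case: ifP.
Qed.

Section Pieces.
Variables (V : Type) (f : R * R -> V) (s t : R).

Lemma loop1 u : 0 <= u <= 1 / 4 -> loop f s t u = f (4 * s * u + 0, 0).
Proof. by move=> /andP[_ h]; rewrite /loop h; congr (f (_, _)); ring. Qed.

Lemma loop2 u : 1 / 4 <= u <= 1 / 2 -> loop f s t u = f (s, 4 * t * u + - t).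
Proof.
rewrite /loop => /andP[h1 h2]; case: ifPn => [h|_].
  have -> : u = 1 / 4 by apply/le_anti/andP.
  by congr (f (_, _)); field.
by rewrite h2; congr (f (_, _)); ring.
Qed.

Lemma loop3 u : 1 / 2 <= u <= 3 / 4 ->
  loop f s t u = f (- (4 * s) * u + 3 * s, t).
Proof.
rewrite /loop => /andP[h1 h2]; case: ifPn => [h|_]; first by exfalso; lra.
case: ifPn => [h|_].
  have -> : u = 1 / 2 by apply/le_anti/andP.
  by congr (f (_, _)); field.
by rewrite h2; congr (f (_, _)); ring.
Qed.

Lemma loop4 u : 3 / 4 <= u <= 1 -> loop f s t u = f (0, - (4 * t) * u + 4 * t).
Proof.
rewrite /loop => /andP[h1 h2]; case: ifPn => [h|_]; first by exfalso; lra.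
case: ifPn => [h|_]; first by exfalso; lra.
case: ifPn => [h|_].
  have -> : u = 3 / 4 by apply/le_anti/andP.
  by congr (f (_, _)); field.
by congr (f (_, _)); ring.
Qed.

End Pieces.

Section Ranges.
Variable s : R.
Hypothesis hs : 0 <= s <= 1.

Lemma loop_in1 u : 0 <= u <= 1 / 4 -> 0 <= 4 * s * u + 0 <= 1.
Proof. by case/andP: hs => ? ? /andP[? ?]; apply/andP; split; nra. Qed.

Lemma loop_in2 u : 1 / 4 <= u <= 1 / 2 -> 0 <= 4 * s * u + - s <= 1.
Proof. by case/andP: hs => ? ? /andP[? ?]; apply/andP; split; nra. Qed.

Lemma loop_in3 u : 1 / 2 <= u <= 3 / 4 -> 0 <= - (4 * s) * u + 3 * s <= 1.
Proof. by case/andP: hs => ? ? /andP[? ?]; apply/andP; split; nra. Qed.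

Lemma loop_in4 u : 3 / 4 <= u <= 1 -> 0 <= - (4 * s) * u + 4 * s <= 1.
Proof. by case/andP: hs => ? ? /andP[? ?]; apply/andP; split; nra. Qed.

End Ranges.

Lemma hol_loop K (f : R * R -> R) s t : bd rho K f ->
  0 <= s <= 1 -> 0 <= t <= 1 -> exists2 L, 0 <= L & hol rho 0 1 L (loop f s t).
Proof.
move=> bf hs ht; have K0 := bd_ge0 bf.
have hf0 : hol rho 0 1 K (fun u => f (u, 0)) := bd_hol1 i0 bf.
have hft : hol rho 0 1 K (fun u => f (u, t)) := bd_hol1 ht bf.
pose A := K * `|4 * s| `^ rho + K * `|4 * t| `^ rho.
have Ks0 : 0 <= K * `|4 * s| `^ rho by rewrite mulr_ge0 ?powR_ge0.
have Kt0 : 0 <= K * `|4 * t| `^ rho by rewrite mulr_ge0 ?powR_ge0.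
have A0 : 0 <= A by rewrite addr_ge0.
exists (2 * (2 * (2 * A))); first by rewrite !mulr_ge0.
apply: (@hol_concat _ _ rho_gt _ 0 (3 / 4)); first by rewrite !mulr_ge0.
  apply: (@hol_concat _ _ rho_gt _ 0 (1 / 2)); first by rewrite !mulr_ge0.
    apply: (@hol_concat _ _ rho_gt _ 0 (1 / 4)) => //.
      apply: (eq_hol (f := fun u => f (4 * s * u + 0, 0))).
        by move=> u hu; rewrite loop1.
      by apply: hol_le (hol_affine (loop_in1 hs) hf0); rewrite lerDl.
    apply: (eq_hol (f := fun u => f (s, 4 * t * u + - t))).
      by move=> u hu; rewrite loop2.
    by apply: hol_le (hol_affine (loop_in2 ht) (bd_hol2 hs bf));
      rewrite lerDr.
  apply: (@hol_le _ _ _ _ _ A); first by rewrite !mulr_natl !mulr2n; lra.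
  apply: (eq_hol (f := fun u => f (- (4 * s) * u + 3 * s, t))).
    by move=> u hu; rewrite loop3.
  by apply: hol_le (hol_affine (loop_in3 hs) hft); rewrite normrN lerDl.
apply: (@hol_le _ _ _ _ _ A); first by rewrite !mulr_natl !mulr2n; lra.
apply: (eq_hol (f := fun u => f (0, - (4 * t) * u + 4 * t))).
  by move=> u hu; rewrite loop4.
by apply: hol_le (hol_affine (loop_in4 ht) (bd_hol2 i0 bf));
  rewrite normrN lerDr.
Qed.

Section Area.
Variables (d : nat) (X : R * R -> 'rV[R]_d) (i j : 'I_d) (K s t : R).
Hypothesis bX : forall k, bd rho K (fun z => X z 0 k).
Hypotheses (hs : 0 <= s <= 1) (ht : 0 <= t <= 1).

Let f z := X z 0 i.
Let g z := X z 0 j.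

(** Sums of increments telescope, so the sewing error is 0. *)
Lemma area_inner_sews k : sews 0 1 theta 0
  (young_germ mul (fun=> 1) (loop_coord X k s t)) (loop_coord X k s t).
Proof.
by move=> a b _ _ _; rewrite /young_germ mul1r subrr normr0 mul0r.
Qed.

Lemma area_innerE u : 0 <= u <= 1 ->
  area_inner X i s t u = loop f s t u - loop f s t 0.
Proof.
move=> hu; rewrite /area_inner.
by rewrite (young_eq01 rho_gt (lexx _) hu (area_inner_sews i)) loop_coordE.
Qed.

Lemma area_inner_integrable u : 0 <= u <= 1 ->
  young_integrable mul rho 0 u (fun=> 1) (loop_coord X i s t).
Proof.
move=> /andP[u0 u1]; have [L L0 hL] := hol_loop (bX i) hs ht.
split.
- by exists 0; exact: hol_cst.
- by exists L; rewrite loop_coordE; exact: hol_sub hL.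
- apply/cvg_ex; eexists; apply: young_sews th1 (lexx _) u0 _.
  exact: sews_sub (area_inner_sews i).
Qed.

Lemma hol_area_inner : exists2 L, 0 <= L & hol rho 0 1 L (area_inner X i s t).
Proof.
have [L L0 hL] := hol_loop (bX i) hs ht; exists L => // u v hu hv.
by rewrite !area_innerE // opprB addrA subrK; exact: hL.
Qed.

Lemma area_integrable :
  young_integrable mul rho 0 1 (area_inner X i s t) (loop_coord X j s t).
Proof.
have [L L0 hL] := hol_area_inner; have [L' L0' hL'] := hol_loop (bX j) hs ht.
rewrite loop_coordE.
exact: (young_integrable_hol rho_gt (mulr_bilinear R) L0 L0' hL hL' ler01).
Qed.

(** The integral over the loop is the sum over its four sides, each an affine image of a coordinate
    segment; the top and left sides are traversed backwards. *)
Lemma areaE : area X i j (s, t) = area_form f g (s, t).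
Proof.
have bf : bd rho K f := bX i; have bg : bd rho K g := bX j.
have K0 := bd_ge0 bf.
have [L L0 hL] := hol_loop bf hs ht; have [L' L0' hL'] := hol_loop bg hs ht.
pose c := loop f s t 0.
have hc : hol rho 0 1 L (fun u => loop f s t u - c).
  by rewrite -[L]addr0; apply: holB => //; exact: hol_cst.
have [I I0 sI] := young_exists rho_gt (mulr_bilinear R) L0 L0' hc hL' ler01.
set D := sewing_cst theta * _ in sI.
have k0 := ltW (sewing_cst_gt0 th1).
have D0 : 0 <= D by apply: mulr_ge0 => //; rewrite !mulr_ge0.
have C0 : 0 <= sewing_cst theta * (1 * K * K).
  by apply: mulr_ge0 => //; rewrite !mulr_ge0.
have -> : area X i j (s, t) = I 1 - I 0.
  rewrite /area /= loop_coordE; apply: youngE th1 D0 ler01 _.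
  apply: eq_sews sI => a b a0 ab b1; rewrite /young_germ area_innerE //.
  by rewrite a0 (le_trans ab).
have b01 := bd_swap bf; have b02 := bd_swap bg.
have [S1 Z1] := young_sews01 rho_gt (mulr_bilinear R) K0 K0 (bd_hol1 i0 bf) (bd_hol1 i0 bg).
have [S2 Z2] := young_sews01 rho_gt (mulr_bilinear R) K0 K0 (bd_hol2 hs bf) (bd_hol2 hs bg).
have [S3 Z3] := young_sews01 rho_gt (mulr_bilinear R) K0 K0 (bd_hol1 ht bf) (bd_hol1 ht bg).
have [S4 Z4] := young_sews01 rho_gt (mulr_bilinear R) K0 K0 (bd_hol2 i0 bf) (bd_hol2 i0 bg).
have c1 : 0 <= 1 / 4 :> R by lra.
have c2 : 1 / 4 <= 1 / 2 :> R by lra.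
have c3 : 1 / 2 <= 3 / 4 :> R by lra.
have c4 : 3 / 4 <= 1 :> R by lra.
have c5 : 1 / 2 <= 1 :> R by lra.
have c6 : 1 / 4 <= 1 :> R by lra.
have c7 : 0 <= 1 / 2 :> R by lra.
have c8 : 0 <= 3 / 4 :> R by lra.
have e1 := young_piece C0 D0 K0 K0 (bd_hol1 i0 bf) (bd_hol1 i0 bg) S1
  (loop_in1 hs) (lexx _) c1 c6 (fun u hu => loop1 f s t hu)
  (fun u hu => loop1 g s t hu) sI.
have e2 := young_piece C0 D0 K0 K0 (bd_hol2 hs bf) (bd_hol2 hs bg) S2
  (loop_in2 ht) c1 c2 c5 (fun u hu => loop2 f s t hu)
  (fun u hu => loop2 g s t hu) sI.
have e3 := young_piece C0 D0 K0 K0 (bd_hol1 ht bf) (bd_hol1 ht bg) S3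
  (loop_in3 hs) c7 c3 c4 (fun u hu => loop3 f s t hu)
  (fun u hu => loop3 g s t hu) sI.
have e4 := young_piece C0 D0 K0 K0 (bd_hol2 i0 bf) (bd_hol2 i0 bg) S4
  (loop_in4 ht) c8 c4 (lexx _) (fun u hu => loop4 f s t hu)
  (fun u hu => loop4 g s t hu) sI.
have q1 : 4 * s * (1 / 4) + 0 = s by field.
have q2 : 4 * s * 0 + 0 = 0 by ring.
have q3 : 4 * t * (1 / 2) + - t = t by field.
have q4 : 4 * t * (1 / 4) + - t = 0 by field.
have q5 : - (4 * s) * (3 / 4) + 3 * s = 0 by field.
have q6 : - (4 * s) * (1 / 2) + 3 * s = s by field.
have q7 : - (4 * t) * 1 + 4 * t = 0 by ring.
have q8 : - (4 * t) * (3 / 4) + 4 * t = t by field.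
move: e1 e2 e3 e4; rewrite q1 q2 q3 q4 q5 q6 q7 q8 Z1 Z2 Z3 Z4.
rewrite /area_form /line_int /swap /=.
by move=> *; lra.
Qed.

End Area.

End BoundaryLoop.

(** * 2D Young integrals *)

Section DoubleIntegral.
Variables (R : realType) (rho : R).
Hypothesis rho_gt : 1 / 2 < rho.

Local Notation theta := (2 * rho).
Local Notation kappa := (sewing_cst (2 * rho)).

Let rho0 : 0 < rho. Proof. exact: rho_gt0. Qed.
Let th1 : 1 < theta. Proof. exact: theta_gt1. Qed.
Let k0 : 0 <= kappa. Proof. exact: ltW (sewing_cst_gt0 th1). Qed.

Variable W : completeNormedModType R.
Implicit Types (f : R * R -> W) (g : R * R -> R).

Local Notation sm := (fun (x : W) (c : R) => c *: x).
Let smP : bounded_bilinear sm 1. Proof. exact: scaler_bilinear. Qed.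

Lemma big_rsum (E : completeNormedModType R) (F : R -> R -> E) a b s :
  \sum_(0 <= k < size s) F (nth b (a :: s) k) (nth b (a :: s) k.+1) = rsum F a s.
Proof.
elim: s a => [|t s IH] a /=; first by rewrite big_nil.
by rewrite big_nat_recl //=; congr (_ + _); rewrite -IH.
Qed.

Lemma rsumB (E : completeNormedModType R) (F G : R -> R -> E) a s :
  rsum (fun u v => F u v - G u v) a s = rsum F a s - rsum G a s.
Proof.
elim: s a => [|t s IH] a /=; first by rewrite subrr.
by rewrite IH; zmod.
Qed.

Lemma eq_rsum (E : completeNormedModType R) (F G : R -> R -> E) a s :
  (forall u v, F u v = G u v) -> rsum F a s = rsum G a s.
Proof. by move=> e; elim: s a => //= t s IH a; rewrite e IH. Qed.

(** Bounds all Riemann sums of a coherent germ at once, whatever their mesh: germ, sewing error of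
    the integral, and distance of the sum to the integral. *)
Lemma rsum_le (E : completeNormedModType R) (F : R -> R -> E) C b s :
  0 <= C -> 0 <= b <= 1 -> coherent 0 1 theta C F -> itv_partition 0 b s ->
  `|F 0 b| <= C -> `|rsum F 0 s| <= (1 + kappa + kappa * 2 `^ (theta - 1)) * C.
Proof.
move=> C0 /andP[b0 b1] cF ps hF.
have [I I0 sI] := additive_sewing th1 C0 b0 (coherent_sub (lexx _) b1 cF).
have kC : 0 <= kappa * C by rewrite mulr_ge0.
(* Gaps are at most 1 and fineness is strict, so mesh 2 fits every partition. *)
have fine2 a l : 0 <= a -> path <%R a l -> last a l <= 1 -> fine 2 a l.
  elim: l a => //= t l IH a a0 /andP[at_ p] l1.
  have tl := path_last_ge p; rewrite /fine /= -/(fine _ _ _) IH // ?andbT.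
    by lra.
  by rewrite (le_trans a0) // ltW.
have fs : fine 2 0 s by case: ps => p /eqP l; apply: fine2; rewrite ?l.
have h1 := sews_rsum th1 kC sI (ltW (ltr0Sn _ 1)) ps fs.
have h2 := sI 0 b (lexx _) b0 (lexx _).
rewrite -[rsum _ _ _](subrK (I b - I 0)) -[I b - I 0](subrK (F 0 b)).
apply: le_trans (ler_normD _ _) _; rewrite (subrK (F 0 b)).
have -> : (1 + kappa + kappa * 2 `^ (theta - 1)) * C =
  kappa * C * 2 `^ (theta - 1) + (kappa * C + C) by ring.
apply: lerD.
  apply: le_trans h1 _; rewrite subr0 ler_piMr // mulr_ge0 ?powR_ge0 //.
rewrite -[I b - I 0](subrK (F 0 b)).
apply: le_trans (ler_normD _ _) _; apply: lerD => //.
apply: le_trans h2 _; rewrite subr0 ler_piMr // powR_le1 ?b0 //.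
by rewrite ltW // (lt_trans ltr01).
Qed.

(** The integral over [[u, v] x [0, t]] with [f] frozen at the left edge: the germ in the first
    variable of the double integral. *)
Definition strip f g (t u v : R) : W :=
  young sm 0 t (fun y => f (u, y)) (fun y => g (v, y) - g (u, y)).

Definition strip_sum f g (s : seq R) (u v : R) : W :=
  rsum (young_germ sm (fun y => f (u, y)) (fun y => g (v, y) - g (u, y))) 0 s.

Lemma riemann_sum2E f g s t pi :
  riemann_sum2 s t f g pi = rsum (strip_sum f g pi.2) 0 pi.1.
Proof.
rewrite /riemann_sum2 -(big_rsum _ _ s); apply: eq_bigr => k _.
rewrite /strip_sum -(big_rsum _ _ t); apply: eq_bigr => l _.
rewrite /young_germ /rect_incr; congr (_ *: _).
by move: (g _) (g _) (g _) (g _) => a b c e; ring.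
Qed.

Section Bounds.
Variables (K L : R) (f : R * R -> W) (g : R * R -> R).
Hypotheses (bf : bd rho K f) (bg : bd rho L g).

Let K0 : 0 <= K := bd_ge0 bf.
Let L0 : 0 <= L := bd_ge0 bg.

Lemma hol_strip_g s t : 0 <= s -> s <= t -> t <= 1 ->
  hol rho 0 1 (L * (t - s) `^ rho) (fun y => g (t, y) - g (s, y)).
Proof.
move=> s0 st t1 u v hu hv; rewrite /= subrACB -mulrA.
have -> : t - s = `|t - s| by rewrite ger0_norm ?subr_ge0.
apply: (@bg (Inc12 t s u v)).
by rewrite /= hu hv t1 s0 (le_trans s0 st) (le_trans st t1).
Qed.

Lemma hol_strip_f s u : 0 <= s -> s <= u -> u <= 1 ->
  hol rho 0 1 (K * (u - s) `^ rho) (fun y => f (s, y) - f (u, y)).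
Proof.
move=> s0 st t1 x y hx hy; rewrite /= subrACB -mulrA.
have -> : u - s = `|s - u| by rewrite distrC ger0_norm ?subr_ge0.
apply: (@bf (Inc12 s u x y)).
by rewrite /= hx hy t1 s0 (le_trans s0 st) (le_trans st t1).
Qed.

Lemma strip_sum_defect s x u y :
  strip_sum f g s x y - strip_sum f g s x u - strip_sum f g s u y =
  rsum (young_germ sm (fun v => f (x, v) - f (u, v))
    (fun v => g (y, v) - g (u, v))) 0 s.
Proof.
rewrite /strip_sum -!rsumB; apply: eq_rsum => a b; rewrite /young_germ.
by rewrite !(scalerBl, scalerBr); zmod.
Qed.

Lemma strip_defect t x u y : 0 <= t <= 1 -> 0 <= x -> x <= u -> u <= y ->
  y <= 1 -> strip f g t x y - strip f g t x u - strip f g t u y =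
  young sm 0 t (fun v => f (x, v) - f (u, v)) (fun v => g (y, v) - g (u, v)).
Proof.
move=> /andP[t0 t1] x0 xu uy y1.
have i01 : 0 <= (0 : R) <= 1 by rewrite lexx ler01.
have hx : 0 <= x <= 1 by rewrite x0 (le_trans xu) // (le_trans uy).
have hu : 0 <= u <= 1 by rewrite (le_trans x0 xu) (le_trans uy).
have [s1 z1] := young_sews01 rho_gt smP K0 (mulr_ge0 L0 (powR_ge0 _ _))
  (bd_hol2 hx bf) (hol_strip_g x0 (le_trans xu uy) y1).
have [s2 z2] := young_sews01 rho_gt smP K0 (mulr_ge0 L0 (powR_ge0 _ _))
  (bd_hol2 hx bf) (hol_strip_g x0 xu (le_trans uy y1)).
have [s3 z3] := young_sews01 rho_gt smP K0 (mulr_ge0 L0 (powR_ge0 _ _))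
  (bd_hol2 hu bf) (hol_strip_g (le_trans x0 xu) uy y1).
have [s4 z4] := young_sews01 rho_gt smP (mulr_ge0 K0 (powR_ge0 _ _))
  (mulr_ge0 L0 (powR_ge0 _ _)) (hol_strip_f x0 xu (le_trans uy y1))
  (hol_strip_g (le_trans x0 xu) uy y1).
have sd := sewsB (sewsB s1 s2) s3.
have C0 a b : 0 <= a -> 0 <= b -> 0 <= kappa * (1 * a * b).
  by move=> *; apply: mulr_ge0 => //; rewrite !mulr_ge0.
have sd' := eq_sews _ sd.
have := sews_uniq th1 _ _ t0 (sews_sub (lexx _) t1 (sd' _ _))
  (sews_sub (lexx _) t1 s4).
rewrite /= z1 z2 z3 z4 !subr0; apply.
- by rewrite !addr_ge0 // C0 // mulr_ge0 ?powR_ge0.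
- by rewrite C0 // mulr_ge0 ?powR_ge0.
- by move=> a b _ _ _; rewrite /young_germ !(scalerBl, scalerBr); zmod.
Qed.

(** Increments in the first variable of [f] and of [g] each contribute a power [rho], while
    rectangular control keeps them Hoelder in the second. The Hoelder bound in [t] gives coherence
    here and the regularity of the double integral later. *)
Lemma strip_defect_hol x u y : 0 <= x -> x <= u -> u <= y -> y <= 1 ->
  hol rho 0 1 ((1 + kappa) * (K * L) * (y - x) `^ theta)
   (fun t => young sm 0 t (fun v => f (x, v) - f (u, v))
      (fun v => g (y, v) - g (u, v))).
Proof.
move=> x0 xu uy y1.
have hx : 0 <= x <= 1 by rewrite x0 (le_trans xu) // (le_trans uy).
have hu : 0 <= u <= 1 by rewrite (le_trans x0 xu) (le_trans uy).
have h := young_hol01 rho_gt smP (mulr_ge0 K0 (powR_ge0 _ _))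
  (mulr_ge0 L0 (powR_ge0 _ _)) (hol_strip_f x0 xu (le_trans uy y1))
  (hol_strip_g (le_trans x0 xu) uy y1) _.
apply: hol_le (h _); last first.
  move=> t ht; rewrite -(ger0_norm (_ : 0 <= u - x)) ?subr_ge0 // (distrC u).
  by apply: (@bf (Inc1 x u t)); rewrite /= hx hu.
have -> : (1 + kappa) * (1 * (K * (u - x) `^ rho) * (L * (y - u) `^ rho)) =
  (1 + kappa) * (K * L) * ((u - x) `^ rho * (y - u) `^ rho) by ring.
rewrite ler_wpM2l ?mulr_ge0 // ?addr_ge0 // powR_theta //.
rewrite ler_pM ?powR_ge0 // ler_powR2r ?(ltW rho0) ?subr_ge0 //.
  by rewrite lerD2r.
by rewrite lerD2l lerN2.
Qed.

Lemma strip_coherent t : 0 <= t <= 1 ->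
  coherent 0 1 theta ((1 + kappa) * (K * L)) (strip f g t).
Proof.
move=> ht x u y x0 xu uy y1; rewrite strip_defect //.
have h := strip_defect_hol x0 xu uy y1.
have i01 : 0 <= (0 : R) <= 1 by rewrite lexx ler01.
have hu : 0 <= u <= 1 by rewrite (le_trans x0 xu) (le_trans uy).
have [_ z] := young_sews01 rho_gt smP (mulr_ge0 K0 (powR_ge0 _ _))
  (mulr_ge0 L0 (powR_ge0 _ _)) (hol_strip_f x0 xu (le_trans uy y1))
  (hol_strip_g (le_trans x0 xu) uy y1).
have := h t 0 ht i01; rewrite z subr0 => {}h; apply: le_trans h _.
rewrite ler_piMr ?mulr_ge0 ?powR_ge0 // ?addr_ge0 //.
by case/andP: ht => t0 t1; rewrite subr0 ger0_norm // powR_le1 ?t0 // ltW.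
Qed.

Let KL0 : 0 <= (1 + kappa) * (K * L).
Proof. by rewrite !mulr_ge0 // addr_ge0. Qed.

(** The key to a joint rather than an iterated limit: replacing inner integrals by sums costs an
    error uniform in the outer partition. The difference of the two germs is itself coherent with a
    constant proportional to [d] to the power [theta - 1], so [rsum_le] applies. *)
Lemma strip_sum_close d s t s1 s2 : 0 < d -> 0 <= s <= 1 -> 0 <= t <= 1 ->
  itv_partition 0 s s1 -> itv_partition 0 t s2 -> fine d 0 s2 ->
  `|rsum (strip_sum f g s2) 0 s1 - rsum (strip f g t) 0 s1| <=
    (1 + kappa + kappa * 2 `^ (theta - 1)) * (kappa * (K * L) * d `^ (theta - 1)).
Proof.
move=> d0 hs ht p1 p2 f2; rewrite -rsumB.
case/andP: (hs) => s0 s1'; case/andP: (ht) => t0 t1.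
have i01 : 0 <= (0 : R) <= 1 by rewrite lexx ler01.
have w0 : 0 <= kappa * (K * L) * d `^ (theta - 1).
  by rewrite mulr_ge0 ?powR_ge0 // mulr_ge0 // mulr_ge0.
have close Kf Kg (phi : R -> W) (psi : R -> R) x : 0 <= x ->
    0 <= Kf -> 0 <= Kg -> hol rho 0 1 Kf phi -> hol rho 0 1 Kg psi ->
    Kf * Kg <= K * L * x ->
    `|rsum (young_germ sm phi psi) 0 s2 - young sm 0 t phi psi|
     <= kappa * (K * L) * d `^ (theta - 1) * x.
  move=> x0 Kf0 Kg0 hphi hpsi hx.
  have [sy z] := young_sews01 rho_gt smP Kf0 Kg0 hphi hpsi.
  have C0 : 0 <= kappa * (1 * Kf * Kg) by apply: mulr_ge0 => //; rewrite !mulr_ge0.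
  have := sews_rsum th1 C0 (sews_sub (lexx _) t1 sy) (ltW d0) p2 f2.
  rewrite z !subr0 => h; apply: le_trans h _.
  have -> : kappa * (1 * Kf * Kg) * d `^ (theta - 1) * t =
    kappa * d `^ (theta - 1) * (Kf * Kg * t) by ring.
  have -> : kappa * (K * L) * d `^ (theta - 1) * x =
    kappa * d `^ (theta - 1) * (K * L * x) by ring.
  apply: ler_wpM2l; first by apply: mulr_ge0 => //; exact: powR_ge0.
  by apply: le_trans hx; rewrite ler_piMr // mulr_ge0.
apply: rsum_le hs _ p1 _ => //.
- move=> x u y x0 xu uy y1.
  have -> : strip_sum f g s2 x y - strip f g t x y
      - (strip_sum f g s2 x u - strip f g t x u)
      - (strip_sum f g s2 u y - strip f g t u y)
    = (strip_sum f g s2 x y - strip_sum f g s2 x u - strip_sum f g s2 u y)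
      - (strip f g t x y - strip f g t x u - strip f g t u y) by zmod.
  rewrite strip_sum_defect strip_defect //.
  apply: close (hol_strip_f x0 xu (le_trans uy y1))
    (hol_strip_g (le_trans x0 xu) uy y1) _; rewrite ?mulr_ge0 ?powR_ge0 //.
  have -> : K * (u - x) `^ rho * (L * (y - u) `^ rho) =
    K * L * ((u - x) `^ rho * (y - u) `^ rho) by ring.
  rewrite ler_wpM2l ?mulr_ge0 // powR_theta //.
  rewrite ler_pM ?powR_ge0 // ler_powR2r ?(ltW rho0) ?subr_ge0 //.
    by rewrite lerD2r.
  by rewrite lerD2l lerN2.
- rewrite -[leRHS]mulr1; apply: close (bd_hol2 i01 bf)
    (hol_strip_g (lexx _) s0 s1') _; rewrite ?mulr_ge0 ?powR_ge0 //.
  rewrite mulr1 mulrA ler_piMr ?mulr_ge0 // powR_le1 ?subr0 ?s0 //.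
  exact: ltW.
Qed.

Lemma young2_cvg s t I C : 0 <= s <= 1 -> 0 <= t <= 1 -> 0 <= C ->
  sews 0 1 theta C (strip f g t) I ->
  riemann_sum2 s t f g @ filter_prod (mesh_to0 0 s) (mesh_to0 0 t)
    --> I s - I 0.
Proof.
move=> hs ht C0 sI; case/andP: (hs) => s0 s1; case/andP: (ht) => t0 t1.
apply/cvgrPdist_lt => e e0.
have th0 : 0 < theta - 1 by rewrite subr_gt0.
pose A := (1 + kappa + kappa * 2 `^ (theta - 1)) * (kappa * (K * L)).
have A0 : 0 <= A.
  have h1 : 0 <= kappa * 2 `^ (theta - 1) by rewrite mulr_ge0 ?powR_ge0.
  rewrite mulr_ge0 //; first by apply: addr_ge0 => //; exact: addr_ge0.
  by apply: mulr_ge0 => //; exact: mulr_ge0.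
have M0 : 0 <= A + C by rewrite addr_ge0.
have e20 : 0 < e / 2 by rewrite divr_gt0.
have [d d0 hd] := powR_small th0 M0 e20.
exists ([set p | itv_partition 0 s p /\ fine d 0 p],
        [set p | itv_partition 0 t p /\ fine d 0 p]).
  by split; apply: (mesh_to0I d0) => p.
move=> [s1' s2'] /= [[p1 f1] [p2 f2]]; rewrite riemann_sum2E /=.
have h1 := strip_sum_close d0 hs ht p1 p2 f2.
have h2 := sews_rsum th1 C0 (sews_sub (lexx _) s1 sI) (ltW d0) p1 f1.
rewrite distrC.
apply: le_lt_trans (ler_distD (rsum (strip f g t) 0 s1') _ _) _.
apply: le_lt_trans (lerD h1 h2) _.
apply: (@le_lt_trans _ _ ((A + C) * d `^ (theta - 1))); last first.
  by apply: le_lt_trans hd _; lra.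
rewrite [leRHS]mulrDl; apply: lerD; first by rewrite /A mulrA.
by rewrite subr0 ler_piMr // mulr_ge0 ?powR_ge0.
Qed.

Lemma mesh_prod_proper (s t : R) : 0 <= s -> 0 <= t ->
  ProperFilter (filter_prod (mesh_to0 0 s) (mesh_to0 0 t)).
Proof.
move=> s0 t0; have := mesh_to0_proper s0; have := mesh_to0_proper t0.
by move=> h1 h2; exact: filter_prod_proper.
Qed.

Lemma young2_exists s t : 0 <= s <= 1 -> 0 <= t <= 1 ->
  riemann_sum2 s t f g @ filter_prod (mesh_to0 0 s) (mesh_to0 0 t)
    --> young2 s t f g.
Proof.
move=> hs ht.
have [I _ sI] := additive_sewing th1 KL0 ler01 (strip_coherent ht).
by apply/cvg_ex; exists (I s - I 0); apply: young2_cvg sI => //; rewrite mulr_ge0.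
Qed.

Lemma young2E s t I C : 0 <= s <= 1 -> 0 <= t <= 1 -> 0 <= C ->
  sews 0 1 theta C (strip f g t) I -> young2 s t f g = I s - I 0.
Proof.
move=> hs ht C0 sI; case/andP: (hs) => s0 _; case/andP: (ht) => t0 _.
have fp := mesh_prod_proper s0 t0.
by apply: cvg_lim => //; exact: young2_cvg sI.
Qed.

(** The difference of the strip germs for [t1] and [t2] is coherent with a constant proportional to
    the size of the increment, by [strip_defect_hol], and [sews_improve] transfers this to the
    integrals. Germ and error contribute 1 and [kappa] to the second factor [1 + kappa]. *)
Lemma young2_hol :
  hol rho 0 1 ((1 + kappa) * (1 + kappa) * (K * L)) (fun t => young2 1 t f g).
Proof.
move=> t1 t2 ht1 ht2.
have i01 : 0 <= (0 : R) <= 1 by rewrite lexx ler01.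
have i11 : 0 <= (1 : R) <= 1 by rewrite lexx ler01.
have kKL : 0 <= kappa * ((1 + kappa) * (K * L)) by exact: mulr_ge0.
have [I1 _ sI1] := additive_sewing th1 KL0 ler01 (strip_coherent ht1).
have [I2 _ sI2] := additive_sewing th1 KL0 ler01 (strip_coherent ht2).
rewrite (young2E i11 ht1 kKL sI1) (young2E i11 ht2 kKL sI2).
pose e := `|t1 - t2| `^ rho; have e0 : 0 <= e by exact: powR_ge0.
have D0 : 0 <= (1 + kappa) * (K * L) * e by exact: mulr_ge0.
have co : coherent 0 1 theta ((1 + kappa) * (K * L) * e)
    (fun x y => strip f g t1 x y - strip f g t2 x y).
  move=> x u y x0 xu uy y1.
  have -> : strip f g t1 x y - strip f g t2 x y
      - (strip f g t1 x u - strip f g t2 x u)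
      - (strip f g t1 u y - strip f g t2 u y)
    = (strip f g t1 x y - strip f g t1 x u - strip f g t1 u y)
      - (strip f g t2 x y - strip f g t2 x u - strip f g t2 u y) by zmod.
  by rewrite !strip_defect // mulrAC; exact: (strip_defect_hol x0 xu uy y1).
have sd := sews_improve th1 D0 (addr_ge0 kKL kKL) co (sewsB sI1 sI2).
have := sd 0 1 (lexx _) ler01 (lexx _); rewrite subr0 powR1 mulr1 => h1.
have h2 : `|strip f g t1 0 1 - strip f g t2 0 1| <= (1 + kappa) * (K * L) * e.
  have h := young_hol01 rho_gt smP K0 (mulr_ge0 L0 (powR_ge0 _ _))
    (bd_hol2 i01 bf) (hol_strip_g (lexx _) ler01 (lexx _)) _.
  have {}h := h (fun t ht => bd_sup bf i01 ht) t1 t2 ht1 ht2.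
  by apply: le_trans h _; rewrite subr0 powR1 mulr1 mul1r.
have -> : I1 1 - I1 0 - (I2 1 - I2 0) = I1 1 - I2 1 - (I1 0 - I2 0) by zmod.
rewrite -[I1 1 - _ - _](subrK (strip f g t1 0 1 - strip f g t2 0 1)).
apply: le_trans (ler_normD _ _) _; apply: le_trans (lerD h1 h2) _.
by rewrite le_eqVlt; apply/orP; left; apply/eqP; rewrite /e; ring.
Qed.

End Bounds.

Lemma young2_diff K f g f' g' s t : bd rho K f -> bd rho K g ->
  bd rho K f' -> bd rho K g' -> 0 <= s <= 1 -> 0 <= t <= 1 ->
  young2 s t f g - young2 s t f' g' =
  young2 s t (fun z => f z - f' z) g + young2 s t f' (fun z => g z - g' z).
Proof.
move=> bf bg bf' bg' hs ht; case/andP: (hs) => s0 _; case/andP: (ht) => t0 _.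
have fp := mesh_prod_proper s0 t0.
have c1 := cvgB (young2_exists bf bg hs ht) (young2_exists bf' bg' hs ht).
have c2 := cvgD (young2_exists (bdB bf bf') bg hs ht)
  (young2_exists bf' (bdB bg bg') hs ht).
pose rs F G := riemann_sum2 s t F G : seq R * seq R -> W.
have {}c1 : (fun pi => rs f g pi - rs f' g' pi)
  @ filter_prod (mesh_to0 0 s) (mesh_to0 0 t) --> _ := c1 (@filter_filter _ _ fp).
have {}c2 : (fun pi => rs (fun z => f z - f' z) g pi
    + rs f' (fun z => g z - g' z) pi)
  @ filter_prod (mesh_to0 0 s) (mesh_to0 0 t) --> _ := c2 (@filter_filter _ _ fp).
suff e : (fun pi => rs f g pi - rs f' g' pi) =
    (fun pi => rs (fun z => f z - f' z) g pi + rs f' (fun z => g z - g' z) pi).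
  by rewrite e in c1; exact: (cvg_unique _ c1 c2).
apply/funext => pi; rewrite /rs !riemann_sum2E -rsumB.
have rsumD (F G : R -> R -> W) a p :
    rsum F a p + rsum G a p = rsum (fun u v => F u v + G u v) a p.
  by elim: p a => [|x p IH] a /=; rewrite ?addr0 // -IH; zmod.
rewrite rsumD; apply: eq_rsum => u v; rewrite /strip_sum -rsumB rsumD.
apply: eq_rsum => x y; rewrite /young_germ.
by rewrite !(scalerBl, scalerBr); zmod.
Qed.

End DoubleIntegral.

(** * Surface development *)

Section SurfaceEquation.
Variables (R : realType) (rho : R).
Hypothesis rho_gt : 1 / 2 < rho.

Local Notation theta := (2 * rho).
Local Notation kappa := (sewing_cst (2 * rho)).

Let th1 : 1 < theta. Proof. exact: theta_gt1. Qed.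
Let k0 : 0 <= kappa. Proof. exact: ltW (sewing_cst_gt0 th1). Qed.
Let i0 : 0 <= (0 : R) <= 1. Proof. by rewrite lexx ler01. Qed.
Let i1 : 0 <= (1 : R) <= 1. Proof. by rewrite lexx ler01. Qed.

Lemma sews_mulmxr q k r a b C (Xi : R -> R -> 'M[R]_(q, k)) I (B : 'M[R]_(k, r)) :
  0 <= C -> sews a b theta C Xi I ->
  sews a b theta (k%:R * C * `|B|) (fun s t => Xi s t *m B) (fun t => I t *m B).
Proof.
move=> C0 h s t as_ st tb; rewrite -!mulmxBl; apply: le_trans (normr_mulmx _ _) _.
by rewrite [leRHS]mulrAC ler_wpM2r // -mulrA ler_wpM2l // h.
Qed.

Lemma hol_mulmxr q k r a b K (f : R -> 'M[R]_(q, k)) (B : 'M[R]_(k, r)) :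
  0 <= K -> hol rho a b K f ->
  hol rho a b (k%:R * K * `|B|) (fun t => f t *m B).
Proof.
move=> K0 h u v hu hv; rewrite -mulmxBl; apply: le_trans (normr_mulmx _ _) _.
by rewrite [leRHS]mulrAC ler_wpM2r // -mulrA ler_wpM2l // h.
Qed.

Variables (n m p : nat).
Implicit Types Z h : R -> 'M[R]_(n + m, n + p).

Local Notation ph := (phi R n m p).
Local Notation L := (@dev_field R n m p).

(* With [g = 1 + h phi], the equation for [h] becomes the linear equation
   [dg = g d(Z phi)] followed by the integration [dh = g dZ]. *)
Definition dev_gauge Z : R -> 'M[R]_(n + m) := Dev rho (fun t => Z t *m ph).

Definition dev_sol Z (t : R) : 'M[R]_(n + m, n + p) :=
  young mulmx 0 t (dev_gauge Z) Z.

Definition phi_cst (K : R) : R := (n + p)%:R * K * `|ph|.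

Lemma phi_cst_ge0 K : 0 <= K -> 0 <= phi_cst K.
Proof. by move=> K0; rewrite !mulr_ge0. Qed.

Let Lip_ge0 : 0 <= (n + p)%:R * `|ph| :> R.
Proof. by rewrite mulr_ge0. Qed.

Lemma dev_field_lip (x y : 'M[R]_(n + m, n + p)) :
  `|L x - L y| <= (n + p)%:R * `|ph| * `|x - y|.
Proof.
rewrite /dev_field (_ : _ - _ = (x - y) *m ph); last by rewrite mulmxBl; zmod.
by apply: le_trans (normr_mulmx _ _) _; rewrite mulrAC.
Qed.

Lemma dev_gauge_bound K : 0 <= K -> exists2 C, 0 <= C & forall Z,
  hol rho 0 1 K Z -> (forall t, 0 <= t <= 1 -> `|dev_gauge Z t| <= C) /\
    hol rho 0 1 C (dev_gauge Z).
Proof.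
move=> K0; have [C C0 hC] := Dev_bound rho_gt (n + m) (phi_cst_ge0 K0).
by exists C => // Z hZ; have [] := hC _ (hol_mulmxr ph K0 hZ).
Qed.

Lemma dev_sol_sews K Z : 0 <= K -> hol rho 0 1 K Z -> exists2 C, 0 <= C &
  hol rho 0 1 C (dev_sol Z) /\
  sews 0 1 theta C (young_germ mulmx (dev_gauge Z) Z) (dev_sol Z).
Proof.
move=> K0 hZ; have [C C0 hC] := dev_gauge_bound K0; have [b hg] := hC _ hZ.
have [s _] := young_sews01 rho_gt (mulmx_bilinear R _ _ _) C0 K0 hg hZ.
have h := young_hol01 rho_gt (mulmx_bilinear R _ _ _) C0 K0 hg hZ b.
have nCK : 0 <= (n + m)%:R * C * K by rewrite !mulr_ge0.
exists ((1 + kappa) * ((n + m)%:R * C * K)).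
  by apply: mulr_ge0 => //; apply: addr_ge0.
split=> // x y x0 xy y1; apply: le_trans (s x y x0 xy y1) _.
apply: ler_wpM2r; first exact: powR_ge0.
by apply: ler_wpM2r => //; rewrite lerDr.
Qed.

Lemma dev_sol0 K Z : 0 <= K -> hol rho 0 1 K Z -> dev_sol Z 0 = 0.
Proof.
move=> K0 hZ; have [C C0 hC] := dev_gauge_bound K0; have [b hg] := hC _ hZ.
by have [_] := young_sews01 rho_gt (mulmx_bilinear R _ _ _) C0 K0 hg hZ.
Qed.

Lemma sews_germ_phi a b C Z (g : R -> 'M[R]_(n + m)) h : 0 <= C ->
  sews a b theta C (young_germ mulmx g Z) h ->
  sews a b theta (phi_cst C) (young_germ mulmx g (fun t => Z t *m ph))
    (fun t => h t *m ph).
Proof.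
move=> C0 sh; apply: eq_sews (sews_mulmxr ph C0 sh) => s t _ _ _.
by rewrite /young_germ -mulmxBl mulmxA.
Qed.

(** Multiplying the integral of [dev_gauge Z] against [Z] by [phi] gives its integral against
    [Z phi], which is [dev_gauge Z - 1]. *)
Lemma dev_gaugeE K Z t : 0 <= K -> hol rho 0 1 K Z -> 0 <= t <= 1 ->
  L (dev_sol Z t) = dev_gauge Z t.
Proof.
move=> K0 hZ /andP[t0 t1].
have [C C0 [_ /(sews_germ_phi C0) s1]] := dev_sol_sews K0 hZ.
have [_ g0 [D D0 [_ s2]]] := DevP rho_gt (phi_cst_ge0 K0) (hol_mulmxr ph K0 hZ).
have := sews_uniq th1 (phi_cst_ge0 C0) D0 t0 (sews_sub (lexx _) t1 s1)
  (sews_sub (lexx _) t1 s2).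
rewrite g0 (dev_sol0 K0 hZ) mul0mx subr0 /dev_field => ->.
by rewrite addrC subrK.
Qed.

Lemma dev_sol_sol K Z : 0 <= K -> hol rho 0 1 K Z ->
  young_sol rho L Z 0 (dev_sol Z).
Proof.
move=> K0 hZ; apply/(young_solP rho_gt Lip_ge0 dev_field_lip _ _ K0 hZ).
split; first exact: dev_sol0 K0 hZ.
have [C C0 [h s]] := dev_sol_sews K0 hZ; exists C => //; split=> //.
apply: eq_sews s => x y x0 xy y1; rewrite /young_germ /= (dev_gaugeE K0 hZ) //.
by rewrite x0 (le_trans xy).
Qed.

(** For any solution [h], the field [L h] solves the linear equation and hence equals the gauge;
    then [h] and [dev_sol Z] integrate the same germ. *)
Lemma dev_sol_uniq K Z h t : 0 <= K -> hol rho 0 1 K Z ->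
  young_sol rho L Z 0 h -> 0 <= t <= 1 -> h t = dev_sol Z t.
Proof.
move=> K0 hZ /(young_solP rho_gt Lip_ge0 dev_field_lip _ _ K0 hZ).
move=> [h0 [C C0 [hh sh]]] /andP[t0 t1].
have e u : 0 <= u <= 1 -> dev_gauge Z u = L (h u).
  apply: (@Dev_uniq _ _ rho_gt _ (phi_cst K) _ (L \o h)).
  - exact: phi_cst_ge0.
  - exact: hol_mulmxr.
  - by rewrite /= h0 /dev_field mul0mx addr0.
  - have LC : 0 <= (n + p)%:R * `|ph| * C by rewrite mulr_ge0.
    exists ((n + p)%:R * `|ph| * C) => //; split.
      exact: (hol_lip Lip_ge0 dev_field_lip hh).
    move=> x y x0 xy y1; have := sews_germ_phi C0 sh x0 xy y1.
    have E : h y *m ph - h x *m ph = L (h y) - L (h x).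
      by rewrite /dev_field opprD addrACA subrr add0r.
    by rewrite /phi_cst (mulrAC _ C) /young_germ /= E.
have [D D0 [_ sD]] := dev_sol_sews K0 hZ.
have sh' : sews 0 1 theta C (young_germ mulmx (dev_gauge Z) Z) h.
  apply: eq_sews sh; move=> a b a0 ab b1; rewrite /young_germ e //=.
  by rewrite a0 (le_trans ab).
have := sews_uniq th1 C0 D0 t0 (sews_sub (lexx _) t1 sh') (sews_sub (lexx _) t1 sD).
by rewrite h0 (dev_sol0 K0 hZ) !subr0.
Qed.

Lemma dev_wellposed K Z : 0 <= K -> hol rho 0 1 K Z ->
  young_wellposed rho L Z 0.
Proof.
move=> K0 hZ; exists (dev_sol Z); first exact: (dev_sol_sol K0 hZ).
by move=> G sG t ht; exact: (dev_sol_uniq K0 hZ sG ht).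
Qed.

Lemma dev_endpoint K Z : 0 <= K -> hol rho 0 1 K Z ->
  young_endpoint rho L Z 0 = dev_sol Z 1.
Proof.
move=> K0 hZ; apply: (dev_sol_uniq K0 hZ) => //.
apply: (@xgetPex _ (fun=> 0) (young_sol rho L Z 0)).
by exists (dev_sol Z); exact: (dev_sol_sol K0 hZ).
Qed.

Lemma dev_endpoint_GL1 K Z : 0 <= K -> hol rho 0 1 K Z -> GL1 (dev_sol Z 1).
Proof.
move=> K0 hZ; set h := dev_sol Z 1.
exists (ulsubmx h + 1%:M), (dlsubmx h), (ursubmx h), (drsubmx h).
split; last by rewrite addrK submxK.
(* [phi] keeps the first [n] columns, so the matrix is block triangular with diagonal blocks [A] and
   1 and has the determinant of [A]. *)
have g1 : L h = block_mx (ulsubmx h + 1%:M) 0 (dlsubmx h) 1%:M.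
  rewrite /dev_field -[h in LHS]submxK /phi mulmx_block !(mulmx0, mulmx1, addr0).
  by rewrite (scalar_mx_block n m 1) add_block_mx !(add0r, addr0) addrC.
have := Dev_inv rho_gt (phi_cst_ge0 K0) (hol_mulmxr ph K0 hZ) i1.
rewrite -/(dev_gauge Z 1) -(dev_gaugeE K0 hZ i1) -/h => /mulmx1_unit[+ _].
by rewrite g1 !unitmxE det_lblock det1 mulr1.
Qed.

Lemma dev_sol_lip K : 0 <= K -> exists2 C, 0 <= C & forall e Z Z', 0 < e ->
  hol rho 0 1 K Z -> hol rho 0 1 K Z' -> hol rho 0 1 (K * e) (fun t => Z t - Z' t) ->
  `|dev_sol Z 1 - dev_sol Z' 1| <= C * e.
Proof.
move=> K0; have [C C0 hC] := dev_gauge_bound K0.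
have [D D0 hD] := Dev_lip rho_gt (n + m) (phi_cst_ge0 K0).
exists ((1 + kappa) * ((n + m)%:R * D * K) + (1 + kappa) * ((n + m)%:R * C * K)).
  by rewrite addr_ge0 // !mulr_ge0 // addr_ge0.
move=> e Z Z' e0 hZ hZ' hd; have [b hg] := hC _ hZ; have [b' hg'] := hC _ hZ'.
have hd' : hol rho 0 1 (phi_cst K * e) (fun t => Z t *m ph - Z' t *m ph).
  apply: (eq_hol (f := fun t => (Z t - Z' t) *m ph)).
    by move=> t _; rewrite mulmxBl.
  apply: hol_le (hol_mulmxr ph (mulr_ge0 K0 (ltW e0)) hd).
  by rewrite le_eqVlt; apply/orP; left; apply/eqP; rewrite /phi_cst; ring.
have [hG bG] := hD e _ _ e0 (hol_mulmxr ph K0 hZ) (hol_mulmxr ph K0 hZ') hd'.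
have KC0 : 0 <= K + C by rewrite addr_ge0.
have KC1 : C <= K + C by rewrite lerDr.
have KC2 : K <= K + C by rewrite lerDl.
rewrite /dev_sol (young_diff01 rho_gt (mulmx_bilinear R _ _ _) KC0
  (hol_le KC1 hg) (hol_le KC2 hZ) (hol_le KC1 hg') (hol_le KC2 hZ') i1).
apply: le_trans (ler_normD _ _) _; rewrite mulrDl.
have De : 0 <= D * e by rewrite mulr_ge0 // ltW.
have Ke : 0 <= K * e by rewrite mulr_ge0 // ltW.
have h1 := young_hol01 rho_gt (mulmx_bilinear R _ _ _) De K0 hG hZ bG i1 i0.
have h2 := young_hol01 rho_gt (mulmx_bilinear R _ _ _) C0 Ke hg' hd b' i1 i0.
have [_ z1] := young_sews01 rho_gt (mulmx_bilinear R _ _ _) De K0 hG hZ.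
have [_ z2] := young_sews01 rho_gt (mulmx_bilinear R _ _ _) C0 Ke hg' hd.
rewrite /= in h1 h2 z1 z2; rewrite z1 !subr0 normr1 powR1 mulr1 in h1.
rewrite z2 !subr0 normr1 powR1 mulr1 in h2.
apply: lerD.
  by apply: le_trans h1 _; rewrite le_eqVlt; apply/orP; left; apply/eqP; ring.
by apply: le_trans h2 _; rewrite le_eqVlt; apply/orP; left; apply/eqP; ring.
Qed.

End SurfaceEquation.

(** * Dependence on the surface and on the connection *)

Section SurfaceDevelopment.
Variables (R : realType) (rho : R).
Hypothesis rho_gt : 1 / 2 < rho.

Local Notation theta := (2 * rho).
Local Notation kappa := (sewing_cst (2 * rho)).

Let th1 : 1 < theta. Proof. exact: theta_gt1. Qed.
Let k0 : 0 <= kappa. Proof. exact: ltW (sewing_cst_gt0 th1). Qed.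

Lemma hol_sum (V : normedModType R) (I : finType) (P : pred I) a b K
    (f : I -> R -> V) : 0 <= K -> (forall i, P i -> hol rho a b K (f i)) ->
  hol rho a b (#|I|%:R * K) (fun t => \sum_(i | P i) f i t).
Proof.
move=> K0 h u v hu hv; rewrite -sumrB; apply: le_trans (ler_norm_sum _ _ _) _.
apply: (@le_trans _ _ (\sum_(i : I) K * `|u - v| `^ rho)).
  rewrite [leRHS](bigID P) /= -[leLHS]addr0 lerD //.
    by apply: ler_sum => i Pi; exact: h.
  by apply: sumr_ge0 => *; rewrite mulr_ge0 ?powR_ge0.
by rewrite sumr_const -mulrA mulr_natl.
Qed.

Lemma hol_sum_lt (V : normedModType R) k a b K (f : 'I_k -> 'I_k -> R -> V) :
  0 <= K -> (forall i j : 'I_k, (i < j)%N -> hol rho a b K (f i j)) ->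
  hol rho a b (k%:R * (k%:R * K))
    (fun t => \sum_(i < k) \sum_(j < k | (i < j)%N) f i j t).
Proof.
move=> K0 h; have kK : 0 <= k%:R * K by rewrite mulr_ge0.
have := @hol_sum V _ xpredT a b _
  (fun (i : 'I_k) t => \sum_(j < k | (i < j)%N) f i j t) kK.
rewrite card_ord; apply=> i _.
have := @hol_sum V _ (fun j : 'I_k => (i < j)%N) a b _ (f i) K0.
by rewrite card_ord; apply=> j; exact: h.
Qed.

Section Forms.
Variables (d q : nat).
Implicit Types (a : 'I_d -> 'M[R]_q) (X : R * R -> 'rV[R]_d).

(** The forms have constant coefficients, so the driver along a tail path of [X] is the [tail] of
    this surface. *)
Definition form_surface a X (z : R * R) : 'M[R]_q := \sum_i X z 0 i *: a i.

Lemma form_path_tail a X s t :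
  form_path a (tail_path X s t) = tail (form_surface a X) s t.
Proof.
by apply/funext => u; rewrite /form_path /tail_path /tail; case: ifP.
Qed.

Lemma bd_form a X A K : 0 <= A -> (forall i, `|a i| <= A) -> bd rho K X ->
  bd rho (d%:R * A * K) (form_surface a X).
Proof.
move=> A0 hA bX.
apply: (bd_lin (phi := fun x : 'rV[R]_d => \sum_i x 0 i *: a i)) bX.
- by move=> x y; rewrite -sumrB; apply: eq_bigr => i _; rewrite !mxE scalerBl.
- move=> x; apply: le_trans (ler_norm_sum _ _ _) _.
  apply: (@le_trans _ _ (\sum_(i < d) A * `|x|)).
    by apply: ler_sum => i _; rewrite normrZ mulrC ler_pM // normr_entry.
  by rewrite sumr_const card_ord -mulrA mulr_natl.
- by rewrite mulr_ge0.
Qed.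

Lemma form_surfaceB a a' X X' z :
  form_surface a X z - form_surface a' X' z =
  form_surface a (fun z => X z - X' z) z
  + form_surface (fun i => a i - a' i) X' z.
Proof.
rewrite /form_surface -sumrB -big_split /=; apply: eq_bigr => i _.
by rewrite !mxE scalerBl scalerBr; zmod.
Qed.

Lemma bd_formB a a' X X' K e : 0 <= K -> 0 <= e -> (forall i, `|a i| <= K) ->
  (forall i, `|a i - a' i| <= e) -> bd rho K X' ->
  bd rho e (fun z => X z - X' z) ->
  bd rho (2 * d%:R * K * e) (fun z => form_surface a X z - form_surface a' X' z).
Proof.
move=> K0 e0 ha ha' bX' bXX'.
apply: (eq_bd (f := fun z => form_surface a (fun z => X z - X' z) z
  + form_surface (fun i => a i - a' i) X' z)).
  by move=> s t _ _; rewrite form_surfaceB.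
apply: bd_le (bdD (bd_form K0 ha bXX') (bd_form e0 ha' bX')).
by rewrite le_eqVlt; apply/orP; left; apply/eqP; ring.
Qed.

End Forms.

Lemma bd_coord d (X : R * R -> 'rV[R]_d) K i :
  bd rho K X -> bd rho K (fun z => X z 0 i).
Proof.
rewrite -[K in bd _ K (fun z => X z 0 i)]mul1r => bX.
apply: (bd_lin (phi := fun x : 'rV[R]_d => x 0 i)) bX => //.
- by move=> x y; rewrite !mxE.
- by move=> x; rewrite mul1r normr_entry.
Qed.

Variables (d n m p : nat).
Implicit Types (X : R * R -> 'rV[R]_d) (w : forms R n m p d).

(** One constant for the surface and the connection together, in the maximum norm. *)
Definition bounded_by K X w := [/\ bd rho K X, forall i, `|alpha w i| <= K,
  forall i, `|beta w i| <= K &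
  forall i j : 'I_d, (i < j)%N -> `|gamma w i j| <= K].

Definition close_by e X w X' w' := [/\ bd rho e (fun z => X z - X' z),
  forall i, `|alpha w i - alpha w' i| <= e,
  forall i, `|beta w i - beta w' i| <= e &
  forall i j : 'I_d, (i < j)%N -> `|gamma w i j - gamma w' i j| <= e].

Definition left_factor X w := tail_dev rho (form_surface (alpha w) X).

(** The inverse of the development of [beta], written as a transposed development so that
    [bd_tail_dev] and [tail_dev_lip] apply to it. *)
Definition right_factor X w (z : R * R) :=
  (tail_dev rho (fun z => - (form_surface (beta w) X z)^T) z)^T.

Definition integrand X w i j z :=
  left_factor X w z *m gamma w i j *m right_factor X w z.

Lemma bd_tr q r K (f : R * R -> 'M[R]_(q, r)) :
  bd rho K f -> bd rho K (fun z => (f z)^T).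
Proof.
rewrite -[K in bd _ K (fun z => (f z)^T)]mul1r => bf.
apply: (bd_lin (phi := fun A : 'M[R]_(q, r) => A^T)) bf => //.
- by move=> x y; rewrite trmxB.
- by move=> x; rewrite mul1r normr_trmx.
Qed.

Lemma bd_factors K : 0 <= K -> exists2 C, 0 <= C & forall X w,
  bounded_by K X w -> bd rho C (left_factor X w) /\ bd rho C (right_factor X w).
Proof.
move=> K0; have B0 : 0 <= d%:R * K * K by rewrite !mulr_ge0.
have [C C0 hC] := bd_tail_dev rho_gt (n + m) B0.
have [D D0 hD] := bd_tail_dev rho_gt (n + p) B0.
exists (C + D) => [|X w [bX ha hb _]]; first by rewrite addr_ge0.
split.
  by apply: bd_le (hC _ (bd_form K0 ha bX)); rewrite lerDl.
apply: bd_le (bd_tr (hD _ (bd_opp_tr (bd_form K0 hb bX)))).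
by rewrite lerDr.
Qed.

Lemma bd_factorsB K : 0 <= K -> exists2 C, 0 <= C & forall e X w X' w', 0 < e ->
  bounded_by K X w -> bounded_by K X' w' -> close_by e X w X' w' ->
  bd rho (C * e) (fun z => left_factor X w z - left_factor X' w' z) /\
  bd rho (C * e) (fun z => right_factor X w z - right_factor X' w' z).
Proof.
(* [tail_dev_lip] takes a single constant for the size of the drivers and for their distance
   relative to [e], so the two bounds are added. *)
move=> K0; pose B := d%:R * K * K + 2 * d%:R * K.
have B1 : 0 <= d%:R * K * K by rewrite !mulr_ge0.
have B2 : 0 <= 2 * d%:R * K by rewrite !mulr_ge0.
have B0 : 0 <= B by rewrite addr_ge0.
have [C C0 hC] := tail_dev_lip rho_gt (n + m) B0.
have [D D0 hD] := tail_dev_lip rho_gt (n + p) B0.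
exists (C + D) => [|e X w X' w' e0 [bX ha hb _] [bX' ha' hb' _] [cX ca cb _]].
  by rewrite addr_ge0.
have e0' := ltW e0.
have le1 : d%:R * K * K <= B by rewrite lerDl.
have le2 : 2 * d%:R * K * e <= B * e by rewrite ler_wpM2r // lerDr.
split.
  apply: bd_le (hC e _ _ e0 (bd_le le1 (bd_form K0 ha bX))
    (bd_le le1 (bd_form K0 ha' bX')) (bd_le le2 (bd_formB K0 e0' ha ca bX' cX))).
  by rewrite ler_wpM2r // lerDl.
have bb : bd rho (B * e) (fun z => - (form_surface (beta w) X z)^T
    - (- (form_surface (beta w') X' z)^T)).
  apply: (eq_bd (f := fun z => - (form_surface (beta w) X z
    - form_surface (beta w') X' z)^T)).
    by move=> s t _ _; rewrite trmxB; zmod.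
  exact: bd_opp_tr (bd_le le2 (bd_formB K0 e0' hb cb bX' cX)).
have h := hD e _ _ e0 (bd_opp_tr (bd_le le1 (bd_form K0 hb bX)))
  (bd_opp_tr (bd_le le1 (bd_form K0 hb' bX'))) bb.
apply: (eq_bd (f := fun z => (tail_dev rho (fun z => - (form_surface (beta w) X z)^T) z
   - tail_dev rho (fun z => - (form_surface (beta w') X' z)^T) z)^T)).
  by move=> s t _ _; rewrite trmxB.
by apply: bd_le (bd_tr h); rewrite ler_wpM2r // lerDr.
Qed.

Lemma bd_sandwich q k l r a b g (A : R * R -> 'M[R]_(q, k)) (G : 'M[R]_(k, l))
    (B : R * R -> 'M[R]_(l, r)) : bd rho a A -> `|G| <= g -> bd rho b B ->
  bd rho (4 * (l%:R * (4 * (k%:R * a * g)) * b)) (fun z => A z *m G *m B z).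
Proof.
move=> bA hG bB.
exact: (bd_mul (mulmx_bilinear R q l r)
  (bd_mul (mulmx_bilinear R q k l) bA (bd_le hG (bd_cst rho G))) bB).
Qed.

Lemma bd_integrand K : 0 <= K -> exists2 C, 0 <= C & forall X w (i j : 'I_d),
  bounded_by K X w -> (i < j)%N -> bd rho C (integrand X w i j).
Proof.
move=> K0; have [C C0 hC] := bd_factors K0.
eexists; last first.
  move=> X w i j bXw ij; have [bl br] := hC _ _ bXw; have [_ _ _ hg] := bXw.
  exact: bd_sandwich bl (hg i j ij) br.
by rewrite !mulr_ge0.
Qed.

Lemma bd_integrandB K : 0 <= K -> exists2 C, 0 <= C & forall e X w X' w' (i j : 'I_d),
  0 < e -> bounded_by K X w -> bounded_by K X' w' -> close_by e X w X' w' ->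
  (i < j)%N ->
  bd rho (C * e) (fun z => integrand X w i j z - integrand X' w' i j z).
Proof.
move=> K0; have [C C0 hC] := bd_factors K0; have [D D0 hD] := bd_factorsB K0.
(* The numerical part of [bd_sandwich]: two applications of [bd_mul] and two inner dimensions. *)
pose N : R := 4 * (n + p)%:R * 4 * (n + m)%:R.
have N0 : 0 <= N by rewrite !mulr_ge0.
exists (N * D * K * C + N * C * C + N * C * K * D).
  by rewrite !addr_ge0 // !mulr_ge0.
move=> e X w X' w' i j e0 bXw bXw' cl ij.
have [bl br] := hC _ _ bXw; have [bl' br'] := hC _ _ bXw'.
have [dl dr] := hD _ _ _ _ _ e0 bXw bXw' cl.
have [_ _ _ hg] := bXw; have [_ _ _ hg'] := bXw'; have [_ _ _ cg] := cl.
(* The three factors are exchanged one after the other. *)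
apply: (eq_bd (f := fun z =>
  (left_factor X w z - left_factor X' w' z) *m gamma w i j *m right_factor X w z
  + left_factor X' w' z *m (gamma w i j - gamma w' i j) *m right_factor X w z
  + left_factor X' w' z *m gamma w' i j
      *m (right_factor X w z - right_factor X' w' z))).
  move=> s t _ _; rewrite /integrand.
  move: (left_factor X w _) (left_factor X' w' _) => A A'.
  move: (right_factor X w _) (right_factor X' w' _) => B B'.
  by rewrite !(mulmxBl, mulmxBr); zmod.
apply: bd_le (bdD (bdD (bd_sandwich dl (hg i j ij) br)
  (bd_sandwich bl' (cg i j ij) br)) (bd_sandwich bl' (hg' i j ij) dr)).
by rewrite le_eqVlt; apply/orP; left; apply/eqP; rewrite /N; ring.
Qed.

Section FixedSurface.
Variables (K : R) (X : R * R -> 'rV[R]_d) (w : forms R n m p d).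
Hypotheses (K0 : 0 <= K) (bXw : bounded_by K X w).

Let bX : bd rho K X. Proof. by case: bXw. Qed.
Let bc i : bd rho K (fun z => X z 0 i). Proof. exact: bd_coord. Qed.

Let hol_form_tail q (a : 'I_d -> 'M[R]_q) s t : (forall i, `|a i| <= K) ->
  0 <= s <= 1 -> 0 <= t <= 1 -> exists2 L, 0 <= L &
    hol rho 0 1 L (form_path a (tail_path X s t)).
Proof.
move=> ha hs ht; rewrite form_path_tail; have b := bd_form K0 ha bX.
exists (2 * (d%:R * K * K * 2 `^ rho)).
  by rewrite mulr_ge0 // mulr_ge0 ?powR_ge0 // !mulr_ge0.
exact (hol_tail rho_gt b hs ht).
Qed.

Lemma path_devE q (a : 'I_d -> 'M[R]_q) s t : (forall i, `|a i| <= K) ->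
  0 <= s <= 1 -> 0 <= t <= 1 ->
  path_dev rho a (tail_path X s t) = tail_dev rho (form_surface a X) (s, t).
Proof.
move=> ha hs ht; rewrite -(Dev_tail rho_gt (bd_form K0 ha bX) hs ht).
by rewrite /path_dev form_path_tail.
Qed.

Lemma form_wellposed q (a : 'I_d -> 'M[R]_q) s t : (forall i, `|a i| <= K) ->
  0 <= s <= 1 -> 0 <= t <= 1 ->
  young_wellposed rho id (form_path a (tail_path X s t)) 1%:M.
Proof.
move=> ha hs ht; have [L L0 hL] := hol_form_tail ha hs ht.
exact: (Dev_wellposed rho_gt L0 hL).
Qed.

Lemma right_factor_inv s t : 0 <= s <= 1 -> 0 <= t <= 1 ->
  path_dev rho (beta w) (tail_path X s t) *m right_factor X w (s, t) = 1%:M.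
Proof.
case: bXw => _ _ hb _ hs ht; rewrite (path_devE hb hs ht).
exact: (tail_dev_inv rho_gt (bd_form K0 hb bX)).
Qed.

Lemma path_dev_unit s t : 0 <= s <= 1 -> 0 <= t <= 1 ->
  path_dev rho (beta w) (tail_path X s t) \in unitmx.
Proof. by move=> hs ht; have /mulmx1_unit[] := right_factor_inv hs ht. Qed.

Lemma dev_integrandE i j s t : 0 <= s <= 1 -> 0 <= t <= 1 ->
  dev_integrand rho X w i j (s, t) = integrand X w i j (s, t).
Proof.
move=> hs ht; rewrite /dev_integrand /integrand /=; case: bXw => _ ha _ _.
rewrite (path_devE ha hs ht); congr (_ *m _).
rewrite -[LHS]mulmx1 -(right_factor_inv hs ht) mulmxA mulVmx ?mul1mx //.
exact: path_dev_unit.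
Qed.

Lemma bd_area i j : bd rho (4 * (1 + kappa) * (K * K)) (area X i j).
Proof.
apply: eq_bd (bd_area_form rho_gt (bc i) (bc j)) => s t hs ht.
by rewrite (areaE rho_gt i j bc hs ht).
Qed.

Lemma bd_dev_integrand C i j : bd rho C (integrand X w i j) ->
  bd rho C (dev_integrand rho X w i j).
Proof. by apply: eq_bd => s t hs ht; rewrite dev_integrandE. Qed.

End FixedSurface.

Lemma hol_dev_Z K : 0 <= K -> exists2 C, 0 <= C & forall X w,
  bounded_by K X w -> hol rho 0 1 C (dev_Z rho X w 1).
Proof.
move=> K0; have [C C0 hC] := bd_integrand K0.
pose A := 4 * (1 + kappa) * (K * K).
have k1 : 0 <= 1 + kappa by exact: addr_ge0.
have A0 : 0 <= A by rewrite /A; apply: mulr_ge0; apply: mulr_ge0.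
have B0 : 0 <= (1 + kappa) * (1 + kappa) * (C * A).
  by apply: mulr_ge0; apply: mulr_ge0.
exists (d%:R * (d%:R * ((1 + kappa) * (1 + kappa) * (C * A)))).
  by apply: mulr_ge0 => //; apply: mulr_ge0.
move=> X w bXw; apply: (hol_sum_lt (f := fun i j t =>
  young2 1 t (dev_integrand rho X w i j) (area X i j))) => // i j ij.
exact: (young2_hol rho_gt (bd_dev_integrand K0 bXw (hC _ _ _ _ bXw ij))
  (bd_area bXw i j)).
Qed.

Lemma hol_dev_ZB K : 0 <= K -> exists2 C, 0 <= C & forall e X w X' w', 0 < e ->
  bounded_by K X w -> bounded_by K X' w' -> close_by e X w X' w' ->
  hol rho 0 1 (C * e) (fun t => dev_Z rho X w 1 t - dev_Z rho X' w' 1 t).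
Proof.
move=> K0; have [C C0 hC] := bd_integrand K0.
have [D D0 hD] := bd_integrandB K0.
have [F F0 hF] := area_form_lip rho_gt K0.
pose A := 4 * (1 + kappa) * (K * K).
have k1 : 0 <= 1 + kappa by exact: addr_ge0.
have A0 : 0 <= A by rewrite /A; apply: mulr_ge0; apply: mulr_ge0.
pose c := (1 + kappa) * (1 + kappa).
have c0 : 0 <= c by exact: mulr_ge0.
pose B := c * (D * A) + c * (C * F).
have B0 : 0 <= B.
  by apply: addr_ge0; apply: mulr_ge0 => //; apply: mulr_ge0.
exists (d%:R * (d%:R * B)); first by apply: mulr_ge0 => //; apply: mulr_ge0.
move=> e X w X' w' e0 bXw bXw' cl.
have Be0 : 0 <= B * e by rewrite mulr_ge0 // ltW.
have i1 : 0 <= (1 : R) <= 1 by rewrite lexx ler01.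
(* The change of each integral is split into the change of the integrand and the change of the area
   process. *)
apply: (eq_hol (f := fun t => \sum_(i < d) \sum_(j < d | (i < j)%N)
  (young2 1 t (fun z => dev_integrand rho X w i j z
     - dev_integrand rho X' w' i j z) (area X i j)
   + young2 1 t (dev_integrand rho X' w' i j)
     (fun z => area X i j z - area X' i j z)))).
  move=> t ht; rewrite /dev_Z -sumrB; apply: eq_bigr => i _.
  rewrite -sumrB; apply: eq_bigr => j ij; apply/esym.
  pose M := C + A.
  have CM : C <= M by rewrite lerDl.
  have AM : A <= M by rewrite lerDr.
  apply: (young2_diff rho_gt (K := M) _ _ _ _ i1 ht).
  - exact: bd_le CM (bd_dev_integrand K0 bXw (hC _ _ _ _ bXw ij)).
  - exact: bd_le AM (bd_area bXw i j).
  - exact: bd_le CM (bd_dev_integrand K0 bXw' (hC _ _ _ _ bXw' ij)).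
  - exact: bd_le AM (bd_area bXw' i j).
rewrite -!mulrA; apply: hol_sum_lt => // i j ij.
have -> : B * e = c * (D * e * A) + c * (C * (F * e)) by rewrite /B; ring.
apply: holD; apply: (young2_hol rho_gt).
- apply: eq_bd (hD _ _ _ _ _ _ _ e0 bXw bXw' cl ij) => s t hs ht.
  by rewrite (dev_integrandE K0 bXw) // (dev_integrandE K0 bXw').
- exact: bd_area bXw i j.
- exact: (bd_dev_integrand K0 bXw' (hC _ _ _ _ bXw' ij)).
- have [bX _ _ _] := bXw; have [bX' _ _ _] := bXw'; have [cX _ _ _] := cl.
  have cc k : bd rho e (fun z => X z 0 k - X' z 0 k).
    apply: eq_bd (bd_coord k cX) => s t _ _; by rewrite !mxE.
  have h := hF e _ _ _ _ (ltW e0) (bd_coord i bX) (bd_coord j bX)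
    (bd_coord i bX') (bd_coord j bX') (cc i) (cc j).
  apply: eq_bd h => s t hs ht.
  by rewrite (areaE rho_gt i j (fun k => bd_coord k bX) hs ht)
    (areaE rho_gt i j (fun k => bd_coord k bX') hs ht).
Qed.

Lemma well_defined_bounded K X w : 0 <= K -> bounded_by K X w ->
  well_defined rho X w.
Proof.
move=> K0 bXw; have [bX ha hb hg] := bXw.
have bc k : bd rho K (fun z => X z 0 k) by exact: bd_coord.
have [C C0 hC] := hol_dev_Z K0; have hZ := hC _ _ bXw.
have [D D0 hD] := bd_integrand K0.
split.
- move=> s t hs ht; split.
  + exact: (form_wellposed K0 bXw ha hs ht).
  + exact: (form_wellposed K0 bXw hb hs ht).
  + exact: (path_dev_unit K0 bXw hs ht).
- move=> i j s t ij hs ht; split.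
    by move=> u hu; exact: (area_inner_integrable rho_gt i bc hs ht hu).
  exact: (area_integrable rho_gt i j bc hs ht).
- move=> i j s t ij hs ht.
  have bi := bd_dev_integrand K0 bXw (hD _ _ _ _ bXw ij).
  have ba := bd_area bXw i j; split.
  + apply: (bd_holder_space rho_gt) (@frobenius_le _ _ _) bi.
    exact: sqrtr_ge0.
  + apply: (bd_holder_space rho_gt ler01) ba => x; by rewrite mul1r.
  + by apply/cvg_ex; eexists; exact: (young2_exists rho_gt bi ba hs ht).
- exact: (dev_wellposed rho_gt C0 hZ).
- rewrite /surface_dev (dev_endpoint rho_gt C0 hZ).
  exact: (dev_endpoint_GL1 rho_gt C0 hZ).
Qed.

Lemma surface_dev_lip K : 0 <= K -> exists2 C, 0 <= C & forall e X w X' w',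
  0 < e -> bounded_by K X w -> bounded_by K X' w' -> close_by e X w X' w' ->
  `|surface_dev rho X w - surface_dev rho X' w'| <= C * e.
Proof.
move=> K0; have [C C0 hC] := hol_dev_Z K0; have [D D0 hD] := hol_dev_ZB K0.
have N0 : 0 <= C + D by rewrite addr_ge0.
have [F F0 hF] := dev_sol_lip rho_gt n m p N0; exists F => //.
move=> e X w X' w' e0 bXw bXw' cl.
have hZ := hC _ _ bXw; have hZ' := hC _ _ bXw'.
have hd := hD _ _ _ _ _ e0 bXw bXw' cl.
have e1 : surface_dev rho X w = dev_sol rho (dev_Z rho X w 1) 1.
  exact: (dev_endpoint rho_gt C0 hZ).
have e2 : surface_dev rho X' w' = dev_sol rho (dev_Z rho X' w' 1) 1.
  exact: (dev_endpoint rho_gt C0 hZ').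
rewrite [X in `|X - _|]e1 [X in `|_ - X|]e2.
have le1 : C <= C + D by rewrite lerDl.
have le2 : D * e <= (C + D) * e by rewrite ler_wpM2r ?(ltW e0) // lerDr.
exact: (hF e _ _ e0 (hol_le le1 hZ) (hol_le le1 hZ') (hol_le le2 hd)).
Qed.

Lemma holder_space_bounded X w :
  holder_space (@frobenius R 1 d) rho X ->
  exists2 K, 0 <= K & bounded_by K X w.
Proof.
move=> hX; have [K K0 bX] := holder_space_bd (@normr_frobenius R 1 d) hX.
pose A := \sum_i `|alpha w i|; pose B := \sum_i `|beta w i|.
pose G := \sum_i \sum_j `|gamma w i j|.
have A0 : 0 <= A by apply: sumr_ge0.
have B0 : 0 <= B by apply: sumr_ge0.
have G0 : 0 <= G by apply: sumr_ge0 => i _; apply: sumr_ge0.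
have term (I : finType) (f : I -> R) i : (forall i, 0 <= f i) -> f i <= \sum_i f i.
  by move=> f0; rewrite (bigD1 i) //= lerDl sumr_ge0.
exists (K + A + B + G); first by rewrite !addr_ge0.
split.
- by apply: bd_le bX; rewrite -!addrA lerDl !addr_ge0.
- move=> i; apply: (@le_trans _ _ A); first exact: (term _ (fun i => `|alpha w i|)).
  by rewrite -addrA addrAC lerDr addr_ge0 // addr_ge0.
- move=> i; apply: (@le_trans _ _ B); first exact: (term _ (fun i => `|beta w i|)).
  by rewrite addrAC lerDr addr_ge0 // addr_ge0.
- move=> i j _; apply: (@le_trans _ _ G); last by rewrite lerDr !addr_ge0.
  apply: le_trans (term _ (fun j => `|gamma w i j|) j _) _ => //.
  apply: (term _ (fun i => \sum_j `|gamma w i j|)) => k; exact: sumr_ge0.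
Qed.

Lemma dist_conn_close r (w w' : forms R n m p d) : dist_conn w w' <= r ->
  [/\ forall i, `|alpha w i - alpha w' i| <= r,
      forall i, `|beta w i - beta w' i| <= r &
      forall i j : 'I_d, (i < j)%N -> `|gamma w i j - gamma w' i j| <= r].
Proof.
rewrite /dist_conn; set A := \sum_i _; set B := \sum_i _; set G := \sum_i _.
have A0 : 0 <= A by apply: sumr_ge0 => *; exact: sqr_ge0.
have B0 : 0 <= B by apply: sumr_ge0 => *; exact: sqr_ge0.
have G0 : 0 <= G by do 2 (apply: sumr_ge0 => ? _); exact: sqr_ge0.
move=> hr; have up q k (x : 'M[R]_(q, k)) : frobenius x ^+ 2 <= A + B + G -> `|x| <= r.
  move=> h; apply: le_trans (normr_frobenius x) _; apply: le_trans hr.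
  rewrite -[frobenius x]ger0_norm ?sqrtr_ge0 // -sqrtr_sqr ler_sqrt //.
  by rewrite !addr_ge0.
split=> [i|i|i j ij]; apply: up.
- rewrite /A (bigD1 i) //= -!addrA lerDl; apply: addr_ge0.
    by apply: sumr_ge0 => *; exact: sqr_ge0.
  exact: addr_ge0.
- rewrite addrAC /B (bigD1 i) //= addrCA lerDl; apply: addr_ge0.
    exact: addr_ge0.
  by apply: sumr_ge0 => *; exact: sqr_ge0.
- rewrite /G (bigD1 i) //= (bigD1 j) //= -[X in _ <= _ + X]addrA (addrCA (A + B)) lerDl.
  apply: addr_ge0; first exact: addr_ge0.
  apply: addr_ge0; first by apply: sumr_ge0 => *; exact: sqr_ge0.
  by do 2 (apply: sumr_ge0 => ? _); exact: sqr_ge0.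
Qed.

Lemma dist_dom_close r X w X' w' :
  (dist_dom rho (X, w) (X', w') <= r%:E)%E -> close_by r X w X' w'.
Proof.
rewrite /dist_dom /= => h.
have c0 : (0 <= (dist_conn w w')%:E)%E by rewrite lee_fin sqrtr_ge0.
have h0 : (0 <= holder_norm (@frobenius R 1 d) rho (fun z => X z - X' z)%R)%E.
  by apply: holder_norm_ge0; exact: normr_frobenius.
have h1 : (holder_norm (@frobenius R 1 d) rho (fun z => X z - X' z)%R <= r%:E)%E.
  by apply: le_trans h; rewrite leeDl.
have h2 : dist_conn w w' <= r.
  by rewrite -lee_fin; apply: le_trans h; rewrite leeDr.
have [ca cb cg] := dist_conn_close h2.
by split=> //; exact: holder_norm_bd (@normr_frobenius R 1 d) h1.
Qed.

Lemma close_by_le e r X w X' w' : e <= r ->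
  close_by e X w X' w' -> close_by r X w X' w'.
Proof.
move=> er [cX ca cb cg]; split=> [|i|i|i j ij]; first exact: bd_le cX.
- exact: le_trans (ca i) er.
- exact: le_trans (cb i) er.
- exact: le_trans (cg i j ij) er.
Qed.

(** Makes the constants uniform on the unit ball around a given pair. *)
Lemma bounded_by_close K X w X' w' : bounded_by K X w ->
  close_by 1 X w X' w' -> bounded_by (K + 1) X' w'.
Proof.
move=> [bX ha hb hg] [cX ca cb cg].
have near q k (x y : 'M[R]_(q, k)) : `|x| <= K -> `|x - y| <= 1 -> `|y| <= K + 1.
  move=> hx hxy; rewrite (_ : y = x - (x - y)); last by zmod.
  by apply: le_trans (ler_normB _ _) _; rewrite lerD.
split.
- apply: eq_bd (bdB bX cX) => s t _ _; by zmod.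
- by move=> i; exact: near (ha i) (ca i).
- by move=> i; exact: near (hb i) (cb i).
- by move=> i j ij; exact: near (hg i j ij) (cg i j ij).
Qed.

End SurfaceDevelopment.

Theorem theorem6p4 (R : realType) (d n m p : nat) (rho : R)
    (d_ge1 : (1 <= d)%N) (rho_range : 1 / 2 < rho <= 1) :
  (forall (X : R * R -> 'rV[R]_d) (w : forms R n m p d),
     holder_space (@frobenius R 1 d) rho X -> matrix_conn w ->
     well_defined rho X w) /\
  locally_lipschitz
    (holder_space (@frobenius R 1 d) rho `*` @matrix_conn R n m p d)
    (@dist_dom R d rho n m p)
    (fun h1 h2 : 'M[R]_(n + m, n + p) => frobenius (h1 - h2))
    (fun a => surface_dev rho a.1 a.2).
Proof.
have rho_gt : 1 / 2 < rho by case/andP: rho_range.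
split=> [X w hX _|[X0 w0] [/= hX0 _]].
  have [K K0 bK] := holder_space_bounded w hX.
  exact: (well_defined_bounded rho_gt K0 bK).
have [K K0 bK] := holder_space_bounded w0 hX0.
have K10 : 0 <= K + 1 by rewrite addr_ge0.
have [C C0 hC] := surface_dev_lip rho_gt d n m p K10.
pose N := Num.sqrt ((n + m) * (n + p))%:R : R.
have N0 : 0 <= N by exact: sqrtr_ge0.
(* [N] compares the Frobenius norm with the maximum norm; the summand 1 keeps the constant positive,
   so that its product with an infinite distance is infinite. *)
exists 1, (N * C + 1); split; first exact: ltr01.
move=> [X w] [X' w'] _ _ /ltW/dist_dom_close/(bounded_by_close bK) bXw.
move=> /ltW/dist_dom_close/(bounded_by_close bK) bXw' /=.
have NC : 0 < N * C + 1 by rewrite ltr_wpDl // mulr_ge0.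
have close r : (dist_dom rho (X, w) (X', w') <= r%:E)%E ->
    0 <= r /\ close_by rho r X w X' w'.
  by move=> /dist_dom_close h; split=> //; case: h => /bd_ge0.
case D : (dist_dom rho (X, w) (X', w')) close => [r| |] close.
- rewrite -EFinM lee_fin; have [r0 cl] := close r (lexx _).
  apply: le_trans (frobenius_le _) _.
  have h : `|surface_dev rho X w - surface_dev rho X' w'| <= C * r.
    (* The distance [r] may be 0, so the estimate is applied with the positive number
       [r + e / (C + 1)]. *)
    apply/ler_addgt0Pr => e e0; have C1 : 0 < C + 1 by rewrite ltr_wpDl.
    have e1 : 0 < e / (C + 1) by rewrite divr_gt0.
    have re : r <= r + e / (C + 1) by rewrite lerDl ltW.
    apply: le_trans (hC _ _ _ _ _ _ bXw bXw' (close_by_le re cl)) _.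
      by rewrite ltr_wpDl.
    rewrite mulrDr lerD2l mulrCA ger_pMr // ler_pdivrMr // mul1r.
    by rewrite lerDl.
  apply: le_trans (ler_wpM2l N0 h) _.
  by rewrite mulrA mulrDl lerDl mul1r.
- by rewrite gt0_muley ?lte_fin // leey.
(* A distance equal to [-oo] would be at most -1, although every real upper bound is nonnegative. *)
- by have [] := close (-1) (leNye _); rewrite lerNr oppr0 ler10.
Qed.
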